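(* Let $\varphi:\mathbb{R}\to\mathbb{R}$ be continuous and nondecreasing, let $\mu\ge0$ be an even Radon measure on $\mathbb{R}^N\setminus\{0\}$ with $\int_{|z|\le1}|z|^2\mu(\mathrm{d}z)+\int_{|z|>1}\mu(\mathrm{d}z)<\infty$, and let $u_0\in L^1(\mathbb{R}^N)\cap L^\infty(\mathbb{R}^N)$. Then there exists an energy solution $u$ of $\partial_tu-\mathcal{L}^\mu[\varphi(u)]=0$ in $Q_T$, $u(\cdot,0)=u_0$ on $\mathbb{R}^N$, satisfying $$u\in L^1(Q_T)\cap L^\infty(Q_T)\cap C([0,T];L^1_{\mathrm{loc}}(\mathbb{R}^N)).$$
   Context: $T>0$, $Q_T:=\mathbb{R}^N\times(0,T)$; $\mu$ even means $\mu(B)=\mu(-B)$ for all Borel $B$. The operator is $\mathcal{L}^\mu[\phi](x)=\int_{\mathbb{R}^N\setminus\{0\}}\big(\phi(x+z)-\phi(x)-z\cdot D\phi(x)\mathbf{1}_{|z|\le1}\big)\mu(\mathrm{d}z)$. Set $\mathcal{E}_\mu[f,g]:=\frac12\int_{\mathbb{R}^N}\int_{|z|>0}(f(x+z)-f(x))(g(x+z)-g(x))\,\mu(\mathrm{d}z)\mathrm{d}x$, $|f|_{E_\mu}^2:=\mathcal{E}_\mu[f,f]$, and $L^2(0,T;E_\mu(\mathbb{R}^N)):=\{f:Q_T\to\mathbb{R}\text{ measurable}:\int_0^T|f(\cdot,t)|_{E_\mu}^2\mathrm{d}t<\infty\}$. Energy solution: $u\in L^1_{\mathrm{loc}}(Q_T)$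 with $\varphi(u)\in L^2(0,T;E_\mu(\mathbb{R}^N))$ and, for all $\psi\in C_c^\infty(\mathbb{R}^N\times[0,T))$, $\int_0^T\big(\int_{\mathbb{R}^N}u\,\partial_t\psi\,\mathrm{d}x-\mathcal{E}_\mu[\varphi(u),\psi]\big)\mathrm{d}t+\int_{\mathbb{R}^N}u_0(x)\psi(x,0)\,\mathrm{d}x=0$. *)

(* Defs.v *)
From HB Require Import structures.
From mathcomp Require Import all_boot all_order all_algebra.
From mathcomp Require Import all_classical all_reals all_analysis.
From mathcomp Require Import measurable_realfun.
From mathcomp Require Import ring lra.

Set Implicit Arguments.
Unset Strict Implicit.
Unset Printing Implicit Defensive.

Import Order.TTheory GRing.Theory Num.Theory.
Import numFieldNormedType.Exports.

Local Open Scope classical_set_scope.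
Local Open Scope ring_scope.

Section measurable_rV.
Variables (R : realType) (n : nat).

Definition rV_coord (i : 'I_n) (x : 'rV[R]_n) : R := x ord0 i.

(* The sigma-algebra is the product one, as the library does for tuples;
   [open_measurable_rV] below shows that it contains the open sets, so that it
   is the Borel sigma-algebra. *)
Let rV_set0 : g_sigma_preimage rV_coord set0.
Proof. exact: sigma_algebra0. Qed.

Let rV_setC A : g_sigma_preimage rV_coord A -> g_sigma_preimage rV_coord (~` A).
Proof. exact: sigma_algebraC. Qed.

Let rV_bigcup (F : (set 'rV[R]_n)^nat) :
  (forall i, g_sigma_preimage rV_coord (F i)) ->
  g_sigma_preimage rV_coord (\bigcup_i (F i)).
Proof. exact: sigma_algebra_bigcup. Qed.

Fact rV_display : measure_display. Proof. exact: default_measure_display. Qed.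

HB.instance Definition _ := @isMeasurable.Build rV_display
  'rV[R]_n (g_sigma_preimage rV_coord) rV_set0 rV_setC rV_bigcup.

End measurable_rV.


Section measurable_rV_theory.
Variable R : realType.

Lemma measurable_rV_coord n (i : 'I_n) :
  measurable_fun [set: 'rV[R]_n] (fun x => x ord0 i).
Proof.
move=> _ Y mY; rewrite setTI; apply: sub_sigma_algebra => /=.
rewrite -bigcup_seq/=; exists i => /=; first by rewrite mem_index_enum.
by exists Y => //; rewrite setTI.
Qed.

Lemma measurable_fun_rV d (T : measurableType d) n (f : T -> 'rV[R]_n) :
  (forall i, measurable_fun [set: T] (fun t => f t ord0 i)) ->
  measurable_fun [set: T] f.
Proof.
move=> mf.
suff H : g_sigma_preimage (fun i => @rV_coord R n i \o f) `<=` measurable.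
  rewrite g_sigma_preimage_comp in H.
  by move=> _ A mA; apply: H; exists A.
apply: smallest_sub; first exact: sigma_algebra_measurable.
rewrite -bigcup_seq; apply: bigcup_sub => i _.
by move=> A [B mB <-]; exact: mf.
Qed.

Lemma measurable_rV_box n (A : 'I_n -> set R) :
  (forall i, measurable (A i)) ->
  measurable [set x : 'rV[R]_n | forall i, A i (x ord0 i)].
Proof.
move=> mA.
have -> : [set x : 'rV[R]_n | forall i, A i (x ord0 i)] =
    \big[setI/setT]_(i < n) ((fun x : 'rV[R]_n => x ord0 i) @^-1` A i).
  rewrite -bigcap_seq; apply/seteqP; split=> x /= Ax i; first by move=> _; exact: Ax.
  by apply: Ax; rewrite /= mem_index_enum.
apply: big_ind => [||i _]; [by []|exact: measurableI|].
by rewrite -[X in measurable X]setTI; exact: measurable_rV_coord.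
Qed.

Lemma open_measurable_rV n (A : set 'rV[R]_n) : open A -> measurable A.
Proof.
move=> oA.
pose B (qe : 'rV[rat]_n * rat) : set 'rV[R]_n :=
  [set x | forall i, `|ratr (qe.1 ord0 i) - x ord0 i| < ratr qe.2].
have mB qe : measurable (B qe).
  apply: (@measurable_rV_box n
    (fun i => [set r : R | `|ratr (qe.1 ord0 i) - r| < ratr qe.2])) => i.
  apply: open_measurable; exact: (@ball_open _ R^o (ratr (qe.1 ord0 i)) (ratr qe.2)).
have -> : A = \bigcup_qe (if `[< B qe `<=` A >] then B qe else set0).
  apply/seteqP; split=> [x Ax|x [qe _]]; last first.
    by case: asboolP => // + Bx; exact.
  have /nbhs_ballP[e /= e0 xeA] : nbhs x A by apply: open_nbhs_nbhs; split.
  have [q /=] := @rat_in_itvoo R 0 (e / 2) (divr_gt0 e0 (ltr0Sn _ _)).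
  rewrite in_itv/= => /andP[q0 qe].
  have H i : exists r : rat, `|ratr r - x ord0 i| < ratr q.
    have [r /=] := @rat_in_itvoo R (x ord0 i) (x ord0 i + ratr q) (ltr_pwDr q0 (lexx _)).
    rewrite in_itv/= => /andP[r0 re]; exists r.
    by rewrite gtr0_norm; lra.
  exists (\row_i projT1 (cid (H i)), q) => //.
  have Bx : B (\row_i projT1 (cid (H i)), q) x.
    by move=> i; rewrite /= mxE; exact: projT2 (cid (H i)).
  case: asboolP => // -[] y By; apply: xeA; split=> // i j.
  rewrite (ord1 i) /ball/=; have := By j; have := Bx j => /= Hx Hy.
  rewrite (_ : _ - _ = (ratr ((\row_i0 projT1 (cid (H i0))) ord0 j) - y ord0 j) -
     (ratr ((\row_i0 projT1 (cid (H i0))) ord0 j) - x ord0 j)); last by ring.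
  by apply: le_lt_trans (ler_normB _ _) _; lra.
apply: countable_bigcupT_measurable => // qe.
by case: asboolP => // _; exact: measurable0.
Qed.

Definition rV_cons n (p : R * 'rV[R]_n) : 'rV[R]_n.+1 :=
  \row_i (if unlift ord0 i is Some j then p.2 ord0 j else p.1).

Lemma measurable_rV_cons n : measurable_fun [set: R * 'rV[R]_n] (@rV_cons n).
Proof.
apply: measurable_fun_rV => i.
under eq_fun do rewrite mxE.
case: unliftP => [j _|_]; last exact: measurable_fst.
apply: (@measurableT_comp _ _ _ _ _ _ (fun v : 'rV[R]_n => v ord0 j)) => //.
exact: measurable_rV_coord.
Qed.

End measurable_rV_theory.

Section lebesgue_rV_cons.
Variables (R : realType) (n : nat).
Variable m : {sigma_finite_measure set 'rV[R]_n -> \bar R}.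

Definition lebesgue_rV_cons : set 'rV[R]_n.+1 -> \bar R :=
  pushforward (lebesgue_measure \x m)%E (@rV_cons R n).

Let mcons : measurable_fun [set: R * 'rV[R]_n] (@rV_cons R n).
Proof. exact: measurable_rV_cons. Qed.

Let cons0 : lebesgue_rV_cons set0 = 0%E.
Proof. by rewrite /lebesgue_rV_cons /pushforward preimage_set0 measure0. Qed.

Let cons_ge0 A : (0 <= lebesgue_rV_cons A)%E.
Proof. exact: measure_ge0. Qed.

Let cons_sigma_additive : semi_sigma_additive lebesgue_rV_cons.
Proof.
move=> F mF tF mUF; rewrite /lebesgue_rV_cons /pushforward preimage_bigcup.
apply: measure_semi_sigma_additive.
- by move=> k; rewrite -[X in measurable X]setTI; exact: mcons.
- apply/trivIsetP => /= i j _ _ ij; rewrite -preimage_setI.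
  by move/trivIsetP : tF => /(_ _ _ _ _ ij) ->//; rewrite preimage_set0.
- by rewrite -preimage_bigcup -[X in measurable X]setTI; exact: mcons.
Qed.

HB.instance Definition _ := isMeasure.Build _ _ _
  lebesgue_rV_cons cons0 cons_ge0 cons_sigma_additive.

Let cons_sigma_finite : sigma_finite setT lebesgue_rV_cons.
Proof.
have /sigma_finiteP[F [TF ndF Foo]] := sigma_finiteT (@lebesgue_measure R).
have /sigma_finiteP[G [TG ndG Goo]] := sigma_finiteT m.
pose H k := F k `*` G k.
have HT : setT = \bigcup_k H k.
  rewrite -setXTT TF TG predeqE => -[x y]; split.
    move=> [/= [i _ Fix] [k _ Gky]]; exists (maxn i k) => //; split.
    - by move: x Fix; exact/subsetPset/ndF/leq_maxl.
    - by move: y Gky; exact/subsetPset/ndG/leq_maxr.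
  by move=> [k _ []/= ? ?]; split; exists k.
have Hoo k : measurable (H k) /\ ((lebesgue_measure \x m) (H k) < +oo)%E.
  have [? ?] := Foo k; have [? ?] := Goo k.
  split; first exact: measurableX.
  by rewrite product_measure1E// lte_mul_pinfty// ge0_fin_numE.
pose g (v : 'rV[R]_n.+1) := (v ord0 ord0, \row_j v ord0 (lift ord0 j) : 'rV[R]_n).
have mg : measurable_fun setT g.
  apply: measurable_fun_pair; first exact: measurable_rV_coord.
  by apply: measurable_fun_rV => i; under eq_fun do rewrite mxE;
    exact: measurable_rV_coord.
have gK p : g (rV_cons p) = p.
  case: p => x v; rewrite /g !mxE unlift_none; congr (_, _).
  by apply/rowP => j; rewrite !mxE liftK.
exists (fun k => g @^-1` H k).
  by rewrite -preimage_bigcup -HT preimage_setT.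
move=> k; have [mH Hk] := Hoo k; split.
  by rewrite -[X in measurable X]setTI; exact: mg.
rewrite /lebesgue_rV_cons /pushforward -comp_preimage.
by rewrite (_ : g \o _ = id) //; apply/funext => p /=; rewrite gK.
Qed.

HB.instance Definition _ := Measure_isSigmaFinite.Build _ _ _
  lebesgue_rV_cons cons_sigma_finite.

End lebesgue_rV_cons.

(* Iterated product of the Lebesgue measure of the line; see [lebesgue_rV_box]. *)
Fixpoint lebesgue_rV (R : realType) (n : nat) :
    {sigma_finite_measure set 'rV[R]_n -> \bar R} :=
  match n with
  | 0 => \d_(0 : 'rV[R]_0)
  | n'.+1 => lebesgue_rV_cons (lebesgue_rV R n')
  end.

Lemma lebesgue_rV_box (R : realType) n (A : 'I_n -> set R) :
  (forall i, measurable (A i)) ->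
  lebesgue_rV R n [set x | forall i, A i (x ord0 i)] =
  (\prod_(i < n) lebesgue_measure (A i))%E.
Proof.
elim: n A => [|n IHn] A mA.
  rewrite big_ord0 /= diracE mem_set//.
  by move=> /= -[].
rewrite big_ord_recl -IHn// /= /lebesgue_rV_cons /pushforward.
rewrite -product_measure1E; last 2 first.
- exact: mA.
- exact: (@measurable_rV_box R n (fun i => A (lift ord0 i))).
congr ((_ \x _)%E _); apply/seteqP; split=> [[x v] Hxv|[x v] [Ax Av] i] /=.
  split => [|i] /=; first by have := Hxv ord0; rewrite /= mxE unlift_none.
  by have := Hxv (lift ord0 i); rewrite /= mxE liftK.
by rewrite mxE; case: unliftP => [j|] ->.
Qed.

Notation lebesgue_rV_time R N :=
  (lebesgue_rV R N \x @lebesgue_measure R)%E.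

Section spaces.
Variables (R : realType) (N : nat).
Implicit Types (T : R) (v : 'rV[R]_N -> R) (u f : 'rV[R]_N * R -> R).

Definition Q_ T : set ('rV[R]_N * R) := [set: 'rV[R]_N] `*` `]0, T[.

Definition L1loc_space v : Prop :=
  measurable_fun setT v /\
  forall K : set 'rV[R]_N, compact K -> (lebesgue_rV R N).-integrable K (EFin \o v).

Definition L1loc_Q T u : Prop :=
  measurable_fun (Q_ T) u /\
  forall K : set ('rV[R]_N * R), K `<=` Q_ T -> compact K ->
    (lebesgue_rV_time R N).-integrable K (EFin \o u).

(* [u] is only given almost everywhere: membership in [C([0,T]; L^1_loc)]
   means that [t |-> u(., t)] has a representative [w], defined on the closed
   interval, which is continuous for the seminorms [L^1(K)], [K] compact. *)
Definition C_L1loc T u : Prop :=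
  exists w : R -> 'rV[R]_N -> R,
  [/\ forall t, 0 <= t <= T -> L1loc_space (w t),
      forall (K : set 'rV[R]_N) (s : R), compact K -> 0 <= s <= T ->
        (\int[lebesgue_rV R N]_(x in K) `|w t x - w s x|%:E)%E
          @[t --> within `[0, T] (nbhs s)] --> 0%E &
      \forall t \ae (@lebesgue_measure R), 0 < t < T ->
        \forall x \ae lebesgue_rV R N, u (x, t) = w t x].

(* All iterated directional derivatives of order at most [k] exist and are
   continuous, which on a finite-dimensional space is [C^k]. *)
Fixpoint Ck (V : normedModType R) (k : nat) (f : V -> R) : Prop :=
  continuous f /\
  match k with
  | 0 => True
  | k'.+1 => forall e : V, (forall x, derivable f x e) /\ Ck k' ('D_e f)
  end.

Definition smooth (V : normedModType R) (f : V -> R) : Prop :=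
  forall k, Ck k f.

(* [C_c^oo(R^N x [0, T[)], its elements being represented by smooth functions
   on [R^N x R]; their values at times outside [0, T[ are irrelevant. *)
Definition test_function T (psi : 'rV[R]_N * R -> R) : Prop :=
  let supp := closure [set p | 0 <= p.2 < T /\ psi p != 0] in
  [/\ smooth psi, compact supp & supp `<=` [set p | 0 <= p.2 < T]].

End spaces.

Section energy.
Variables (R : realType) (N : nat).
Implicit Types (mu : {measure set 'rV[R]_N -> \bar R}) (T : R).

(* The library norm of ['rV[R]_N] is the sup norm. *)
Definition eucl_norm (z : 'rV[R]_N) : R := Num.sqrt (\sum_i z ord0 i ^+ 2).

(* A measure on [R^N \ {0}] is a Borel measure on [R^N] without mass at [0]; it
   is Radon when it is finite on the compact subsets of [R^N \ {0}] (regularity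
   is automatic there). *)
Definition punctured_radon mu : Prop :=
  mu [set 0] = 0%E /\
  forall K : set 'rV[R]_N, compact K -> K `<=` ~` [set 0] -> (mu K < +oo)%E.

Definition even_measure mu : Prop :=
  forall B : set 'rV[R]_N, measurable B -> mu B = mu [set - z | z in B].

Definition levy_integrable mu : Prop :=
  (\int[mu]_(z in [set z | (eucl_norm z <= 1)%R]) (eucl_norm z ^+ 2)%:E +
   \int[mu]_(z in [set z | (1 < eucl_norm z)%R]) 1 < +oo)%E.

Definition energy_form mu (f g : 'rV[R]_N -> R) : \bar R :=
  ((2^-1)%:E *
   \int[lebesgue_rV R N]_x \int[mu]_(z in [set z | (0 < eucl_norm z)%R])
     ((f (x + z) - f x) * (g (x + z) - g x))%:E)%E.

Definition L2_energy T mu (f : 'rV[R]_N * R -> R) : Prop :=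
  measurable_fun (Q_ T) f /\
  (\int[lebesgue_measure]_(t in `]0%R, T[)
     energy_form mu (fun x => f (x, t)) (fun x => f (x, t)) < +oo)%E.

Definition time_derivative (psi : 'rV[R]_N * R -> R) (p : 'rV[R]_N * R) : R :=
  derive1 (fun t : R => psi (p.1, t)) p.2.

(* Weak formulation of [d_t u - L^mu[phi(u)] = 0], [u(., 0) = u0]: the operator
   [L^mu] enters only through its energy form. *)
Definition energy_solution T (phi : R -> R) mu (u0 : 'rV[R]_N -> R)
    (u : 'rV[R]_N * R -> R) : Prop :=
  [/\ L1loc_Q T u, L2_energy T mu (phi \o u) &
      forall psi, test_function T psi ->
      (\int[lebesgue_measure]_(t in `]0%R, T[)
         (\int[lebesgue_rV R N]_x (u (x, t) * time_derivative psi (x, t))%:E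
          - energy_form mu (fun x => phi (u (x, t))) (fun x => psi (x, t)))
       + \int[lebesgue_rV R N]_x (u0 x * psi (x, 0))%:E = 0)%E].

End energy.

(* Main.v *)
Require Import Defs.
From HB Require Import structures.
From mathcomp Require Import all_boot all_order all_algebra.
From mathcomp Require Import all_classical all_reals all_analysis.
From mathcomp Require Import measurable_realfun ess_sup_inf.
From mathcomp Require Import ring lra.

Set Implicit Arguments.
Unset Strict Implicit.
Unset Printing Implicit Defensive.

Import Order.TTheory GRing.Theory Num.Theory.
Import numFieldNormedType.Exports.

Local Open Scope classical_set_scope.
Local Open Scope ring_scope.

(** The solution is a limit of explicit Euler approximations of tamed problems. The nonlinearity,
    normalised by [phi 0 = 0], is replaced by monotone Lipschitz functions converging to it
    uniformly on [-M, M], where M bounds the datum, and the Levy measure by its restriction to |z| >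
    1/(n+1), which is finite and even. One step is u + delta * L[phi(u)] with the truncated operator
    L ([scheme_step]). Under a CFL condition s - delta * mass * phi(s) is nondecreasing in s, which
    makes the step monotone: it preserves the bound M ([step_bounded]) and contracts L1 distances
    ([step_contraction]). As it commutes with translations, the approximations inherit the L1
    modulus of translation of the datum ([iterate_translation]). With Phi the convex primitive of
    phi, testing the step with phi(u) gives a discrete energy inequality ([energy_step]), hence a
    bound on the energy of phi(u) independent of n ([u_energy]).

    Compactness. In space, the modulus of translation of the datum tends to 0 by continuity of
    translations in L1 ([ltc_integrable]). In time, the weak form of the scheme is tested with a
    translated tent function; by Young's inequality the change of a mollified value is paid for by a
    small multiple of the energy bound and by a multiple of the elapsed time ([u_weak]). The
    mollified approximations are thus bounded and equicontinuous, and an Arzela-Ascoli argument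
    along an ultrafilter ([moll_ultra]) controls them uniformly on compact sets. Undoing the
    mollification gives a subsequence that is Cauchy in L1 on balls, uniformly in time, and
    summability of its steps gives convergence at almost every x for every t in [0, T]
    ([exists_limit]). Fatou's lemma carries the bounds and the modulus of continuity in time over to
    the limit.

    Passage to the limit. Summation by parts turns the scheme into a discrete weak identity
    ([iterate_weak_sum]). Its nonlinear term pairs increments of phi(u), bounded in L2 and
    convergent almost everywhere, with increments of the test function, whose squares have one
    integrable majorant thanks to the Levy condition. For such pairs the integrals of the products
    converge ([weak_limit]), and [test_limit] obtains the limit equation. What remains is to rewrite
    integrals over time, space and jumps as the iterated integrals of the definition, to modify the
    datum on a null set, and to note that only increments of phi enter. *)

(** * Measure-preserving maps and integrals *)

Section preserving_maps.
Context d (X : measurableType d) (R : realType).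
Variables (m : {measure set X -> \bar R}) (s : X -> X).
Hypotheses (ms : measurable_fun setT s)
  (s_pres : forall A, measurable A -> m (s @^-1` A) = m A).
Local Open Scope ereal_scope.

Lemma ge0_integral_preserving (f : X -> \bar R) :
  measurable_fun setT f -> (forall x, 0 <= f x) ->
  \int[m]_x f (s x) = \int[m]_x f x.
Proof.
move=> mf f0.
rewrite -[LHS](@ge0_integral_pushforward _ _ _ _ _ _ ms m setT f)//.
by apply: eq_measure_integral => A mA _; exact: s_pres.
Qed.

Lemma integral_preserving (f : X -> \bar R) : measurable_fun setT f ->
  \int[m]_x f (s x) = \int[m]_x f x.
Proof.
move=> mf; rewrite integralE [RHS]integralE; congr (_ - _).
- have := ge0_integral_preserving (measurable_funepos mf) (funepos_ge0 f).
  by under eq_integral do rewrite /= funeposE; move=> <-; apply: eq_integral => x _; rewrite funeposE.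
- have := ge0_integral_preserving (measurable_funeneg mf) (funeneg_ge0 f).
  by under eq_integral do rewrite /= funenegE; move=> <-; apply: eq_integral => x _; rewrite funenegE.
Qed.

Lemma integrable_preserving (f : X -> \bar R) :
  m.-integrable setT f -> m.-integrable setT (f \o s).
Proof.
move=> /integrableP[mf foo]; apply/integrableP; split.
  exact: measurableT_comp.
rewrite (ge0_integral_preserving (f := fun x => `|f x|))//.
exact: measurableT_comp.
Qed.

End preserving_maps.
Arguments ge0_integral_preserving {d X R} m s _ _ f.
Arguments integral_preserving {d X R} m s _ _ f.
Arguments integrable_preserving {d X R} m s _ _ f.

Lemma measurable_comp_fun d1 d2 d3 (T1 : measurableType d1)
    (T2 : measurableType d2) (T3 : measurableType d3) (f : T2 -> T3) (g : T1 -> T2) :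
  measurable_fun setT f -> measurable_fun setT g ->
  measurable_fun setT (fun x => f (g x)).
Proof. exact: measurableT_comp. Qed.

(** * Translation invariance of Lebesgue measure and reversal of jumps *)

Section translation.
Variable R : realType.

(** The pushforward under the translation agrees with Lebesgue measure on half-open intervals, and
    these determine the measure. *)
Lemma lebesgue_measure_shift (y : R) (A : set R) : measurable A ->
  lebesgue_measure ((fun x => x + y) @^-1` A) = lebesgue_measure A.
Proof.
move=> mA.
have ms : measurable_fun setT (fun x : R => x + y).
  by apply: measurable_funD => //; exact: measurable_cst.
apply/esym.
pose s : {mfun measurableTypeR R >-> measurableTypeR R} :=
  HB.pack (fun x : R => x + y)
    (@isMeasurableFun.Build _ _ (measurableTypeR R) (measurableTypeR R) _ ms).
apply: (@lebesgue_measure_unique R (pushforward (@lebesgue_measure R) s)) => //.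
move=> _ [[a b] _ <-] /=.
rewrite /pushforward.
have -> : s @^-1` `]a, b] = `]a - y, b - y]%classic.
  apply/seteqP; split => x /=; rewrite /s !in_itv/= => /andP[? ?]; apply/andP; split; lra.
rewrite !lebesgue_measure_itv/= !lte_fin ltrD2r.
by case: ifP => // _; rewrite -!EFinB; congr EFin; ring.
Qed.

Lemma measurable_shift N (y : 'rV[R]_N) :
  measurable_fun setT (fun x : 'rV[R]_N => x + y).
Proof.
apply: measurable_fun_rV => i.
under eq_fun do rewrite mxE.
by apply: measurable_funD; [exact: measurable_rV_coord|exact: measurable_cst].
Qed.

Lemma measurable_addrV N :
  measurable_fun setT (fun p : 'rV[R]_N * 'rV[R]_N => p.1 + p.2).
Proof.
apply: measurable_fun_rV => i.
under eq_fun do rewrite mxE.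
by apply: measurable_funD;
  apply: (@measurableT_comp _ _ _ _ _ _ (fun v : 'rV[R]_N => v ord0 i)) => //;
  exact: measurable_rV_coord.
Qed.

Lemma measurable_opprV N : measurable_fun setT (fun x : 'rV[R]_N => - x).
Proof.
apply: measurable_fun_rV => i.
under eq_fun do rewrite mxE.
by apply: measurable_funN; exact: measurable_rV_coord.
Qed.

(** Induction on the dimension: a section of the shifted set is a shift of a section of [A] taken at
    a shifted first coordinate, so the induction hypothesis treats the sections and invariance on
    the line treats the outer integral. *)
Lemma lebesgue_rV_shift N (y : 'rV[R]_N) (A : set 'rV[R]_N) : measurable A ->
  lebesgue_rV R N ((fun x => x + y) @^-1` A) = lebesgue_rV R N A.
Proof.
elim: N y A => [|N IHN] y A mA.
  by congr (_ _); apply/seteqP; split=> x /=; rewrite [x + y]thinmx0 [x]thinmx0.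
rewrite /= /lebesgue_rV_cons /pushforward /product_measure1.
pose y' := \row_j y ord0 (lift ord0 j) : 'rV[R]_N.
have yE (a : R) v : rV_cons (a, v) + y = rV_cons (a + y ord0 ord0, v + y').
  apply/rowP => i; rewrite !mxE; case: unliftP => [j|] -> //=.
  by rewrite !mxE.
have mB : measurable (@rV_cons R N @^-1` A).
  by rewrite -[X in measurable X]setTI; exact: measurable_rV_cons.
under eq_integral => a _.
  rewrite /= (_ : xsection _ _ =
    (fun v => v + y') @^-1` xsection (@rV_cons R N @^-1` A) (a + y ord0 ord0)); last first.
    by apply/seteqP; split=> v; rewrite /xsection/= !inE/= yE.
  rewrite IHN; last exact: measurable_xsection.
  over.
rewrite /= (ge0_integral_preserving (@lebesgue_measure R) (fun a => a + y ord0 ord0) _ _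
  (fun a => lebesgue_rV R N (xsection (@rV_cons R N @^-1` A) a)))//.
- by apply: measurable_funD => //; exact: measurable_cst.
- exact: lebesgue_measure_shift.
- exact: measurable_fun_xsection.
Qed.

End translation.

Section translation_integral.
Variables (R : realType) (N : nat).
Notation V := 'rV[R]_N.
Notation leb := (lebesgue_rV R N).
Local Open Scope ereal_scope.

Lemma ge0_integral_shift (y : V) (f : V -> \bar R) : measurable_fun setT f ->
  (forall x, 0 <= f x) -> \int[leb]_x f (x + y)%R = \int[leb]_x f x.
Proof.
move=> mf f0.
rewrite (ge0_integral_preserving leb (fun x : V => x + y)%R)//.
- exact: measurable_shift.
- exact: lebesgue_rV_shift.
Qed.

Lemma integrable_shift (y : V) (f : V -> \bar R) : leb.-integrable setT f ->
  leb.-integrable setT (fun x => f (x + y)%R).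
Proof.
apply: (integrable_preserving leb (fun x : V => x + y)%R).
- exact: measurable_shift.
- exact: lebesgue_rV_shift.
Qed.

Variable m : {sigma_finite_measure set V -> \bar R}.
Hypothesis m_even : forall A : set V, measurable A ->
  m ((fun z : V => - z)%R @^-1` A) = m A.

(** Reverses a jump: the jump from x to x + z becomes the jump from x + z back to x. *)
Definition flip (p : V * V) : V * V := (p.1 + p.2, - p.2)%R.

Lemma measurable_flip : measurable_fun setT flip.
Proof.
apply: measurable_fun_pair; first exact: measurable_addrV.
by apply: (measurableT_comp (@measurable_opprV R N)).
Qed.

(** For fixed z the first coordinate is only translated, which Lebesgue measure does not see; once
    the integrals are exchanged, the reflection of z is absorbed by the evenness of [m]. *)
Lemma flip_preserving A : measurable A -> (leb \x m) (flip @^-1` A) = (leb \x m) A.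
Proof.
move=> mA.
have mF : measurable (flip @^-1` A).
  by rewrite -[X in measurable X]setTI; exact: measurable_flip.
have indE B : measurable B -> (leb \x m) B = \int[leb]_x \int[m]_z (\1_B (x, z))%:E.
  move=> mB; rewrite -[in LHS](setIT B) -integral_indic//.
  apply: (fubini_tonelli1 (fun p => (\1_B p)%:E)) => [|p]; last by rewrite lee_fin.
  by apply/measurable_EFinP; exact: measurable_indic.
rewrite indE// indE//.
rewrite (fubini_tonelli (fun p => (\1_(flip @^-1` A) p)%:E)); last 2 first.
  by apply/measurable_EFinP; exact: measurable_indic.
  by move=> p; rewrite lee_fin.
transitivity (\int[m]_z \int[leb]_x (\1_A (x, - z)%R)%:E).
  apply: eq_integral => z _.
  rewrite -[RHS](@ge0_integral_shift z (fun x => (\1_A (x, - z)%R)%:E)); [by []| |by []].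
  apply/measurable_EFinP.
  apply: (measurable_comp_fun (f := \1_A : V * V -> R)) => //.
rewrite -(fubini_tonelli (fun p : V * V => (\1_A (p.1, - p.2)%R)%:E)); last 2 first.
  apply/measurable_EFinP.
  apply: (measurable_comp_fun (f := \1_A : V * V -> R) (g := fun p : V * V => (p.1, - p.2)%R)) => //.
  apply: measurable_fun_pair => //.
  by apply: (measurableT_comp (@measurable_opprV R N)).
  by move=> p; rewrite lee_fin.
apply: eq_integral => x _.
rewrite (ge0_integral_preserving m (fun z : V => - z)%R _ _ (fun z => (\1_A (x, z))%:E))//.
- exact: measurable_opprV.
- apply/measurable_EFinP.
  by apply: (@measurable_fun_pair2 _ _ _ _ _ _ (\1_A : V * V -> R)).
Qed.

End translation_integral.

Section ecvg0.
Variables (R : realType).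
Local Open Scope ereal_scope.

Lemma ge0_cvge0P (T : Type) (F : set_system T) {FF : Filter F} (u : T -> \bar R) :
  (forall k, 0 <= u k) ->
  (u @ F --> 0) <->
  (forall e : R, (0 < e)%R -> \forall k \near F, u k <= e%:E).
Proof.
move=> u0; split.
  move=> /fine_cvgP[fin cvg] e e0.
  move/cvgr0Pnorm_le : cvg => /(_ e e0) cvg.
  near=> k.
  have ufin : u k \is a fin_num by near: k; exact: fin.
  rewrite -(fineK ufin) lee_fin; apply: le_trans (ler_norm _) _.
  by near: k; exact: cvg.
move=> H; apply/fine_cvgP; split.
  have := H 1%R ltr01; apply: filterS => k uk.
  by rewrite ge0_fin_numE// (le_lt_trans uk)// ltry.
apply/cvgr0Pnorm_le => e e0.
have := H e e0; apply: filterS => k uk.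
have ufin : u k \is a fin_num by rewrite ge0_fin_numE// (le_lt_trans uk)// ltry.
by rewrite ger0_norm ?fine_ge0//= -lee_fin fineK.
Unshelve. all: by end_near. Qed.

Lemma addeI_fin (a x y : \bar R) : a \is a fin_num -> x + a = y + a -> x = y.
Proof. by move=> afin xy; rewrite -(addeK x afin) xy addeK. Qed.

End ecvg0.

(** * Continuity of translations in L1 *)

Section L1_translation.
Variables (R : realType) (N : nat).
Notation V := 'rV[R]_N.
Notation leb := (lebesgue_rV R N).
Local Open Scope ereal_scope.

(** Extended-real valued, so that the triangle inequality and the contraction estimates ask for
    measurability only. *)
Definition L1dist d (X : measurableType d) (m : {measure set X -> \bar R})
  (f g : X -> R) : \bar R := \int[m]_x `|f x - g x|%:E.

Lemma L1dist_ge0 d (X : measurableType d) (m : {measure set X -> \bar R}) f g :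
  0 <= L1dist m f g.
Proof. by apply: integral_ge0 => x _; rewrite lee_fin. Qed.

Lemma measurable_EFin_norm_sub d (X : measurableType d) (f g : X -> R) :
  measurable_fun setT f -> measurable_fun setT g ->
  measurable_fun setT (fun x => `|f x - g x|%:E).
Proof.
move=> mf mg; apply/measurable_EFinP; apply: measurableT_comp => //.
exact: measurable_funB.
Qed.

Lemma L1dist_sym d (X : measurableType d) (m : {measure set X -> \bar R}) f g :
  L1dist m f g = L1dist m g f.
Proof. by apply: eq_integral => x _; rewrite distrC. Qed.

Lemma L1dist_triangle d (X : measurableType d) (m : {measure set X -> \bar R})
    f g h : measurable_fun setT f -> measurable_fun setT g -> measurable_fun setT h ->
  L1dist m f h <= L1dist m f g + L1dist m g h.
Proof.
move=> mf mg mh; rewrite /L1dist -ge0_integralD//; last 2 first.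
  exact: measurable_EFin_norm_sub.
  exact: measurable_EFin_norm_sub.
apply: ge0_le_integral => //.
- exact: measurable_EFin_norm_sub.
- by apply: emeasurable_funD; exact: measurable_EFin_norm_sub.
- by move=> x _; rewrite -EFinD lee_fin ler_distD.
Qed.

Lemma L1dist_shift (y : V) f g : measurable_fun setT f -> measurable_fun setT g ->
  L1dist leb (fun x : V => f (x + y)%R) (fun x : V => g (x + y)%R) = L1dist leb f g.
Proof.
move=> mf mg; rewrite /L1dist (@ge0_integral_shift _ _ y (fun x => `|f x - g x|%:E))//.
exact: measurable_EFin_norm_sub.
Qed.

Lemma measurable_comp_shift (y : V) (f : V -> R) : measurable_fun setT f ->
  measurable_fun setT (fun x : V => f (x + y)%R).
Proof. by move=> mf; apply: (measurableT_comp mf); exact: measurable_shift. Qed.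

Definition L1_translation_continuous (f : V -> R) :=
  forall y_ : V^nat, y_ @ \oo --> (0 : V)%R ->
  L1dist leb (fun x : V => f (x + y_ k)%R) f @[k --> \oo] --> 0.

Local Notation ltc := L1_translation_continuous.

(** Three-epsilon argument: a translation is an L1 isometry, so replacing [f] by [g] costs the same
    before and after translating. *)
Lemma ltc_lim f : measurable_fun setT f ->
  (forall e : R, (0 < e)%R -> exists g, [/\ measurable_fun setT g, ltc g &
    L1dist leb f g <= e%:E]) -> ltc f.
Proof.
move=> mf H y_ y0; apply/ge0_cvge0P; first by move=> k; exact: L1dist_ge0.
move=> e e0; have [g [mg tg fg]] := H (e / 3)%R (divr_gt0 e0 (ltr0Sn _ _)).
have /ge0_cvge0P := tg _ y0 => /(_ (fun k => L1dist_ge0 _ _ _) (e / 3)%R).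
move=> /(_ (divr_gt0 e0 (ltr0Sn _ _))); apply: filterS => k gk.
have m1 := measurable_comp_shift (y_ k) mf.
have m2 := measurable_comp_shift (y_ k) mg.
apply: (le_trans (L1dist_triangle leb m1 m2 mf)).
rewrite L1dist_shift//.
apply: (@le_trans _ _ ((e/3)%:E + ((e/3)%:E + (e/3)%:E))).
  apply: leeD => //; apply: (le_trans (L1dist_triangle leb m2 mg mf)).
  by apply: leeD => //; rewrite L1dist_sym.
by rewrite -!EFinD lee_fin; lra.
Qed.

Lemma ltcD f g (a : R) : measurable_fun setT f -> measurable_fun setT g ->
  ltc f -> ltc g -> ltc (fun x => f x + a * g x)%R.
Proof.
move=> mf mg tf tg y_ y0.
apply/ge0_cvge0P; first by move=> k; exact: L1dist_ge0.
move=> e e0; pose e' := (e / (2 * (1 + `|a|)))%R.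
have a0 : (0 < 1 + `|a|)%R by have := normr_ge0 a; lra.
have e'0 : (0 < e')%R by rewrite divr_gt0// mulr_gt0.
have /ge0_cvge0P := tf _ y0 => /(_ (fun k => L1dist_ge0 _ _ _) _ e'0) Hf.
have /ge0_cvge0P := tg _ y0 => /(_ (fun k => L1dist_ge0 _ _ _) _ e'0) Hg.
near=> k.
have m1 := measurable_comp_shift (y_ k) mf.
have m2 := measurable_comp_shift (y_ k) mg.
have m3 := measurable_EFin_norm_sub m1 mf.
have m4 := measurable_EFin_norm_sub m2 mg.
apply: (@le_trans _ _ (L1dist leb (fun x : V => f (x + y_ k)%R) f +
   `|a|%:E * L1dist leb (fun x : V => g (x + y_ k)%R) g)).
  have m5 : measurable_fun setT (fun x : V => `|a|%:E * `|g (x + y_ k) - g x|%:E).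
    exact: measurable_funeM.
  rewrite /L1dist -ge0_integralZl// -ge0_integralD//.
  apply: ge0_le_integral => //.
  - apply: measurable_EFin_norm_sub; apply: measurable_funD => //;
      apply: measurable_funM => //; exact: measurable_cst.
  - by apply: emeasurable_funD => //; apply: measurable_funeM.
  - move=> x _; rewrite -EFinM -EFinD lee_fin -normrM.
    by rewrite opprD addrACA -mulrBr ler_normD.
apply: (@le_trans _ _ (e'%:E + `|a|%:E * e'%:E)).
  apply: leeD; first by near: k.
  by apply: lee_pmul => //; [exact: L1dist_ge0|near: k].
rewrite -EFinM -EFinD lee_fin /e'.
rewrite -[X in (X + _)%R]mul1r -mulrDl mulrCA ler_piMr ?ltW//.
by rewrite invfM mulrCA mulfV ?gt_eqF// mulr1; lra.
Unshelve. all: by end_near. Qed.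

Lemma integral_indic_shift (A : set V) (y : V) : measurable A ->
  \int[leb]_x (\1_A (x + y)%R)%:E = leb A.
Proof.
move=> mA; rewrite (@ge0_integral_shift _ _ y (fun x => (\1_A x)%:E))//.
  by rewrite integral_indic// setIT.
by apply/measurable_EFinP.
Qed.

(* For an open set the positive part of [1_A - 1_A(. + y)] tends to 0 pointwise,
   and by invariance of the measure it carries half of the L1 distance. *)
Lemma ltc_open (A : set V) : open A -> leb A < +oo -> ltc (\1_A).
Proof.
move=> oA Aoo y_ y0.
have mA : measurable A by exact: open_measurable_rV.
have mI : measurable_fun setT (\1_A : V -> R) by exact: measurable_indic.
pose h k x : R := Num.max 0%R (\1_A x - \1_A (x + y_ k))%R.
have mh k : measurable_fun setT (h k).
  apply: measurable_maxr; first exact: measurable_cst.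
  by apply: measurable_funB => //; exact: measurable_comp_shift.
(* With a and b the indicators at x and at x + y_k, |b - a| + a = 2 max(0, a - b) + b pointwise; a
   and b have the same finite integral, which cancels. *)
have hE k : L1dist leb (fun x : V => \1_A (x + y_ k)%R) \1_A =
    2%:E * \int[leb]_x (h k x)%:E.
  have Afin : leb A \is a fin_num by rewrite ge0_fin_numE.
  have AE : \int[leb]_x (\1_A x)%:E = leb A by rewrite integral_indic// setIT.
  apply: (addeI_fin Afin).
  have mIy := measurable_comp_shift (y_ k) mI.
  have h0 x : (0 <= h k x)%R by rewrite /h le_max lexx.
  have mhE : measurable_fun setT (fun x => (h k x)%:E) by exact/measurable_EFinP.
  have mIE : measurable_fun setT (fun x => (\1_A x : R)%:E) by exact/measurable_EFinP.
  have mIyE : measurable_fun setT (fun x : V => (\1_A (x + y_ k)%R : R)%:E).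
    exact/measurable_EFinP.
  have mhE2 : measurable_fun setT (fun x => 2%:E * (h k x)%:E) by exact: measurable_funeM.
  have h20 x : setT x -> 0 <= 2%:E * (h k x)%:E by rewrite -EFinM lee_fin mulr_ge0.
  have md := measurable_EFin_norm_sub mIy mI.
  rewrite -{1}AE /L1dist -ge0_integralD// -ge0_integralZl//; last first.
    by move=> x _; rewrite lee_fin.
  rewrite -[in RHS](integral_indic_shift (y_ k) mA) -ge0_integralD//.
  apply: eq_integral => x _; rewrite -EFinM -!EFinD /h; congr EFin.
  by rewrite !indicE; do 2 case: (_ \in _) => /=; rewrite /Num.max; case: ifP => //;
    rewrite ?subrr ?normr0 ?sub0r ?subr0 ?normrN ?normr1 ?ltr01 ?ltrN10 ?ltxx//; lra.
rewrite (funext hE) -[X in _ --> X](mule0 2%:E); apply: cvgeZl => //.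
have [|||||_ _] := @dominated_convergence _ _ _ leb setT measurableT
    (fun k x => (h k x)%:E) (cst 0) (fun x => (\1_A x)%:E).
- by move=> k; exact/measurable_EFinP.
- exact: measurable_cst.
- apply: nearW => x _; apply: cvg_near_cst.
  have [Ax|nAx] := pselect (A x); last first.
    by near=> k; rewrite /h !indicE memNset//= sub0r; congr EFin; apply/max_idPl; rewrite oppr_le0.
  have : nbhs x A by exact: open_nbhs_nbhs.
  have xy : (cst (x : V) \+ y_)%R @ \oo --> (x : V).
    have := @cvgD R V nat \oo _ (cst (x : V)) y_ x 0%R (cvg_cst _) y0.
    by rewrite addr0 => H; exact: H.
  move/xy => AA; near=> k.
  have Ak : A (x + y_ k)%R by near: k; exact: AA.
  by rewrite /h !indicE !mem_set//= subrr maxxx.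
- apply/integrableP; split; first exact/measurable_EFinP.
  under eq_integral do rewrite /= ger0_norm//.
  by rewrite integral_indic// setIT.
- apply: nearW => x k _; rewrite /= lee_fin ger0_norm /h ?le_max ?lexx//.
  by rewrite ge_max /= lerBlDr lerDl; apply/andP.
by rewrite integral0.
Unshelve. all: by end_near. Qed.

End L1_translation.

Lemma integrable_measurable d (X : measurableType d) (R : realType)
    (m : {measure set X -> \bar R}) (f : X -> R) :
  m.-integrable setT (EFin \o f) -> measurable_fun setT f.
Proof. by move=> /integrableP[mf _]; exact/measurable_EFinP. Qed.

Section L1_translation_integrable.
Variables (R : realType) (N : nat).
Notation V := 'rV[R]_N.
Notation leb := (lebesgue_rV R N).
Local Open Scope ereal_scope.

Import HBSimple.

(** The coordinates are continuous, hence measurable for the sigma-algebra generated by the open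
    sets. These form a pi-system, from which the argument of [ltc_measurable] starts. *)
Lemma measurable_rV_sigma_open (A : set V) :
  measurable A -> <<s [set O : set V | open O] >> A.
Proof.
move: A; apply: smallest_sub; first exact: smallest_sigma_algebra.
rewrite -bigcup_seq; apply: bigcup_sub => i _ _ [B mB <-]; rewrite setTI.
pose f := (fun x => (x : V) ord0 i) : g_sigma_algebraType [set O : set V | open O] -> R.
suff mf : measurable_fun setT f by rewrite -[X in <<s _ >> X]setTI; exact: mf.
apply: (measurability (RGenOpens.G (R := R))); first exact: RGenOpens.measurableE.
move=> _ [_ [a [b ->]] <-]; rewrite setTI; apply: sub_sigma_algebra => /=.
apply: (@open_comp V R (fun x : V => x ord0 i)); last exact: itv_open.
by move=> x _; exact: coord_continuous.
Qed.

Lemma ler_norm_coord (x : V) i : (`|x ord0 i| <= `|x|)%R.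
Proof.
rewrite [X in (_ <= X)%R]/Num.Def.normr/= mx_normrE.
by apply: (le_trans _ (le_bigmax _ _ (ord0, i))).
Qed.

Lemma rV_norm_le (x : V) (r : R) : (0 <= r)%R -> (forall i, `|x ord0 i| <= r)%R ->
  (`|x| <= r)%R.
Proof.
move=> r0 H; rewrite [X in (X <= _)%R]/Num.Def.normr/= mx_normrE.
by apply/bigmax_leP; split=> // -[i j] _ /=; rewrite (ord1 i).
Qed.

Lemma open_rV_ball (r : R) : open [set x : V | (`|x| < r)%R].
Proof.
rewrite (_ : mkset _ = ball (0 : V)%R r); first exact: ball_open.
by apply/seteqP; split => x; rewrite -ball_normE /= sub0r normrN.
Qed.

Lemma lebesgue_rV_bounded (r : R) : leb [set x : V | (`|x| <= r)%R] < +oo.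
Proof.
have [r0|r0] := leP 0%R r; last first.
  rewrite (_ : mkset _ = set0) ?measure0 ?ltry//.
  by rewrite -subset0 => x /= xr; have := normr_ge0 x; lra.
pose A := fun i : 'I_N => [set` `[(- r)%R, r]].
have -> : [set x : V | (`|x| <= r)%R] = [set x : V | forall i, A i (x ord0 i)].
  apply/seteqP; split => x /= H.
    by move=> i; rewrite /A/= in_itv/= -ler_norml; exact: le_trans (ler_norm_coord _ _) H.
  by apply: rV_norm_le => // i; rewrite ler_norml; have := H i; rewrite /A/= in_itv.
rewrite lebesgue_rV_box; last by move=> i; exact: measurable_itv.
rewrite -ge0_fin_numE; last by apply: prode_ge0 => i _; exact: measure_ge0.
apply: prode_fin_num => i _; rewrite /A /= lebesgue_measure_itv/=.
by case: ifP.
Qed.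


Lemma bounded_setI_lty (A : set V) (r : R) : measurable A ->
  leb (A `&` [set x : V | (`|x| < r)%R]) < +oo.
Proof.
move=> mA; apply: le_lt_trans (lebesgue_rV_bounded r); apply: le_measure.
- rewrite inE; apply: measurableI => //.
  by apply: open_measurable_rV; exact: open_rV_ball.
- rewrite inE (_ : mkset _ = ~` [set x : V | (r < `|x|)%R]); last first.
    by apply/seteqP; split=> x /=; rewrite real_leNgt ?num_real//; move/negP.
  apply: measurableC; apply: open_measurable_rV.
  rewrite (_ : mkset _ = (@Num.Def.normr R V) @^-1` [set s : R | (r < s)%R])//.
  by apply: open_comp; [move=> x _; exact: norm_continuous|exact: open_gt].
- by move=> x [_ /=]; exact: ltW.
Qed.

Local Notation ltc := (@L1_translation_continuous R N).
Local Notation Om k := [set x : V | (`|x| < k%:R)%R].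

Lemma measurable_rV_ball (r : R) : measurable [set x : V | (`|x| < r)%R].
Proof. by apply: open_measurable_rV; exact: open_rV_ball. Qed.

(** Dynkin's argument starting from the open sets: proper differences are handled by linearity,
    increasing unions by dominated convergence. Cutting with a ball keeps all measures finite. *)
Lemma ltc_measurable (A : set V) (k : nat) : measurable A ->
  ltc (\1_(A `&` Om k)).
Proof.
move=> mA; move/measurable_rV_sigma_open : (mA).
pose H := [set A : set V | measurable A /\ ltc (\1_(A `&` Om k))].
have mO := measurable_rV_ball k%:R.
suff sub : <<s [set O : set V | open O] >> `<=` H by move=> /sub[].
apply: lambda_system_subset => //.
- by move=> B C /=; exact: openI.
- split => //.
  + split; first exact: measurableT.
    rewrite setTI; apply: ltc_open; first exact: open_rV_ball.
    by have := bounded_setI_lty k%:R measurableT; rewrite setTI.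
  + move=> B C CB [mB tB] [mC tC]; split; first exact: measurableD.
    have -> : \1_((B `\` C) `&` Om k) =
        (fun x : V => \1_(B `&` Om k) x + (- 1) * \1_(C `&` Om k) x)%R :> (V -> R).
      apply/funext => x; rewrite !indicE setDE !in_setI in_setC mulN1r.
      case: (boolP (x \in C)) => [|nC].
        by rewrite inE => /CB; rewrite -inE => ->; case: (x \in Om k) => /=; rewrite ?andbF ?subrr.
      by rewrite /= andbT subr0.
    by apply: ltcD => //; apply: measurable_indic; exact: measurableI.
  + move=> F ndF HF; have mF n : measurable (F n) by have [] := HF n.
    split; first exact: bigcupT_measurable.
    apply: ltc_lim.
      by apply: measurable_indic; apply: measurableI => //; exact: bigcupT_measurable.
    move=> e e0.
    pose h n (x : V) : R := `|\1_(\bigcup_i F i `&` Om k) x - \1_(F n `&` Om k) x|%R.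
    have mI n : measurable_fun setT (\1_(F n `&` Om k) : V -> R).
      by apply: measurable_indic; exact: measurableI.
    have mIU : measurable_fun setT (\1_(\bigcup_i F i `&` Om k) : V -> R).
      by apply: measurable_indic; apply: measurableI => //; exact: bigcupT_measurable.
    have cv : \int[leb]_x (h n x)%:E @[n --> \oo] --> \int[leb]_x (cst 0 x).
      apply: (@dominated_cvg _ _ _ leb setT measurableT
        (fun n x => (h n x)%:E) (cst 0) (fun x => (\1_(Om k) x)%:E)) => //.
      * by move=> n; exact: measurable_EFin_norm_sub.
      * move=> x _; apply: cvg_near_cst.
        have [[n _ Fnx]|nF] := pselect ((\bigcup_i F i) x); last first.
          apply: nearW => n; rewrite /h !indicE !in_setI.
          have nFn : ~ F n x by move=> Fnx; apply: nF; exists n.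
          by rewrite (memNset nF) (memNset nFn)/= subrr normr0.
        exists n => // p /= np.
        have Fnp : F n `<=` F p by exact/subsetPset/ndF.
        have Fpx : F p x by exact: Fnp.
        rewrite /h !indicE !in_setI (mem_set Fpx).
        by rewrite (mem_set (_ : (\bigcup_i F i) x))/= ?subrr ?normr0//; exists n.
      * apply/integrableP; split; first by apply/measurable_EFinP; exact: measurable_indic.
        under eq_integral do rewrite /= ger0_norm//.
        by rewrite integral_indic// setIC; exact: bounded_setI_lty.
      * move=> n x _; rewrite /= normr_id lee_fin !indicE !in_setI.
        by case: (x \in Om k) => /=; rewrite ?andbF ?subrr ?normr0// !andbT;
          do 2 case: (_ \in _) => /=; rewrite ?subrr ?subr0 ?sub0r ?normrN ?normr1 ?normr0.
    rewrite integral0 in cv.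
    have /ge0_cvge0P := cv => /(_ (fun n => L1dist_ge0 _ _ _)) /(_ e e0)[n _ Hn].
    exists (\1_(F n `&` Om k)); split => //; first by have [] := HF n.
    exact: Hn n (leqnn n).
- move=> B /= oB; split; first exact: open_measurable_rV.
  apply: ltc_open; first by apply: openI => //; exact: open_rV_ball.
  by apply: bounded_setI_lty; exact: open_measurable_rV.
Qed.

Lemma ltc_sum n (c : nat -> R) (F : nat -> V -> R) :
  (forall i, measurable_fun setT (F i)) -> (forall i, ltc (F i)) ->
  ltc (fun x => \sum_(i < n) c i * F i x)%R.
Proof.
move=> mF tF; elim: n => [|n IHn].
  rewrite (_ : (fun _ => _) = cst 0%R); last by apply/funext => x; rewrite big_ord0.
  move=> y_ _; apply/ge0_cvge0P; first by move=> k; exact: L1dist_ge0.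
  move=> e e0; apply: nearW => k; rewrite /L1dist.
  under eq_integral do rewrite /= subrr normr0.
  by rewrite integral0 lee_fin ltW.
rewrite (_ : (fun _ => _) =
    (fun x => (\sum_(i < n) c i * F i x) + c n * F n x)%R); last first.
  by apply/funext => x; rewrite big_ord_recr.
apply: ltcD => //; apply: measurable_sum => i.
by apply: measurable_funM => //; exact: measurable_cst.
Qed.

(** Cutting [f] to a large ball and replacing it there by a simple function cost e / 2 each; the
    result is a finite combination of the indicators of [ltc_measurable]. *)
Lemma ltc_integrable (f : V -> R) : leb.-integrable setT (EFin \o f) -> ltc f.
Proof.
move=> fint; have mf : measurable_fun setT f by exact: integrable_measurable fint.
apply: ltc_lim => // e e0.
have e20 : (0 < e / 2)%R by lra.
have [k Hk] : exists k : nat, L1dist leb f (fun x => f x * \1_(Om k) x)%R <= (e/2)%:E.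
  pose h n (x : V) : R := `|f x - f x * \1_(Om n) x|%R.
  have mfO n : measurable_fun setT (fun x => f x * \1_(Om n) x)%R.
    by apply: measurable_funM => //; apply: measurable_indic; exact: measurable_rV_ball.
  have cv : \int[leb]_x (h n x)%:E @[n --> \oo] --> \int[leb]_x (cst 0 x).
    apply: (@dominated_cvg _ _ _ leb setT measurableT
        (fun n x => (h n x)%:E) (cst 0) (fun x => `|f x|%:E)) => //.
    * by move=> n; exact: measurable_EFin_norm_sub.
    * move=> x _; apply: cvg_near_cst.
      near=> p; rewrite /h indicE mem_set ?mulr1 ?subrr ?normr0//=.
      by near: p; exact: nbhs_infty_gtr.
    * exact: integrable_norm.
    * move=> n x _; rewrite /= normr_id lee_fin indicE.
      by case: (_ \in _); rewrite ?mulr1 ?mulr0 ?subrr ?subr0 ?normr0.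
  rewrite integral0 in cv.
  have /ge0_cvge0P := cv => /(_ (fun n => L1dist_ge0 _ _ _)) /(_ _ e20)[n _ Hn].
  by exists n; exact: Hn n (leqnn n).
have [g [gint _ gcv]] := approximation_sfun_integrable measurableT fint.
have /ge0_cvge0P := gcv => /(_ (fun n => L1dist_ge0 _ _ _)) /(_ _ e20)[n _ Hn].
have {}Hn : L1dist leb f (g n) <= (e / 2)%:E := Hn n (leqnn n).
have mg : measurable_fun setT (g n) by exact: integrable_measurable (gint n).
have mO := measurable_rV_ball k%:R.
have mIO : measurable_fun setT (\1_(Om k) : V -> R) by exact: measurable_indic.
pose gk := fun x => (g n x * \1_(Om k) x)%R.
have mgk : measurable_fun setT gk by exact: measurable_funM.
have mfk : measurable_fun setT (fun x => f x * \1_(Om k) x)%R by exact: measurable_funM.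
exists gk; split => //; last first.
  apply: (le_trans (L1dist_triangle leb mf mfk mgk)).
  rewrite [e in leRHS](splitr e) EFinD; apply: leeD => //.
  apply: le_trans Hn; apply: ge0_le_integral => //; [exact: measurable_EFin_norm_sub..|].
  move=> x _; rewrite lee_fin /gk -mulrBl normrM ler_piMr// indicE.
  by case: (_ \in _); rewrite ?normr1 ?normr0.
pose s := finmap.enum_fset (fset_set (range (g n))).
have -> : gk = (fun x => \sum_(i < size s) s`_i *
    \1_(g n @^-1` [set s`_i] `&` Om k) x)%R.
  apply/funext => x; rewrite /gk fimfunEord mulr_suml; apply: eq_bigr => i _.
  by rewrite -mulrA indicI.
have mgi (r : R) : measurable (g n @^-1` [set r]).
  by rewrite -[X in measurable X]setTI; exact: mg.
apply: (@ltc_sum (size s) (fun i => s`_i)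
  (fun i => \1_(g n @^-1` [set s`_i] `&` Om k))) => i; first by apply: measurable_indic; exact: measurableI.
exact: ltc_measurable.
Unshelve. all: by end_near. Qed.

End L1_translation_integrable.

Notation Rintegrable m f := (m.-integrable setT (EFin \o f)).

(** * Real-valued integrals and Fubini's theorem *)

Section real_integral.
Context d (X : measurableType d) (R : realType).
Variable m : {measure set X -> \bar R}.
Implicit Types f g : X -> R.

Lemma Rintegrable_le f g : measurable_fun setT f -> (forall x, `|f x| <= g x) ->
  Rintegrable m g -> Rintegrable m f.
Proof.
move=> mf fg; apply: le_integrable => //; first exact/measurable_EFinP.
by move=> x _ /=; rewrite lee_fin; apply: le_trans (fg x) (ler_norm _).
Qed.

Lemma RintegrableD f g : Rintegrable m f -> Rintegrable m g ->
  Rintegrable m (fun x => f x + g x).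
Proof. by move=> fi gi; exact: (integrableD measurableT fi gi). Qed.

Lemma RintegrableB f g : Rintegrable m f -> Rintegrable m g ->
  Rintegrable m (fun x => f x - g x).
Proof. by move=> fi gi; exact: (integrableB measurableT fi gi). Qed.

Lemma RintegrableZ (k : R) f : Rintegrable m f -> Rintegrable m (fun x => k * f x).
Proof. by move=> fi; exact: (integrableZl measurableT k fi). Qed.

Lemma Rintegrable_norm f : Rintegrable m f -> Rintegrable m (fun x => `|f x|).
Proof. exact: integrable_norm. Qed.

Lemma Rintegrable_sum n (F : nat -> X -> R) : (forall i, (i < n)%N -> Rintegrable m (F i)) ->
  Rintegrable m (fun x => \sum_(i < n) F i x).
Proof.
elim: n => [|n IHn] H.
  rewrite (_ : _ \o _ = cst 0%E); first exact: integrable0.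
  by apply/funext => x /=; rewrite big_ord0.
rewrite (_ : (fun x => _) = (fun x => \sum_(i < n) F i x + F n x)); last first.
  by apply/funext => x; rewrite big_ord_recr.
by apply: RintegrableD; [apply: IHn => i ni; apply: H; exact: ltnW|exact: H].
Qed.

Lemma EFin_Rintegral f : Rintegrable m f ->
  (\int[m]_x (f x)%:E)%E = (\int[m]_x f x)%:E.
Proof. by move=> fi; rewrite /Rintegral fineK//; exact: integrable_fin_num. Qed.

Lemma Rintegral_sum n (F : nat -> X -> R) : (forall i, (i < n)%N -> Rintegrable m (F i)) ->
  \int[m]_x (\sum_(i < n) F i x) = \sum_(i < n) \int[m]_x F i x.
Proof.
elim: n => [|n IHn] H.
  under eq_Rintegral do rewrite big_ord0.
  by rewrite big_ord0 /Rintegral integral0.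
under eq_Rintegral do rewrite big_ord_recr/=.
rewrite RintegralD//; last 2 first.
- by apply: Rintegrable_sum => i ni; apply: H; exact: ltnW.
- exact: H.
by rewrite big_ord_recr/= IHn// => i ni; apply: H; exact: ltnW.
Qed.

Lemma ge0_Rintegrable f : measurable_fun setT f -> (forall x, 0 <= f x) ->
  (\int[m]_x (f x)%:E < +oo)%E -> Rintegrable m f.
Proof.
move=> mf f0 foo; apply/integrableP; split; first exact/measurable_EFinP.
by under eq_integral do rewrite /= ger0_norm//.
Qed.

Lemma Rintegrable_lty f : Rintegrable m f -> (\int[m]_x `|f x|%:E < +oo)%E.
Proof. by move=> /integrableP[]. Qed.

Lemma Rintegrable_ltyP f : measurable_fun setT f ->
  (\int[m]_x `|f x|%:E < +oo)%E -> Rintegrable m f.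
Proof. by move=> mf foo; apply/integrableP; split; first exact/measurable_EFinP. Qed.

End real_integral.

Section finite_bounded.
Context d (X : measurableType d) (R : realType).
Variable m : {finite_measure set X -> \bar R}.

Lemma bounded_Rintegrable (f : X -> R) (B : R) : measurable_fun setT f ->
  (forall x, `|f x| <= B) -> Rintegrable m f.
Proof.
move=> mf fB; apply: (Rintegrable_le mf fB).
exact: finite_measure_integrable_cst.
Qed.

End finite_bounded.

Section real_fubini.
Context d1 d2 (X : measurableType d1) (Y : measurableType d2) (R : realType).
Variables (m1 : {sigma_finite_measure set X -> \bar R})
  (m2 : {sigma_finite_measure set Y -> \bar R}).
Implicit Types f : X * Y -> R.

Lemma measurable_integral2 (f : X * Y -> \bar R) : measurable_fun setT f ->
  measurable_fun setT (fun x => \int[m2]_y f (x, y))%E.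
Proof.
move=> mf.
rewrite (_ : (fun x => _) = (fun x => \int[m2]_y (f^\+ (x, y))%E -
   \int[m2]_y (f^\- (x, y))%E)%E); last first.
  by apply/funext => x; rewrite integralE; congr (_ - _)%E; apply: eq_integral => y _;
    rewrite ?funeposE ?funenegE.
apply: emeasurable_funB.
- apply: (measurable_fun_fubini_tonelli_F (f^\+)%E) => //.
  exact: measurable_funepos.
- apply: (measurable_fun_fubini_tonelli_F (f^\-)%E) => //.
  exact: measurable_funeneg.
Qed.

Lemma measurable_Rintegral2 f : measurable_fun setT f ->
  measurable_fun setT (fun x => \int[m2]_y f (x, y)).
Proof.
move=> mf; apply: (measurable_comp_fun (f := @fine R)) => //.
by apply: (measurable_integral2 (f := EFin \o f)); exact/measurable_EFinP.
Qed.

Lemma Rintegrable_fubini f : Rintegrable (m1 \x m2)%E f ->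
  Rintegrable m1 (fun x => \int[m2]_y f (x, y)).
Proof.
move=> fi; have mf := integrable_measurable fi.
apply: le_integrable (integrable_fubini_F fi) => //.
  by apply/measurable_EFinP; exact: measurable_Rintegral2.
by move=> x _; rewrite /= /Rintegral /fubini_F /=; case: (integral _ _ _) => [r||] //=; rewrite ?leey.
Qed.

Lemma Rfubini f : Rintegrable (m1 \x m2)%E f ->
  \int[(m1 \x m2)%E]_p f p = \int[m1]_x \int[m2]_y f (x, y).
Proof.
move=> fi; have mf := integrable_measurable fi.
rewrite /Rintegral -(integral12_prod_meas1 fi); congr fine.
apply: ae_eq_integral => //.
- exact: measurable_int (integrable_fubini_F fi).
- by apply/measurable_EFinP; exact: measurable_Rintegral2.
have := integrable_ae measurableT (integrable_fubini_F fi).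
apply: filterS => x /(_ Logic.I) xfin _.
by rewrite -[LHS]fineK.
Qed.

Lemma Rintegrable_prod f : measurable_fun setT f ->
  (\int[m1]_x \int[m2]_y `|f (x, y)|%:E < +oo)%E -> Rintegrable (m1 \x m2)%E f.
Proof.
move=> mf foo; apply/(integrable12ltyP m1 m2) => //.
exact/measurable_EFinP.
Qed.

End real_fubini.

(** * The nonlocal operator of a finite measure and its bilinear form *)

Section jump.
Variables (R : realType) (N : nat).
Notation V := 'rV[R]_N.
Notation leb := (lebesgue_rV R N).
Variable m : {finite_measure set V -> \bar R}.

Definition mass : R := fine (m setT).

(** For an even finite measure this is the operator L^m: the compensating gradient term integrates
    to zero by symmetry. *)
Definition jump (v : V -> R) (x : V) : R := \int[m]_z (v (x + z) - v x).

(** Twice the energy form of [m]: the factor 1/2 is written separately wherever the form is used. *)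
Definition jump_form (v g : V -> R) : R :=
  \int[(leb \x m)%E]_p ((v (p.1 + p.2) - v p.1) * (g (p.1 + p.2) - g p.1)).

Lemma mass_ge0 : 0 <= mass. Proof. exact: fine_ge0. Qed.

Lemma mass_fin : m setT = mass%:E.
Proof. by rewrite fineK// fin_num_measure. Qed.

Lemma measurable_comp_add (v : V -> R) : measurable_fun setT v ->
  measurable_fun setT (fun p : V * V => v (p.1 + p.2)).
Proof. by move=> mv; apply: (measurableT_comp mv); exact: measurable_addrV. Qed.

Lemma measurable_comp_fst (v : V -> R) : measurable_fun setT v ->
  measurable_fun setT (fun p : V * V => v p.1).
Proof. by move=> mv; apply: (measurableT_comp mv). Qed.

Lemma measurable_jump_diff (v : V -> R) : measurable_fun setT v ->
  measurable_fun setT (fun p : V * V => v (p.1 + p.2) - v p.1).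
Proof.
by move=> mv; apply: measurable_funB;
  [exact: measurable_comp_add|exact: measurable_comp_fst].
Qed.

Lemma measurable_comp_addl (v : V -> R) (x : V) : measurable_fun setT v ->
  measurable_fun setT (fun z : V => v (x + z)).
Proof.
move=> mv; rewrite (_ : (fun z => _) = fun z => v (z + x)).
  exact: measurable_comp_shift.
by apply/funext => z; rewrite addrC.
Qed.

Lemma measurable_jump (v : V -> R) : measurable_fun setT v ->
  measurable_fun setT (jump v).
Proof.
move=> mv; apply: (measurable_Rintegral2 m (f := fun p : V * V => v (p.1 + p.2) - v p.1)).
exact: measurable_jump_diff.
Qed.

Section bounded.
Variables (B : R) (v : V -> R).
Hypotheses (mv : measurable_fun setT v) (vB : forall x, `|v x| <= B).

Lemma Rintegrable_shifted x : Rintegrable m (fun z => v (x + z)).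
Proof. by apply: (@bounded_Rintegrable _ _ _ m _ B) => //; exact: measurable_comp_addl. Qed.

Lemma jumpE x : jump v x = \int[m]_z v (x + z) - mass * v x.
Proof.
rewrite /jump RintegralB//; [|exact: Rintegrable_shifted|].
  by rewrite Rintegral_cst// mulrC.
by apply: (@bounded_Rintegrable _ _ _ m _ B).
Qed.

Lemma jump_diff_le (p : V * V) : `|v (p.1 + p.2) - v p.1| <= 2 * B.
Proof.
apply: le_trans (ler_normB _ _) _.
by have := vB (p.1 + p.2); have := vB p.1; lra.
Qed.

Lemma bounded_B_ge0 : 0 <= B. Proof. exact: le_trans (normr_ge0 _) (vB 0). Qed.

Lemma Rintegrable_jump_diff x : Rintegrable m (fun z => v (x + z) - v x).
Proof.
apply: RintegrableB; first exact: Rintegrable_shifted.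
by apply: (@bounded_Rintegrable _ _ _ m _ B).
Qed.

Lemma Rintegrable_fst (g : V -> R) : Rintegrable leb g ->
  Rintegrable (leb \x m)%E (fun p => g p.1).
Proof.
move=> gi; have mg := integrable_measurable gi.
apply: Rintegrable_prod; first exact: measurable_comp_fst.
rewrite /=; under eq_integral do rewrite integral_cst//= mass_fin muleC.
have mg' : measurable_fun setT (fun x => `|g x|%:E).
  by apply/measurable_EFinP; exact: measurableT_comp.
rewrite ge0_integralZl ?lee_fin ?mass_ge0//.
by rewrite lte_mul_pinfty// ?lee_fin ?mass_ge0//; exact: Rintegrable_lty.
Qed.

Lemma Rintegrable_jump_prod (g : V -> R) : Rintegrable leb g ->
  Rintegrable (leb \x m)%E (fun p => g p.1 * (v (p.1 + p.2) - v p.1)).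
Proof.
move=> gi; have mg := integrable_measurable gi.
apply: (Rintegrable_le (g := fun p : V * V => (2 * B) * `|g p.1|)).
- by apply: measurable_funM; [exact: measurable_comp_fst|exact: measurable_jump_diff].
- by move=> p; rewrite normrM mulrC ler_wpM2r// jump_diff_le.
- by apply: RintegrableZ; apply: (Rintegrable_fst (g := fun x => `|g x|)); exact: Rintegrable_norm.
Qed.

End bounded.

Hypothesis m_even : forall A : set V, measurable A ->
  m ((fun z : V => - z) @^-1` A) = m A.

(** With h(x, z) = g(x) (v(x + z) - v(x)), the integrand of the form is minus the sum of h and of
    its composition with [flip], and both have the same integral because [flip] preserves the
    product measure. *)
Lemma jump_form_ibp (B : R) (v g : V -> R) : measurable_fun setT v ->
  (forall x, `|v x| <= B) -> Rintegrable leb g ->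
  [/\ Rintegrable (leb \x m)%E
       (fun p => (v (p.1 + p.2) - v p.1) * (g (p.1 + p.2) - g p.1)),
      Rintegrable leb (fun x => g x * jump v x) &
      \int[leb]_x (g x * jump v x) = - (2^-1 * jump_form v g)].
Proof.
move=> mv vB gi; have mg := integrable_measurable gi.
pose h (p : V * V) := g p.1 * (v (p.1 + p.2) - v p.1).
have hi : Rintegrable (leb \x m)%E h by exact: (@Rintegrable_jump_prod B v).
have hfi : Rintegrable (leb \x m)%E (fun p => h (flip p)).
  exact: (integrable_preserving (leb \x m)%E (@flip R N) (@measurable_flip R N)
    (flip_preserving m_even) (EFin \o h) hi).
have hfE : \int[(leb \x m)%E]_p h (flip p) = \int[(leb \x m)%E]_p h p.
  rewrite /Rintegral; congr fine.
  apply: (integral_preserving (leb \x m)%E (@flip R N) (@measurable_flip R N)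
    (flip_preserving m_even) (EFin \o h)).
  exact: measurable_int hi.
have hhE p : (v (p.1 + p.2) - v p.1) * (g (p.1 + p.2) - g p.1) =
    - 1 * (h p + h (flip p)).
  by rewrite /h /flip /= addrK; ring.
have hx x : \int[m]_z h (x, z) = g x * jump v x.
  rewrite /h /= RintegralZl//; exact: (Rintegrable_jump_diff mv vB).
have hhi : Rintegrable (leb \x m)%E (fun p => h p + h (flip p)) by exact: RintegrableD.
split.
- rewrite (_ : (fun p => _) = (fun p => - 1 * (h p + h (flip p)))).
    exact: RintegrableZ.
  exact/funext.
- rewrite (_ : (fun x => _) = (fun x => \int[m]_z h (x, z))).
    exact: Rintegrable_fubini.
  by apply/funext => x; rewrite hx.
- rewrite /jump_form; under [in RHS]eq_Rintegral do rewrite hhE.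
  rewrite RintegralZl// RintegralD// hfE Rfubini//.
  under [in RHS]eq_Rintegral do rewrite hx.
  by field.
Qed.

End jump.

(** * One step of the explicit scheme and its a priori estimates *)

Section scheme.
Variables (R : realType) (N : nat).
Notation V := 'rV[R]_N.
Notation leb := (lebesgue_rV R N).
Variable m : {finite_measure set V -> \bar R}.
Hypothesis m_even : forall A : set V, measurable A ->
  m ((fun z : V => - z) @^-1` A) = m A.
Variables (phi : R -> R) (Lip delta : R).
Hypothesis phi_nd : {homo phi : r s / r <= s}.
Hypothesis phi0 : phi 0 = 0.
Hypothesis phi_lip : forall s t, `|phi s - phi t| <= Lip * `|s - t|.
Hypothesis delta_ge0 : 0 <= delta.
Hypothesis cfl : 4 * (delta * Lip * mass m) <= 1.

Definition scheme_step (u : V -> R) (x : V) : R :=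
  u x + delta * jump m (phi \o u) x.

Lemma measurable_phi_comp (u : V -> R) : measurable_fun setT u ->
  measurable_fun setT (phi \o u).
Proof. by move=> mu; apply: measurableT_comp => //; exact: nondecreasing_measurable. Qed.

Lemma measurable_step (u : V -> R) : measurable_fun setT u ->
  measurable_fun setT (scheme_step u).
Proof.
move=> mu; apply: measurable_funD => //; apply: measurable_funM.
  exact: measurable_cst.
by apply: measurable_jump; exact: measurable_phi_comp.
Qed.

Lemma Lip_ge0 : 0 <= Lip.
Proof.
by have := phi_lip 1 0; rewrite subr0 normr1 mulr1; apply: le_trans.
Qed.

Definition phi_sup (M : R) := Num.max (phi M) (- phi (- M)).

Lemma phi_bounded M s : `|s| <= M -> `|phi s| <= phi_sup M.
Proof.
rewrite !ler_norml => /andP[sM Ms]; rewrite /phi_sup; apply/andP; split.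
  by rewrite lerNl le_max lerN2 (phi_nd sM) orbT.
by rewrite le_max (phi_nd Ms).
Qed.

(** This is the monotonicity of s - delta * mass * phi(s), the form in which the CFL condition
    serves the bounds in sup norm and in L1. *)
Lemma cfl_nd s t : t <= s ->
  delta * mass m * (phi s - phi t) <= s - t.
Proof.
move=> ts; have := phi_lip s t; rewrite !ger0_norm ?subr_ge0// ?phi_nd// => H.
have d0 : 0 <= delta * mass m by rewrite mulr_ge0// mass_ge0.
apply: le_trans (ler_wpM2l d0 H) _; rewrite mulrA ler_piMl ?subr_ge0//.
have := mulr_ge0 d0 Lip_ge0.
have -> : delta * mass m * Lip = delta * Lip * mass m by ring.
by move: cfl; lra.
Qed.

(** Both [phi] and s - delta * mass * phi(s) are nondecreasing, so all absolute values open with the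
    same sign and nothing is lost. The negative sign of the last term is what the contraction lives
    on. *)
Lemma cfl_norm s t :
  `|(s - delta * (mass m * phi s)) - (t - delta * (mass m * phi t))| =
  `|s - t| - delta * mass m * `|phi s - phi t|.
Proof.
wlog ts : s t / t <= s => [H|].
  have [ts|/ltW st] := leP t s; first exact: H.
  by rewrite distrC H// distrC [X in _ - _ * X]distrC.
have H := cfl_nd ts.
rewrite (_ : _ - _ - _ = s - t - delta * mass m * (phi s - phi t)); last by ring.
have pts : 0 <= phi s - phi t by rewrite subr_ge0 phi_nd.
have st : 0 <= s - t by rewrite subr_ge0.
by rewrite (ger0_norm st) (ger0_norm pts) ger0_norm// subr_ge0.
Qed.

Lemma phi_comp_bounded M (u : V -> R) : (forall x, `|u x| <= M) ->
  forall x, `|(phi \o u) x| <= phi_sup M.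
Proof. by move=> uM x; exact: phi_bounded. Qed.

Lemma stepE M (u : V -> R) x : measurable_fun setT u -> (forall x, `|u x| <= M) ->
  scheme_step u x = u x - delta * (mass m * phi (u x)) +
    delta * \int[m]_z phi (u (x + z)).
Proof.
move=> mu uM; rewrite /scheme_step (jumpE m (measurable_phi_comp mu) (phi_comp_bounded uM)).
by rewrite /=; ring.
Qed.

(** The new value is s - delta * mass * phi(s) at s = u(x), plus delta times an integral of phi.
    Both parts are monotone in [u], and for the constants M and -M they add up to M and -M. *)
Lemma step_bounded M (u : V -> R) : measurable_fun setT u -> (forall x, `|u x| <= M) ->
  forall x, `|scheme_step u x| <= M.
Proof.
move=> mu uM x; rewrite (stepE _ mu uM).
have := uM x; rewrite ler_norml => /andP[Mu uM'].
have pi : Rintegrable m (fun z => phi (u (x + z))).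
  exact: (Rintegrable_shifted m (measurable_phi_comp mu) (phi_comp_bounded uM)).
have ci r : Rintegrable m (fun _ : V => r) by exact: finite_measure_integrable_cst.
have up : \int[m]_z phi (u (x + z)) <= phi M * mass m.
  rewrite -(Rintegral_cst m measurableT); apply: le_Rintegral => // z _.
  by apply: phi_nd; apply: le_trans (ler_norm _) _.
have lo : phi (- M) * mass m <= \int[m]_z phi (u (x + z)).
  rewrite -(Rintegral_cst m measurableT); apply: le_Rintegral => // z _.
  by apply: phi_nd; have := uM (x + z); rewrite ler_norml => /andP[].
have H1 := cfl_nd uM'; have H2 := cfl_nd Mu.
have H3 := ler_wpM2l delta_ge0 up; have H4 := ler_wpM2l delta_ge0 lo.
by rewrite ler_norml; apply/andP; split; lra.
Qed.

(** The term in phi is kept on the left because, after integration in x, it cancels exactly against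
    the integral on the right. *)
Lemma step_dist_le M (u w : V -> R) x : measurable_fun setT u -> measurable_fun setT w ->
  (forall x, `|u x| <= M) -> (forall x, `|w x| <= M) ->
  `|scheme_step u x - scheme_step w x| + delta * mass m * `|phi (u x) - phi (w x)| <=
  `|u x - w x| + delta * \int[m]_z `|phi (u (x + z)) - phi (w (x + z))|.
Proof.
move=> mu mw uM wM; rewrite (stepE _ mu uM) (stepE _ mw wM).
have ui : Rintegrable m (fun z => phi (u (x + z))).
  exact: (Rintegrable_shifted m (measurable_phi_comp mu) (phi_comp_bounded uM)).
have wi : Rintegrable m (fun z => phi (w (x + z))).
  exact: (Rintegrable_shifted m (measurable_phi_comp mw) (phi_comp_bounded wM)).
rewrite -lerBrDr.
rewrite (_ : _ + _ - (_ + _) = (u x - delta * (mass m * phi (u x))) -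
    (w x - delta * (mass m * phi (w x))) +
  delta * (\int[m]_z phi (u (x + z)) - \int[m]_z phi (w (x + z)))); last by ring.
apply: le_trans (ler_normD _ _) _; rewrite cfl_norm addrAC lerD2r lerD2l.
rewrite normrM ger0_norm// ler_wpM2l// -RintegralB//.
by apply: le_normr_Rintegral => //; exact: RintegrableB.
Qed.

(** Integrate [step_dist_le]: by Fubini and translation invariance the jump integral on the right
    equals the mass times the L1 distance of phi(u) and phi(w), which is the extra term on the
    left. *)
Lemma step_contraction M (u w : V -> R) : measurable_fun setT u -> measurable_fun setT w ->
  (forall x, `|u x| <= M) -> (forall x, `|w x| <= M) ->
  (L1dist leb (scheme_step u) (scheme_step w) <= L1dist leb u w)%E.
Proof.
move=> mu mw uM wM.
(* An infinite distance leaves nothing to prove; for a finite one the Lipschitz bound makes phi(u) -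
   phi(w) integrable, so that the common term may be subtracted. *)
have [->|Dfin] := eqVneq (L1dist leb u w) +oo%E; first exact: leey.
have {}Dfin : (L1dist leb u w < +oo)%E by rewrite ltey.
have mpu := measurable_phi_comp mu; have mpw := measurable_phi_comp mw.
have mpd : measurable_fun setT (fun x => phi (u x) - phi (w x)).
  exact: (measurable_funB mpu mpw).
have di : Rintegrable leb (fun x => u x - w x).
  by apply: Rintegrable_ltyP => //; exact: measurable_funB.
have pdi : Rintegrable leb (fun x => `|phi (u x) - phi (w x)|).
  apply: (Rintegrable_le (g := fun x => Lip * `|u x - w x|)).
  - exact: measurableT_comp.
  - by move=> x; rewrite normr_id.
  - by apply: RintegrableZ; exact: Rintegrable_norm.
have mI : measurable_fun setT (fun p : V * V => `|phi (u (p.1 + p.2)) - phi (w (p.1 + p.2))|).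
  apply: (measurable_comp_add (v := fun x => `|phi (u x) - phi (w x)|)).
  exact: measurableT_comp.
pose I x := \int[m]_z `|phi (u (x + z)) - phi (w (x + z))|.
have IE : (\int[leb]_x \int[m]_z (`|phi (u (x + z)) - phi (w (x + z))|%R)%:E =
    (mass m)%:E * \int[leb]_x (`|phi (u x) - phi (w x)|%R)%:E)%E.
  rewrite (fubini_tonelli (fun p : V * V => `|phi (u (p.1 + p.2)) - phi (w (p.1 + p.2))|%:E))//=;
    last exact/measurable_EFinP.
  under eq_integral => z _.
    rewrite (@ge0_integral_shift _ _ z (fun x => `|phi (u x) - phi (w x)|%:E))//; last first.
      by apply/measurable_EFinP; exact: measurableT_comp.
    over.
  rewrite integral_cst// muleC; congr (_ * _)%E; exact: mass_fin.
have Ii : Rintegrable (leb \x m)%E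
    (fun p : V * V => `|phi (u (p.1 + p.2)) - phi (w (p.1 + p.2))|).
  apply: Rintegrable_prod => //=; under eq_integral do under eq_integral do rewrite normr_id.
  rewrite IE lte_mul_pinfty ?lee_fin ?mass_ge0//.
  by have := Rintegrable_lty pdi; under eq_integral do rewrite normr_id.
have Imi : Rintegrable leb I by exact: (Rintegrable_fubini Ii).
have IE' : \int[leb]_x I x = mass m * \int[leb]_x `|phi (u x) - phi (w x)|.
  rewrite -(Rfubini Ii) {1}/Rintegral fubini_tonelli1//=; last exact/measurable_EFinP.
  by rewrite /fubini_F/= IE EFin_Rintegral.
have sle x := step_dist_le x mu mw uM wM.
have si : Rintegrable leb (fun x => `|scheme_step u x - scheme_step w x|).
  apply: (Rintegrable_le (g := fun x => `|u x - w x| + delta * I x)).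
  - by apply: measurableT_comp => //; apply: measurable_funB; exact: measurable_step.
  - move=> x; rewrite normr_id; apply: le_trans (sle x); rewrite lerDl.
    by rewrite !mulr_ge0// mass_ge0.
  - by apply: RintegrableD; [exact: Rintegrable_norm|exact: RintegrableZ].
rewrite /L1dist (EFin_Rintegral si) (EFin_Rintegral (Rintegrable_norm di)) lee_fin.
have := @le_Rintegral _ _ _ leb setT _ _ measurableT
  (RintegrableD si (RintegrableZ (delta * mass m) pdi))
  (RintegrableD (Rintegrable_norm di) (RintegrableZ delta Imi)) (fun x _ => sle x).
rewrite !RintegralD//; [|exact: Rintegrable_norm|exact: RintegrableZ..].
by rewrite !RintegralZl// IE' mulrA lerD2r.
Qed.

Lemma step_shift (u : V -> R) (y x : V) :
  scheme_step (fun x => u (x + y)) x = scheme_step u (x + y).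
Proof.
by rewrite /scheme_step /jump /=; under eq_Rintegral do rewrite addrAC.
Qed.

Lemma step0 (x : V) : scheme_step (cst 0) x = 0.
Proof.
by rewrite /scheme_step /jump /=; under eq_Rintegral do rewrite subrr; rewrite /Rintegral integral0 mulr0 addr0.
Qed.

(** Cauchy-Schwarz, obtained by expanding the integral of the squared deviation of the increment
    from its mean [c]; a measure of mass zero is treated apart. *)
Lemma jump_sqr_le (B : R) (v : V -> R) x : measurable_fun setT v ->
  (forall x, `|v x| <= B) ->
  jump m v x ^+ 2 <= mass m * \int[m]_z (v (x + z) - v x) ^+ 2.
Proof.
move=> mv vB; have di := Rintegrable_jump_diff m mv vB x.
have md := integrable_measurable di.
have d2i : Rintegrable m (fun z => (v (x + z) - v x) ^+ 2).
  apply: (@bounded_Rintegrable _ _ _ m _ ((2 * B) ^+ 2)); first exact: measurable_funX.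
  move=> z; rewrite normrX ler_sqr ?nnegrE//; first exact: (jump_diff_le vB (x, z)).
  by rewrite mulr_ge0// (bounded_B_ge0 vB).
have [m0|m0] := eqVneq (mass m) 0.
  suff -> : jump m v x = 0 by rewrite m0 mul0r expr0n.
  have mT0 : m setT = 0%E by rewrite mass_fin m0.
  by rewrite /jump /Rintegral (null_set_integral measurableT (measurable_int _ di) mT0).
have mp : 0 < mass m by rewrite lt_neqAle eq_sym m0 mass_ge0.
pose c := jump m v x / mass m.
have : 0 <= \int[m]_z ((v (x + z) - v x) - c) ^+ 2.
  by apply: Rintegral_ge0 => z _; exact: sqr_ge0.
under eq_Rintegral do rewrite sqrrB.
have d2 : Rintegrable m (fun z => (v (x + z) - v x) * c *+ 2).
  rewrite (_ : (fun z => _) = fun z => (c *+ 2) * (v (x + z) - v x)).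
    exact: RintegrableZ.
  by apply/funext => z; rewrite mulrnAl mulrC.
rewrite RintegralD//; [|exact: RintegrableB|exact: finite_measure_integrable_cst].
rewrite RintegralB// Rintegral_cst// -/(mass m).
under [in X in _ - X]eq_Rintegral do rewrite mulrC -mulrnAl.
rewrite RintegralZl// -/(jump m v x).
set I := Rintegral _ _ _ => H.
have : 0 <= mass m * (I - c *+ 2 * jump m v x + c ^+ 2 * mass m) by rewrite mulr_ge0// ltW.
rewrite (_ : mass m * _ = mass m * I - jump m v x ^+ 2); first by rewrite subr_ge0.
by rewrite /c; field.
Qed.

Variable Phi : R -> R.
Hypothesis Phi_meas : measurable_fun setT Phi.
Hypothesis Phi0 : Phi 0 = 0.
Hypothesis Phi_sub : forall a b, Phi b - Phi a <= phi b * (b - a).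

Lemma Phi_ge0 a : 0 <= Phi a.
Proof. by have := Phi_sub a 0; rewrite Phi0 phi0 mul0r; lra. Qed.

Lemma Phi_le M a : `|a| <= M -> Phi a <= phi_sup M * `|a|.
Proof.
move=> aM; have := Phi_sub 0 a; rewrite Phi0 !subr0 => /le_trans; apply.
by apply: le_trans (ler_norm _) _; rewrite normrM ler_wpM2r// phi_bounded.
Qed.

Lemma Rintegrable_Phi M (u : V -> R) : Rintegrable leb u -> (forall x, `|u x| <= M) ->
  Rintegrable leb (Phi \o u).
Proof.
move=> ui uM; apply: (Rintegrable_le (g := fun x => phi_sup M * `|u x|)).
- by apply: measurableT_comp => //; exact: integrable_measurable ui.
- by move=> x; rewrite ger0_norm ?Phi_ge0//; exact: Phi_le.
- by apply: RintegrableZ; exact: Rintegrable_norm.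
Qed.

Lemma Rintegrable_phi (u : V -> R) : Rintegrable leb u -> Rintegrable leb (phi \o u).
Proof.
move=> ui; apply: (Rintegrable_le (g := fun x => Lip * `|u x|)).
- by apply: measurable_phi_comp; exact: integrable_measurable ui.
- by move=> x; have := phi_lip (u x) 0; rewrite phi0 !subr0.
- by apply: RintegrableZ; exact: Rintegrable_norm.
Qed.

Lemma jump_form_ge0 v : 0 <= jump_form m v v.
Proof. by apply: Rintegral_ge0 => p _; rewrite -expr2 sqr_ge0. Qed.

Lemma Rintegrable_step M (u : V -> R) : Rintegrable leb u -> (forall x, `|u x| <= M) ->
  Rintegrable leb (scheme_step u).
Proof.
move=> ui uM; have mu := integrable_measurable ui.
have M0 : 0 <= M := bounded_B_ge0 uM.
apply: Rintegrable_ltyP; first exact: measurable_step.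
have H : (L1dist leb (scheme_step u) (scheme_step (cst 0%R)) <= L1dist leb u (cst 0%R))%E.
  by apply: (@step_contraction M) => // x; rewrite normr0.
rewrite (_ : (\int[leb]_x _)%E = L1dist leb (scheme_step u) (scheme_step (cst 0%R))).
  apply: le_lt_trans H _; rewrite (_ : L1dist _ _ _ = (\int[leb]_x `|u x|%:E)%E).
    exact: Rintegrable_lty ui.
  by apply: eq_integral => x _; rewrite subr0.
by apply: eq_integral => x _; rewrite step0 subr0.
Qed.

(** Write u' for the new value, v = phi(u), J for [jump] and E for the form of v. Convexity
    ([Phi_sub]) gives Phi(u') - Phi(u) <= phi(u') * delta * Jv. Replacing phi(u') by v costs at most
    delta^2 * Lip * (Jv)^2, which [jump_sqr_le] controls. After integration the main term is -(delta
    / 2) * E by parts, and the error is at most (delta / 4) * E, which explains the 4 in the CFL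
    condition. *)
Lemma energy_step M (u : V -> R) : Rintegrable leb u -> (forall x, `|u x| <= M) ->
  \int[leb]_x Phi (scheme_step u x) + delta / 4 * jump_form m (phi \o u) (phi \o u) <=
  \int[leb]_x Phi (u x).
Proof.
move=> ui uM; have mu := integrable_measurable ui.
have mv := measurable_phi_comp mu; have vB := phi_comp_bounded uM.
set v := phi \o u in mv vB *.
have vi : Rintegrable leb v by exact: Rintegrable_phi.
have [v2i vJi vJE] := jump_form_ibp m_even mv vB vi.
have Psi : Rintegrable leb (fun x => Phi (scheme_step u x)).
  apply: (@Rintegrable_Phi M); first exact: (@Rintegrable_step M).
  exact: step_bounded.
have Pui : Rintegrable leb (fun x => Phi (u x)) by exact: (@Rintegrable_Phi M).
pose I x := \int[m]_z ((v (x + z) - v x) * (v (x + z) - v x)).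
have Ii : Rintegrable leb I by exact: (Rintegrable_fubini v2i).
have IE : \int[leb]_x I x = jump_form m v v by rewrite /jump_form Rfubini.
have key x : Phi (scheme_step u x) - Phi (u x) <=
    delta * (v x * jump m v x) + delta * delta * Lip * mass m * I x.
  apply: le_trans (Phi_sub _ _) _.
  have dE : scheme_step u x - u x = delta * jump m v x by rewrite /scheme_step addrC addKr.
  rewrite dE.
  have -> : phi (scheme_step u x) * (delta * jump m v x) = delta * (v x * jump m v x) +
     delta * ((phi (scheme_step u x) - v x) * jump m v x) by ring.
  rewrite lerD2l -!mulrA ler_wpM2l//.
  apply: le_trans (ler_norm _) _; rewrite normrM.
  have := phi_lip (scheme_step u x) (u x); rewrite dE normrM (ger0_norm delta_ge0) => H.
  apply: le_trans (ler_wpM2r (normr_ge0 _) H) _.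
  rewrite -!mulrA -expr2 real_normK ?num_real// mulrCA ler_wpM2l// ler_wpM2l ?Lip_ge0//.
  by have := jump_sqr_le x mv vB; under eq_Rintegral do rewrite expr2.
have := @le_Rintegral _ _ _ leb setT _ _ measurableT (RintegrableB Psi Pui)
  (RintegrableD (RintegrableZ delta vJi) (RintegrableZ (delta * delta * Lip * mass m) Ii))
  (fun x _ => key x).
rewrite RintegralB// RintegralD//; [|exact: RintegrableZ..].
rewrite !RintegralZl// vJE IE.
have E0 := jump_form_ge0 v.
have := ler_wpM2r (mulr_ge0 delta_ge0 E0) cfl.
set E := jump_form m v v in E0 *.
have -> : delta * delta * Lip * mass m * E = delta * Lip * mass m * (delta * E) by ring.
lra.
Qed.

End scheme.

(** * Iteration of the scheme: uniform bounds and discrete weak form *)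

Section iterates.
Variables (R : realType) (N : nat).
Notation V := 'rV[R]_N.
Notation leb := (lebesgue_rV R N).
Variable m : {finite_measure set V -> \bar R}.
Hypothesis m_even : forall A : set V, measurable A ->
  m ((fun z : V => - z) @^-1` A) = m A.
Variables (phi : R -> R) (Lip delta M : R).
Hypothesis phi_nd : {homo phi : r s / r <= s}.
Hypothesis phi0 : phi 0 = 0.
Hypothesis phi_lip : forall s t, `|phi s - phi t| <= Lip * `|s - t|.
Hypothesis delta_ge0 : 0 <= delta.
Hypothesis cfl : 4 * (delta * Lip * mass m) <= 1.
Variable u0 : V -> R.
Hypothesis u0i : Rintegrable leb u0.
Hypothesis u0M : forall x, `|u0 x| <= M.

Definition iterate (k : nat) : V -> R := iter k (scheme_step m phi delta) u0.

Lemma iterate_bounded k x : `|iterate k x| <= M.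
Proof.
suff : measurable_fun setT (iterate k) /\ forall x, `|iterate k x| <= M by case.
elim: k => [|k [mk bk]]; first by split => //; exact: integrable_measurable u0i.
by split; [exact: measurable_step|exact: (step_bounded phi_nd phi_lip delta_ge0 cfl mk bk)].
Qed.

Lemma iterate_integrable k : Rintegrable leb (iterate k).
Proof.
elim: k => [//|k IHk].
apply: (Rintegrable_step phi_nd phi_lip delta_ge0 cfl IHk (iterate_bounded k)).
Qed.

Lemma iterate_measurable k : measurable_fun setT (iterate k).
Proof. exact: integrable_measurable (iterate_integrable k). Qed.

Lemma iterate_shift k (y x : V) :
  iter k (scheme_step m phi delta) (fun x => u0 (x + y)) x = iterate k (x + y).
Proof.
elim: k x => [//|k IHk] x; rewrite /= -(step_shift m phi delta (iterate k)).
by congr (scheme_step _ _ _ _ _); apply/funext.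
Qed.

(** A step commutes with translations and contracts L1, so every time level inherits the modulus of
    the datum. *)
Lemma iterate_translation k (y : V) :
  (L1dist leb (fun x => iterate k (x + y)) (iterate k) <=
   L1dist leb (fun x => u0 (x + y)) u0)%E.
Proof.
elim: k => [//|k IHk]; apply: le_trans IHk.
rewrite (_ : (fun x => iterate k.+1 (x + y)) =
    scheme_step m phi delta (fun x => iterate k (x + y))); last first.
  by apply/funext => x; rewrite step_shift.
apply: (step_contraction phi_nd phi_lip delta_ge0 cfl (M := M)).
- by apply: measurable_comp_shift; exact: iterate_measurable.
- exact: iterate_measurable.
- by move=> x; exact: iterate_bounded.
- exact: iterate_bounded.
Qed.

(** Contraction against the zero function, which a step fixes. *)
Lemma iterate_L1 k : (\int[leb]_x `|iterate k x|%:E <= \int[leb]_x `|u0 x|%:E)%E.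
Proof.
elim: k => [//|k IHk]; apply: le_trans IHk.
have H : (L1dist leb (iterate k.+1) (scheme_step m phi delta (cst 0%R)) <=
    L1dist leb (iterate k) (cst 0%R))%E.
  apply: (step_contraction phi_nd phi_lip delta_ge0 cfl (M := M)) => //.
  - exact: iterate_measurable.
  - exact: iterate_bounded.
  - by move=> x; rewrite normr0; apply: le_trans (u0M 0).
move: H; rewrite /L1dist.
under eq_integral do rewrite step0 subr0.
by under [in X in (_ <= X)%E -> _]eq_integral do rewrite subr0.
Qed.

Local Notation v k := (phi \o iterate k).

Lemma iterate_phi_bounded k x : `|v k x| <= phi_sup phi M.
Proof. by apply: phi_bounded => //; exact: iterate_bounded. Qed.

Lemma iterate_phi_measurable k : measurable_fun setT (v k).
Proof. by apply: measurable_phi_comp => //; exact: iterate_measurable. Qed.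

Lemma iterate_phi_integrable k : Rintegrable leb (v k).
Proof. exact: (Rintegrable_phi phi_nd phi0 phi_lip (iterate_integrable k)). Qed.

(** Telescoping of [energy_step]; the final integral of Phi is nonnegative and is dropped, and the
    initial one is bounded through [Phi_le]. *)
Lemma iterate_energy (Phi : R -> R) K : measurable_fun setT Phi -> Phi 0 = 0 ->
  (forall a b, Phi b - Phi a <= phi b * (b - a)) ->
  \sum_(k < K) delta * jump_form m (v k) (v k) <=
  4 * (phi_sup phi M * \int[leb]_x `|u0 x|).
Proof.
move=> mPhi Phi0 Phi_sub.
have Pi k : Rintegrable leb (fun x => Phi (iterate k x)).
  apply: (Rintegrable_Phi phi_nd phi0 mPhi Phi0 Phi_sub (iterate_integrable k)).
  exact: iterate_bounded.
have H : \int[leb]_x Phi (iterate K x) +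
    \sum_(k < K) delta / 4 * jump_form m (v k) (v k) <= \int[leb]_x Phi (u0 x).
  elim: K => [|K IHK]; first by rewrite big_ord0 addr0.
  rewrite big_ord_recr/= addrCA; apply: le_trans IHK; rewrite addrC.
  rewrite addrC [leRHS]addrC lerD2l.
  exact: (energy_step m_even phi_nd phi0 phi_lip delta_ge0 cfl mPhi Phi0 Phi_sub
    (iterate_integrable K) (iterate_bounded K)).
have H0 : 0 <= \int[leb]_x Phi (iterate K x).
  by apply: Rintegral_ge0 => x _; exact: (Phi_ge0 phi0 Phi0 Phi_sub).
have H1 : \int[leb]_x Phi (u0 x) <= phi_sup phi M * \int[leb]_x `|u0 x|.
  rewrite -RintegralZl//; last exact: Rintegrable_norm.
  apply: le_Rintegral => //; [exact: (Pi 0)|by apply: RintegrableZ; exact: Rintegrable_norm|].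
  by move=> x _; exact: (Phi_le phi_nd Phi0 Phi_sub).
have -> : \sum_(k < K) delta * jump_form m (v k) (v k) =
    4 * \sum_(k < K) delta / 4 * jump_form m (v k) (v k).
  by rewrite mulr_sumr; apply: eq_bigr => k _; field.
rewrite ler_pM2l//; lra.
Qed.

Lemma Rintegrable_iterate_mul k (g : V -> R) : Rintegrable leb g ->
  Rintegrable leb (fun x => iterate k x * g x).
Proof.
move=> gi; apply: (Rintegrable_le (g := fun x => M * `|g x|)).
- by apply: measurable_funM; [exact: iterate_measurable|exact: integrable_measurable gi].
- by move=> x; rewrite normrM ler_wpM2r// iterate_bounded.
- by apply: RintegrableZ; exact: Rintegrable_norm.
Qed.

Lemma iterate_weak_step k (g : V -> R) : Rintegrable leb g ->
  \int[leb]_x (iterate k.+1 x * g x) =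
  \int[leb]_x (iterate k x * g x) - delta * (2^-1 * jump_form m (v k) g).
Proof.
move=> gi.
have [_ ji jE] := jump_form_ibp m_even (iterate_phi_measurable k) (iterate_phi_bounded k) gi.
under eq_Rintegral => x _.
  rewrite (_ : _ * _ = iterate k x * g x + delta * (g x * jump m (v k) x)); last first.
    by rewrite /= /scheme_step; ring.
  over.
rewrite /= RintegralD//; [|exact: Rintegrable_iterate_mul|exact: RintegrableZ].
by rewrite RintegralZl// jE mulrN.
Qed.

Lemma iterate_weak_diff i n (g : V -> R) : Rintegrable leb g ->
  \int[leb]_x (iterate (i + n) x * g x) - \int[leb]_x (iterate i x * g x) =
  - \sum_(k < n) delta * (2^-1 * jump_form m (v (i + k)) g).
Proof.
move=> gi; elim: n => [|n IHn]; first by rewrite addn0 subrr big_ord0 oppr0.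
by rewrite addnS iterate_weak_step// addrAC IHn big_ord_recr/= opprD.
Qed.

(* Summation by parts in time. *)
Lemma iterate_weak_sum K (psi : nat -> V -> R) : (forall k, Rintegrable leb (psi k)) ->
  \sum_(k < K) \int[leb]_x (iterate k x * (psi k.+1 x - psi k x)) -
  \sum_(k < K) delta * (2^-1 * jump_form m (v k) (psi k.+1)) +
  \int[leb]_x (u0 x * psi 0%N x) = \int[leb]_x (iterate K x * psi K x).
Proof.
move=> psii; elim: K => [|K IHK]; first by rewrite !big_ord0 subr0 add0r.
rewrite !big_ord_recr/= iterate_weak_step//.
have -> : \int[leb]_x (iterate K x * (psi K.+1 x - psi K x)) =
    \int[leb]_x (iterate K x * psi K.+1 x) - \int[leb]_x (iterate K x * psi K x).
  rewrite -RintegralB//; [|exact: Rintegrable_iterate_mul..].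
  by under eq_Rintegral do rewrite mulrBr.
rewrite -IHK; ring.
Qed.

(** Stated with a free parameter so that it can be summed over time levels: the first term is
    charged to the total energy, the second to the elapsed time. *)
Lemma jump_form_young (g : V -> R) (B eta : R) k : Rintegrable leb g ->
  (forall x, `|g x| <= B) -> 0 < eta ->
  `|jump_form m (v k) g| <= eta * jump_form m (v k) (v k) + eta^-1 * jump_form m g g.
Proof.
move=> gi gB eta0; have mg := integrable_measurable gi.
have [v2i _ _] := jump_form_ibp m_even (iterate_phi_measurable k)
  (iterate_phi_bounded k) (iterate_phi_integrable k).
have [vgi _ _] := jump_form_ibp m_even (iterate_phi_measurable k)
  (iterate_phi_bounded k) gi.
have [g2i _ _] := jump_form_ibp m_even mg gB gi.
rewrite /jump_form; apply: le_trans (le_normr_Rintegral measurableT vgi) _.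
rewrite -!RintegralZl// -RintegralD//; [|exact: RintegrableZ..].
apply: le_Rintegral => //; [exact: Rintegrable_norm|by apply: RintegrableD; exact: RintegrableZ|].
move=> p _; set a := _ - _; set b := g _ - _.
have ab c : 0 <= (eta * `|a| - c * `|b|) ^+ 2 by exact: sqr_ge0.
rewrite normrM -(@ler_pM2l _ eta)// mulrDr !mulrA mulfV ?gt_eqF// mul1r.
have := ab 1; rewrite mul1r sqrrB.
have -> : (eta * `|a|) ^+ 2 = eta * eta * a * a.
  by rewrite exprMn real_normK ?num_real//; ring.
have -> : `|b| ^+ 2 = b * b by rewrite real_normK ?num_real// expr2.
have : 0 <= eta * `|a| * `|b| by rewrite !mulr_ge0// ltW.
rewrite mulr2n; lra.
Qed.

End iterates.

(** * Moduli of translation and mollification by a tent *)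

Section tent.
Variables (R : realType) (N : nat).
Notation V := 'rV[R]_N.
Notation leb := (lebesgue_rV R N).

Lemma L1_translation_modulus (f : V -> R) : Rintegrable leb f ->
  forall e : R, 0 < e -> exists2 d : R, 0 < d &
  forall y : V, `|y| < d -> (L1dist leb (fun x : V => f (x + y))%R f <= e%:E)%E.
Proof.
move=> fi e e0; apply: contrapT => H.
have {}H (k : nat) : exists y : V, `|y| < k.+1%:R^-1 /\
    ~ (L1dist leb (fun x : V => f (x + y))%R f <= e%:E)%E.
  apply: contrapT => H'; apply: H; exists k.+1%:R^-1; first by rewrite invr_gt0.
  by move=> y yk; apply: contrapT => H2; apply: H'; exists y.
have [y_ Hy] := choice H.
have y0 : y_ @ \oo --> (0 : V).
  apply/cvgr0Pnorm_lt => d d0; near=> k.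
  apply: lt_trans (Hy k).1 _; near: k; exact: near_infty_natSinv_lt (PosNum d0).
have /ge0_cvge0P := ltc_integrable fi y0 => /(_ (fun k => L1dist_ge0 _ _ _) _ e0)[k _ Hk].
by have [_] := Hy k; apply; exact: Hk k (leqnn k).
Unshelve. all: by end_near. Qed.

Lemma continuous_measurable_rV (f : V -> R) : continuous f -> measurable_fun setT f.
Proof.
move=> cf; apply: (measurability (RGenOpens.G (R := R))); first exact: RGenOpens.measurableE.
move=> _ [_ [a [b ->]] <-]; rewrite setTI; apply: open_measurable_rV.
apply: open_comp; last exact: itv_open.
by move=> x _; exact: cf.
Qed.

Lemma measurable_rV_cball (r : R) : measurable [set x : V | `|x| <= r].
Proof.
rewrite (_ : mkset _ = ~` [set x : V | r < `|x|]); last first.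
  by apply/seteqP; split=> x /=; rewrite real_leNgt ?num_real//; move/negP.
apply: measurableC; apply: open_measurable_rV.
rewrite (_ : mkset _ = (@Num.Def.normr R V) @^-1` [set s : R | r < s])//.
by apply: open_comp; [move=> x _; exact: norm_continuous|exact: open_gt].
Qed.

Lemma lebesgue_rV_cball_gt0 (r : R) : 0 < r -> (0 < leb [set x : V | (`|x| <= r)%R])%E.
Proof.
move=> r0; pose A := fun i : 'I_N => [set` `[- r, r]].
have -> : [set x : V | `|x| <= r] = [set x : V | forall i, A i (x ord0 i)].
  apply/seteqP; split => x /= H.
    by move=> i; rewrite /A/= in_itv/= -ler_norml; exact: le_trans (ler_norm_coord _ _) H.
  by apply: rV_norm_le => // [|i]; [exact: ltW|];
    rewrite ler_norml; have := H i; rewrite /A/= in_itv.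
rewrite lebesgue_rV_box; last by move=> i; exact: measurable_itv.
rewrite /A (eq_bigr (fun _ => (r - - r)%:E)); last first.
  move=> i _; rewrite lebesgue_measure_itv/= lte_fin ifT ?EFinB//; lra.
rewrite prodEFin lte_fin prodr_gt0// => i _; lra.
Qed.

Variable eps : R.
Hypothesis eps0 : 0 < eps.

(** A compactly supported Lipschitz kernel: this regularity suffices to bound its jump form. It
    takes values in [0, 1] and is not normalised. *)
Definition tent (y : V) : R := Num.max 0 (1 - `|y| / eps).

Lemma tent_ge0 y : 0 <= tent y. Proof. by rewrite /tent le_max lexx. Qed.

Lemma tent_le1 y : tent y <= 1.
Proof. by rewrite /tent ge_max ler01/= lerBlDr lerDl divr_ge0// ltW. Qed.

Lemma tent_eq0 y : eps <= `|y| -> tent y = 0.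
Proof.
by move=> ey; apply/max_idPl; rewrite subr_le0 ler_pdivlMr// mul1r.
Qed.

Lemma tent_norm y : `|tent y| = tent y. Proof. by rewrite ger0_norm// tent_ge0. Qed.

Lemma tent_lip y z : `|tent y - tent z| <= eps^-1 * `|y - z|.
Proof.
have H a b : `|Num.max 0 a - Num.max 0 b| <= `|a - b| :> R.
  have h1 := ler_norm (a - b); have h2 := ler_norm (b - a).
  rewrite distrC in h2; rewrite ler_norml /Num.max.
  by do 2 case: ltP => ?; apply/andP; split; lra.
apply: le_trans (H _ _) _.
rewrite (_ : _ - _ - _ = (`|z| - `|y|) * eps^-1); last by ring.
have ei0 : 0 <= eps^-1 by rewrite invr_ge0 ltW.
rewrite normrM (ger0_norm ei0) mulrC; apply: ler_wpM2l => //.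
rewrite ler_norml; apply/andP; split; last by rewrite (distrC y); exact: lerB_dist.
by rewrite lerNl opprB; exact: lerB_dist.
Qed.

Lemma continuous_tent : continuous tent.
Proof.
move=> y; have FF : Filter (nbhs (y : V)) by exact: (@nbhs_filter V y).
apply/(@cvgrPdist_le R R^o V (nbhs (y : V)) FF) => e e0.
have ee0 : 0 < e * eps by rewrite mulr_gt0.
have := @cvgr_dist_le R V V (nbhs (y : V)) FF id y (@cvg_id V (nbhs (y : V))) (e * eps) ee0.
apply: (@filterS V (nbhs (y : V)) FF) => z yz; apply: le_trans (tent_lip _ _) _.
by rewrite mulrC ler_pdivrMr.
Qed.

Lemma measurable_tent : measurable_fun setT tent.
Proof. exact: continuous_measurable_rV continuous_tent. Qed.

Lemma Rintegrable_tent : Rintegrable leb tent.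
Proof.
apply: (Rintegrable_le (g := \1_[set x : V | `|x| <= eps])) => //.
- exact: measurable_tent.
- move=> y; rewrite tent_norm indicE; have [ye|ye] := leP `|y| eps.
    by rewrite mem_set// tent_le1.
  by rewrite tent_eq0// ltW.
apply/integrableP; split; first by apply/measurable_EFinP; apply: measurable_indic; exact: measurable_rV_cball.
under eq_integral do rewrite /= ger0_norm//.
have mB := measurable_rV_cball eps.
by rewrite integral_indic// setIT; exact: lebesgue_rV_bounded.
Qed.

Definition tent_mass : R := \int[leb]_y tent y.

Lemma tent_mass_gt0 : 0 < tent_mass.
Proof.
have e20 : 0 < eps / 2 by rewrite divr_gt0.
have mB := measurable_rV_cball (eps / 2).
rewrite -lte_fin -EFin_Rintegral; last exact: Rintegrable_tent.
(* On the ball of radius eps / 2, which has positive volume, the tent is at least 1/2. *)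
apply: (@lt_le_trans _ _ (2^-1%:E * leb [set x : V | (`|x| <= eps / 2)%R])%E).
  by rewrite mule_gt0 ?lebesgue_rV_cball_gt0// lte_fin.
have mI : measurable_fun setT
    (fun x : V => (\1_[set x : V | (`|x| <= eps / 2)%R] x : R)%:E).
  by apply/measurable_EFinP; exact: measurable_indic.
rewrite -[X in leb X]setIT -integral_indic// -ge0_integralZl// ?lee_fin//.
apply: ge0_le_integral => //.
- exact: measurable_funeM.
- by apply/measurable_EFinP; exact: measurable_tent.
move=> x _; rewrite -EFinM lee_fin indicE; have [xe|xe] := leP `|x| (eps / 2).
  rewrite mem_set// mulr1 /tent le_max; apply/orP; right.
  have : `|x| / eps <= 2^-1 by rewrite ler_pdivrMr// mulrC.
  lra.
by rewrite memNset ?mulr0 ?tent_ge0//=; apply/negP; rewrite -ltNge.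
Qed.

Lemma Rintegral_shift (f : V -> R) (y : V) : measurable_fun setT f ->
  \int[leb]_x f (x + y) = \int[leb]_x f x.
Proof.
move=> mf; rewrite /Rintegral; congr fine.
apply: (integral_preserving leb (fun x : V => x + y) _ _ (EFin \o f)).
- exact: measurable_shift.
- exact: lebesgue_rV_shift.
- exact/measurable_EFinP.
Qed.

(** Convolution with the unnormalised tent, hence an approximation of [tent_mass * u]. *)
Definition moll (u : V -> R) (x : V) : R := \int[leb]_y (u y * tent (y - x)).

Lemma Rintegrable_tent_shift x : Rintegrable leb (fun y : V => tent (y - x)).
Proof. exact: (integrable_shift (- x) Rintegrable_tent). Qed.

Section moll.
Variables (M : R) (u : V -> R).
Hypotheses (mu : measurable_fun setT u) (uM : forall x, `|u x| <= M).

Lemma Rintegrable_mul_bounded (g : V -> R) : Rintegrable leb g ->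
  Rintegrable leb (fun x => u x * g x).
Proof.
move=> gi; apply: (Rintegrable_le (g := fun x => M * `|g x|)).
- by apply: measurable_funM => //; exact: integrable_measurable gi.
- by move=> x; rewrite normrM ler_wpM2r.
- by apply: RintegrableZ; exact: Rintegrable_norm.
Qed.

Lemma mollE x : moll u x = \int[leb]_y (u (y + x) * tent y).
Proof.
rewrite /moll -(Rintegral_shift (f := fun y => u y * tent (y - x)) x).
  by apply: eq_Rintegral => y _; rewrite addrK.
apply: measurable_funM => //.
exact: integrable_measurable (Rintegrable_tent_shift x).
Qed.

End moll.

Lemma Rintegrable_moll M (u : V -> R) x : measurable_fun setT u ->
  (forall x, `|u x| <= M) -> Rintegrable leb (fun y => u (y + x) * tent y).
Proof.
move=> mu uM; apply: (@Rintegrable_mul_bounded M (fun y => u (y + x))) => //.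
- exact: measurable_comp_shift.
- exact: Rintegrable_tent.
Qed.

(** As the tent is at most 1, the regularity is taken from the L1 modulus of [u], which is common to
    all approximations. *)
Lemma moll_lip M (u : V -> R) x x' : measurable_fun setT u -> (forall x, `|u x| <= M) ->
  (`|moll u x - moll u x'|%:E <=
    L1dist leb (fun y : V => u (y + (x - x')))%R u)%E.
Proof.
move=> mu uM; rewrite !mollE//.
have xi := Rintegrable_moll x mu uM; have xi' := Rintegrable_moll x' mu uM.
have mx := measurable_comp_shift x mu; have mx' := measurable_comp_shift x' mu.
rewrite -RintegralB// EFin_normr_Rintegral//; last exact: RintegrableB.
apply: le_trans (le_abse_integral _ _ _) _ => //.
  exact: measurable_int (RintegrableB xi xi').
rewrite -(L1dist_shift x' (measurable_comp_shift _ mu) mu).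
apply: ge0_le_integral => //.
- apply: measurableT_comp => //; exact: measurable_int (RintegrableB xi xi').
- apply: measurable_EFin_norm_sub => //.
  exact: (measurable_comp_shift x' (measurable_comp_shift (x - x') mu)).
move=> y _ /=; rewrite lee_fin -mulrBl normrM tent_norm -addrA (addrC x') subrK.
by rewrite ler_piMr// tent_le1.
Qed.

Lemma measurable_moll (u : V -> R) : measurable_fun setT u -> measurable_fun setT (moll u).
Proof.
move=> mu; rewrite (_ : moll u = fun x => \int[leb]_y (u (y + x) * tent y)).
  apply: (measurable_Rintegral2 leb (f := fun p : V * V => u (p.2 + p.1) * tent p.2)).
  apply: measurable_funM; last exact: (measurableT_comp measurable_tent).
  apply: measurableT_comp => //; rewrite (_ : (fun p => _) = fun p : V * V => p.1 + p.2).
    exact: measurable_addrV.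
  by apply/funext => p; rewrite addrC.
by apply/funext => x; exact: mollE.
Qed.

(** The error at x integrates u(x) - u(x + y) against tent(y), which vanishes unless |y| < eps;
    exchanging the integrals leaves the L1 modulus of [u] at y. *)
Lemma moll_err M (e : R) (u : V -> R) : measurable_fun setT u -> (forall x, `|u x| <= M) ->
  (forall y : V, `|y| < eps -> (L1dist leb (fun x : V => u (x + y))%R u <= e%:E)%E) ->
  0 <= e ->
  (L1dist leb (fun x => tent_mass * u x)%R (moll u) <= (tent_mass * e)%:E)%E.
Proof.
move=> mu uM ue e0.
pose h (p : V * V) := `|u (p.2 + p.1) - u p.1| * tent p.2.
have mh : measurable_fun setT h.
  apply: measurable_funM; last exact: (measurableT_comp measurable_tent).
  apply: measurableT_comp => //; apply: measurable_funB; last exact: measurableT_comp.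
  apply: measurableT_comp => //; rewrite (_ : (fun p => _) = fun p : V * V => p.1 + p.2).
    exact: measurable_addrV.
  by apply/funext => p; rewrite addrC.
have h0 p : 0 <= h p by rewrite mulr_ge0// tent_ge0.
have mhE : measurable_fun setT (fun p => (h p)%:E) by exact/measurable_EFinP.
have h0E p : (0 <= (h p)%:E)%E by rewrite lee_fin.
have mm := measurable_moll mu.
apply: (@le_trans _ _ (\int[leb]_x \int[leb]_y (h (x, y))%:E)%E).
  apply: ge0_le_integral => //.
  - apply: measurable_EFin_norm_sub => //; apply: measurable_funM => //.
  - exact: (@measurable_integral2 _ _ _ _ _ leb (fun p => (h p)%:E)).
  move=> x _; rewrite mollE// -RintegralZr; last 2 first.
  - by [].
  - exact: Rintegrable_tent.
  have xi := Rintegrable_moll x mu uM.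
  have ci : Rintegrable leb (fun y => tent y * u x).
    rewrite (_ : (fun y => _) = fun y => u x * tent y).
      by apply: RintegrableZ; exact: Rintegrable_tent.
    by apply/funext => y; rewrite mulrC.
  rewrite -RintegralB// EFin_normr_Rintegral//; last exact: RintegrableB.
  apply: le_trans (le_abse_integral _ _ _) _ => //.
    exact: measurable_int (RintegrableB ci xi).
  apply: ge0_le_integral => //.
  - apply: measurableT_comp => //; exact: measurable_int (RintegrableB ci xi).
  - by apply: (measurable_fun_pair2 (f := fun p => (h p)%:E)).
  move=> y _ /=; rewrite lee_fin /h /= mulrC -mulrBl normrM tent_norm.
  by rewrite distrC.
rewrite (fubini_tonelli (fun p => (h p)%:E))//=.
apply: (@le_trans _ _ (\int[leb]_y ((tent y)%:E * e%:E))%E); last first.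
  rewrite ge0_integralZr//; last 2 first.
  - by apply/measurable_EFinP; exact: measurable_tent.
  - by move=> y _; rewrite lee_fin tent_ge0.
  by rewrite EFin_Rintegral ?EFinM//; exact: Rintegrable_tent.
apply: ge0_le_integral => //.
- by move=> y _; apply: integral_ge0 => x _.
- exact: (measurable_fun_fubini_tonelli_G (fun p => (h p)%:E)).
- apply: emeasurable_funM; last exact: measurable_cst.
  by apply/measurable_EFinP; exact: measurable_tent.
move=> y _; rewrite /h /=.
have [ye|ye] := leP eps `|y|.
  rewrite tent_eq0// mul0e (_ : (fun x => _) = cst 0%E) ?integral0//.
  by apply/funext => x; rewrite mulr0.
under eq_integral do rewrite mulrC EFinM.
rewrite ge0_integralZl//; last 2 first.
- apply: measurable_EFin_norm_sub => //.
  exact: measurable_comp_addl.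
- by rewrite lee_fin tent_ge0.
by apply: lee_pmul => //; [rewrite lee_fin tent_ge0|exact: integral_ge0|
 under eq_integral do rewrite (addrC y); exact: ue].
Qed.

End tent.

(** Along an ultrafilter a cluster point is a limit: if the preimage of a neighbourhood were not in
    [U], its complement would be, against clustering. *)
Lemma ultra_bounded_cvg (R : realType) (I : Type) (U : set_system I) (f : I -> R) (B : R) :
  UltraFilter U -> (forall i, `|f i| <= B) -> exists l : R, f @ U --> l.
Proof.
move=> UU fB; have PU : ProperFilter U by case: UU.
have PF : ProperFilter (f @ U) by exact: fmap_proper_filter.
have UI : (f @ U) `[- B, B]%classic.
  by rewrite /fmap/=; apply: filterS (@filterT _ U _) => i _ /=; rewrite in_itv/= -ler_norml.
have [l [_ cl]] := @segment_compact R (- B) B (f @ U) PF UI.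
exists l => W Wl; have [//|UC] := in_ultra_setVsetC (f @^-1` W) UU.
have [] := cl (~` W) W => //.
by move=> x [].
Qed.

(** * Local L1 distances and Arzela-Ascoli for the mollified family *)

Section compactness.
Variables (R : realType) (N : nat).
Notation V := 'rV[R]_N.
Notation leb := (lebesgue_rV R N).
Local Notation K r := [set x : V | `|x| <= r].

Definition locdist (r : R) (u w : V -> R) : \bar R :=
  (\int[leb]_(x in K r) `|u x - w x|%:E)%E.

Lemma locdist_ge0 r u w : (0 <= locdist r u w)%E.
Proof. by apply: integral_ge0 => x _; rewrite lee_fin. Qed.

Definition cvol (r : R) : R := fine (leb (K r)).

Lemma cvolE r : leb (K r) = (cvol r)%:E.
Proof. by rewrite /cvol fineK// ge0_fin_numE// lebesgue_rV_bounded. Qed.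

Lemma cvol_ge0 r : 0 <= cvol r. Proof. exact: fine_ge0. Qed.

Lemma locdist_le_L1dist r u w : measurable_fun setT u -> measurable_fun setT w ->
  (locdist r u w <= L1dist leb u w)%E.
Proof.
move=> mu mw; apply: ge0_subset_integral => //; first exact: measurable_rV_cball.
exact: measurable_EFin_norm_sub.
Qed.

Lemma locdist_triangle r u v w : measurable_fun setT u -> measurable_fun setT v ->
  measurable_fun setT w -> (locdist r u w <= locdist r u v + locdist r v w)%E.
Proof.
move=> mu mv mw; have mK := @measurable_rV_cball R N r.
have S (f g : V -> R) : measurable_fun setT f -> measurable_fun setT g ->
    measurable_fun (K r) (fun x : V => (`|f x - g x|)%:E).
  by move=> mf mg; apply: (@measurable_funS _ _ _ _ setT) => //; exact: measurable_EFin_norm_sub.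
rewrite /locdist -ge0_integralD//; [|exact: S..].
apply: ge0_le_integral => //; [exact: S| |].
- by apply: emeasurable_funD; exact: S.
- by move=> x _; rewrite -EFinD lee_fin ler_distD.
Qed.

(** Triangle inequality through both mollified functions: each mollification error costs
    [tent_mass * e], and the middle term is at most [a] on a ball of volume [cvol r]. *)
Lemma locdist_moll (eps e a r M : R) (u w : V -> R) : 0 < eps -> 0 <= e ->
  measurable_fun setT u -> (forall x, `|u x| <= M) ->
  measurable_fun setT w -> (forall x, `|w x| <= M) ->
  (forall y : V, `|y| < eps -> (L1dist leb (fun x : V => u (x + y))%R u <= e%:E)%E) ->
  (forall y : V, `|y| < eps -> (L1dist leb (fun x : V => w (x + y))%R w <= e%:E)%E) ->
  (forall x, `|x| <= r -> `|moll eps u x - moll eps w x| <= a) ->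
  ((tent_mass N eps)%:E * locdist r u w <= (tent_mass N eps * e * 2 + a * cvol r)%:E)%E.
Proof.
move=> eps0 e0 mu uM mw wM ue we ua; have mK := @measurable_rV_cball R N r.
set th := tent_mass N eps.
have th0 : 0 < th by exact: tent_mass_gt0.
have mm := measurable_moll eps0 mu; have mm' := measurable_moll eps0 mw.
have S (f g : V -> R) : measurable_fun setT f -> measurable_fun setT g ->
    measurable_fun (K r) (fun x : V => (`|f x - g x|)%:E).
  by move=> mf mg; apply: (@measurable_funS _ _ _ _ setT) => //; exact: measurable_EFin_norm_sub.
have mtu : measurable_fun setT (fun x => th * u x) by exact: measurable_funM.
have mtw : measurable_fun setT (fun x => th * w x) by exact: measurable_funM.
have -> : (th%:E * locdist r u w)%E = locdist r (fun x => th * u x) (fun x => th * w x).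
  rewrite /locdist -ge0_integralZl// ?lee_fin ?(ltW th0)//; last exact: S.
  by apply: eq_integral => x _; rewrite -EFinM -mulrBr normrM (ger0_norm (ltW th0)).
apply: (le_trans (locdist_triangle r mtu mm mtw)).
rewrite (_ : _ + a * _ = th * e + (a * cvol r + th * e)); last by ring.
rewrite EFinD; apply: leeD.
  by apply: (le_trans (locdist_le_L1dist r mtu mm)); exact: (moll_err eps0 mu uM).
apply: (le_trans (locdist_triangle r mm mm' mtw)).
rewrite EFinD; apply: leeD.
  apply: (@le_trans _ _ (\int[leb]_(x in K r) a%:E)%E).
    by apply: ge0_le_integral => //; exact: S.
  by rewrite integral_cst//= cvolE -EFinM.
apply: (le_trans (locdist_le_L1dist r mm' mtw)).
by rewrite L1dist_sym; exact: (moll_err eps0 mw wM).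
Qed.

Variables (M : R) (u0 : V -> R) (u_ : nat -> R -> V -> R).
Hypothesis u0i : Rintegrable leb u0.
Hypothesis u_meas : forall n t, measurable_fun setT (u_ n t).
Hypothesis u_bnd : forall n t x, `|u_ n t x| <= M.
Hypothesis u_trans : forall n t (y : V),
  (L1dist leb (fun x : V => u_ n t (x + y))%R (u_ n t) <=
   L1dist leb (fun x : V => u0 (x + y))%R u0)%E.
Hypothesis u_weak : forall eps eta, 0 < eps -> 0 < eta ->
  exists2 tau, 0 < tau & exists n0, forall n x t s, (n0 <= n)%N -> `|t - s| < tau ->
  `|moll eps (u_ n t) x - moll eps (u_ n s) x| <= eta.

(** Reduces closeness in L1 on a ball to uniform closeness of mollified values. One width [eps]
    serves all indices and times, since every modulus is dominated by that of [u0]. *)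
Lemma locdist_eventually (r e : R) : 0 < e -> exists eps a : R, [/\ 0 < eps, 0 < a &
  forall n p t s, (forall x, `|x| <= r ->
     `|moll eps (u_ n t) x - moll eps (u_ p s) x| <= a) ->
  (locdist r (u_ n t) (u_ p s) <= e%:E)%E].
Proof.
move=> e0; have e40 : 0 < e / 4 by rewrite divr_gt0.
have [eps eps0 Heps] := L1_translation_modulus u0i e40.
have th0 : 0 < tent_mass N eps by exact: tent_mass_gt0.
have c0 : 0 < cvol r + 1 by have := cvol_ge0 r; lra.
(* The two mollification errors take tent_mass * e / 4 each and the middle term at most as much;
   adding 1 to the volume keeps the denominator positive. *)
exists eps, (tent_mass N eps * (e / 4) / (cvol r + 1)); split => //.
  by rewrite !(divr_gt0, mulr_gt0).
move=> n p t s H.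
have := locdist_moll eps0 (ltW e40) (u_meas n t) (u_bnd n t) (u_meas p s) (u_bnd p s)
  (fun y ye => le_trans (u_trans n t y) (Heps y ye))
  (fun y ye => le_trans (u_trans p s y) (Heps y ye)) H.
set th := tent_mass N eps in th0 *.
have cc : th * (e / 4) / (cvol r + 1) * cvol r <= th * (e / 4).
  rewrite mulrAC ler_pdivrMr// ler_wpM2l ?mulr_ge0 ?ltW//; lra.
move=> HH; have := le_trans HH (_ : _ <= (th * e)%:E)%E; rewrite EFinM lee_pmul2l//.
apply; rewrite lee_fin.
have -> : th * e = th * (e / 4) * 4 by field.
have : 0 < th * (e / 4) by rewrite mulr_gt0.
lra.
Qed.

Lemma locdist_time (r e : R) : 0 < e ->
  exists2 tau, 0 < tau & exists n0, forall n t s, (n0 <= n)%N -> `|t - s| < tau ->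
  (locdist r (u_ n t) (u_ n s) <= e%:E)%E.
Proof.
move=> e0; have [eps [a [eps0 a0 H]]] := locdist_eventually r e0.
have [tau tau0 [n0 Hn]] := u_weak eps0 a0.
exists tau => //; exists n0 => n t s nn ts; apply: H => x _; exact: Hn.
Qed.

Lemma moll_bounded eps n t x : 0 < eps -> `|moll eps (u_ n t) x| <= M * tent_mass N eps.
Proof.
move=> eps0; rewrite mollE//.
have ti := Rintegrable_tent N eps0.
have ii := Rintegrable_moll eps0 x (u_meas n t) (u_bnd n t).
apply: le_trans (le_normr_Rintegral _ ii) _ => //.
rewrite -RintegralZl//; apply: le_Rintegral => //.
- exact: Rintegrable_norm.
- exact: RintegrableZ.
by move=> y _; rewrite normrM tent_norm ler_wpM2r// tent_ge0.
Qed.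

Lemma moll_equicontinuous eps eta : 0 < eps -> 0 < eta ->
  exists2 tau, 0 < tau & exists n0, forall n x x' t s, (n0 <= n)%N ->
  `|x - x'| < tau -> `|t - s| < tau ->
  `|moll eps (u_ n t) x - moll eps (u_ n s) x'| <= eta.
Proof.
move=> eps0 eta0; have e20 : 0 < eta / 2 by rewrite divr_gt0.
have [d d0 Hd] := L1_translation_modulus u0i e20.
have [tau tau0 [n0 Hn]] := u_weak eps0 e20.
exists (Num.min d tau); first by rewrite lt_min d0.
exists n0 => n x x' t s nn; rewrite !lt_min => /andP[xd _] /andP[_ ts].
apply: le_trans (ler_distD (moll eps (u_ n t) x') _ _) _.
rewrite [eta]splitr lerD//; last exact: Hn.
rewrite -lee_fin; apply: (le_trans (moll_lip eps0 x x' (u_meas n t) (u_bnd n t))).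
by apply: le_trans (u_trans _ _ _) _; exact: Hd.
Qed.

(** Arzela-Ascoli without a diagonal extraction: the limits along the ultrafilter exist at all
    points at once, they inherit the equicontinuity, and compactness of the ball times [0, T] makes
    the approximation uniform. *)
Lemma moll_ultra (U : set_system nat) (T r eps eta : R) : UltraFilter U ->
  \oo `<=` U -> 0 < eps -> 0 < eta ->
  exists A : V -> R -> R, \forall n \near U, forall x t, `|x| <= r -> 0 <= t <= T ->
    `|moll eps (u_ n t) x - A x t| <= eta.
Proof.
move=> UU Uoo eps0 eta0; have PU : ProperFilter U by case: UU.
have /choice[A HA] (p : V * R) : exists l : R,
    (fun n => moll eps (u_ n p.2) p.1) @ U --> l.
  by apply: (@ultra_bounded_cvg _ _ _ _ (M * tent_mass N eps)) => n; exact: moll_bounded.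
exists (fun x t => A (x, t)).
have e30 : 0 < eta / 3 by rewrite divr_gt0.
have [tau tau0 [n0 Hn]] := moll_equicontinuous eps0 e30.
have Un0 : U [set n | (n0 <= n)%N] by apply: Uoo; exists n0.
have A_eq x x' t s : `|x - x'| < tau -> `|t - s| < tau -> `|A (x, t) - A (x', s)| <= eta / 3.
  move=> xx ts; apply: (@closed_cvg _ _ U PU
    (fun n => `|moll eps (u_ n t) x - moll eps (u_ n s) x'|) [set z | z <= eta / 3]).
  - exact: closed_le.
  - by apply: filterS Un0 => n nn; exact: Hn.
  - by apply: cvg_norm; apply: cvgB; [exact: (HA (x, t))|exact: (HA (x', s))].
have cK : compact (K r `*` `[0, T]).
  apply: compact_setX; last exact: segment_compact.
  have [r0|r0] := leP 0 r; last first.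
    rewrite (_ : K r = set0); first exact: compact0.
    by rewrite -subset0 => x /= xr; have := normr_ge0 x; lra.
  rewrite (_ : K r = [set x : V | forall i, (fun=> `[- r, r]%classic) i (x ord0 i)]).
    by apply: (@rV_compact R N (fun=> `[- r, r]%classic)) => i; exact: segment_compact.
  apply/seteqP; split => x /= H.
    by move=> i; rewrite /= in_itv/= -ler_norml; exact: le_trans (ler_norm_coord _ _) H.
  by apply: rV_norm_le => // i; rewrite ler_norml; have := H i; rewrite /= in_itv.
have /compact_near_coveringP cov := cK.
have : \forall n \near U, K r `*` `[0, T] `<=`
    (fun p => `|moll eps (u_ n p.2) p.1 - A p| <= eta).
  apply: cov => -[x t] _ /=.
  have Ux : U [set n | `|moll eps (u_ n t) x - A (x, t)| <= eta / 3].
    have /cvgrPdist_le := HA (x, t) => /(_ _ e30).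
    by apply: filterS => n /=; rewrite distrC.
  (* Three errors of eta / 3: moving the point in the approximation, convergence at the centre (x,
     t), and moving the point in the limit. *)
  exists (ball x tau `*` ball t tau, [set n | (n0 <= n)%N] `&`
      [set n | `|moll eps (u_ n t) x - A (x, t)| <= eta / 3]).
    split => /=; last exact: filterI.
    by exists (ball x tau, ball t tau) => //=; split; exact: nbhsx_ballx.
  move=> [[x' t'] n] /= [[xx tt] [nn nA]].
  rewrite -ball_normE /= in xx; rewrite -ball_normE /= in tt.
  have H1 := Hn n x x' t t' nn xx tt; have H2 := A_eq x x' t t' xx tt.
  have := ler_distD (moll eps (u_ n t) x) (moll eps (u_ n t') x') (A (x', t')).
  have := ler_distD (A (x, t)) (moll eps (u_ n t) x) (A (x', t')). 
rewrite (distrC (moll eps (u_ n t') x') (moll eps (u_ n t) x)).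
  by move: H1 nA H2 => /= H1 nA H2 h1 h2; lra.
apply: filterS => n Hnn x t xr tT; apply: (Hnn (x, t)); split => //=.
Qed.

End compactness.

(** * Fatou's lemma and extraction of a subsequence converging almost everywhere *)

Section fatou_le.
Context d (X : measurableType d) (R : realType).
Variable m : {measure set X -> \bar R}.
Local Open Scope ereal_scope.

Lemma limn_einf_le (u : nat -> \bar R) (C : \bar R) :
  (\forall n \near \oo, u n <= C) -> limn_einf u <= C.
Proof.
move=> uC; rewrite limn_einf_lim; apply: lime_le; first exact: is_cvg_einfs.
apply: filterS uC => n un; apply: le_trans un; apply: ereal_inf_lbound.
by exists n => /=.
Qed.

Lemma fatou_ae_le (D : set X) (f : nat -> X -> R) (g : X -> R) (C : \bar R) :
  measurable D ->
  (forall n, measurable_fun D (f n)) -> measurable_fun D g ->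
  (forall n x, D x -> (0 <= f n x)%R) -> (forall x, D x -> (0 <= g x)%R) ->
  {ae m, forall x, D x -> f n x @[n --> \oo] --> g x} ->
  (\forall n \near \oo, \int[m]_(x in D) (f n x)%:E <= C) ->
  \int[m]_(x in D) (g x)%:E <= C.
Proof.
move=> mD mf mg f0 g0 fg fC.
have mfE n : measurable_fun D (fun x => (f n x)%:E) by exact/measurable_EFinP.
have mgE : measurable_fun D (fun x => (g x)%:E) by exact/measurable_EFinP.
have ml : measurable_fun D (fun x => limn_einf (fun n => (f n x)%:E)).
  rewrite (_ : (fun x => _) = fun x => - limn_esup (fun n => - (f n x)%:E))//.
  by apply: measurableT_comp => //; apply: measurable_fun_limn_esup => n; exact: measurableT_comp.
have H : \int[m]_(x in D) (g x)%:E = \int[m]_(x in D) limn_einf (fun n => (f n x)%:E).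
  apply: ae_eq_integral => //; apply: filterS fg => x fgx Dx.
  apply/esym; apply: (cvg_limn_einf_sup _).1.
  by apply: cvg_EFin; [exact: nearW|exact: fgx].
rewrite H; apply: le_trans (fatou m mD mfE _) _.
  by move=> n x Dx; rewrite lee_fin f0.
exact: limn_einf_le.
Qed.

End fatou_le.

(** The weights leave finitely many steps uncontrolled, as happens at a point outside the first few
    balls; from [j0] on the telescoping series converges absolutely. *)
Lemma cvg_summable_steps (R : realType) (a c : nat -> R) (j0 : nat) :
  (forall j, 0 <= c j) -> (forall j, (j0 <= j)%N -> c j = 1) ->
  (\sum_(0 <= j <oo) (`|a j.+1 - a j| * c j)%:E < +oo)%E -> cvgn a.
Proof.
move=> c0 c1 Soo.
pose b := fun j => a (j + j0)%N.
suff : cvgn b.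
  move=> /cvg_ex[l bl]; apply/cvg_ex; exists l.
  by rewrite -(cvg_shiftn j0).
have S0 j : (0 <= (`|a j.+1 - a j| * c j)%:E)%E by rewrite lee_fin mulr_ge0.
have Sfin : (\sum_(0 <= j <oo) (`|a j.+1 - a j| * c j)%:E)%E \is a fin_num.
  by rewrite ge0_fin_numE// nneseries_ge0// => n _ _.
have cs : cvgn [normed series (telescope b)].
  apply: nondecreasing_is_cvgn.
    by apply: nondecreasing_series => n _; rewrite /= normr_ge0.
  exists (fine (\sum_(0 <= j <oo) (`|a j.+1 - a j| * c j)%:E)%E) => _ [n _ <-].
  rewrite -lee_fin fineK// /series /= -sumEFin.
  apply: (@le_trans _ _ (\sum_(j0 <= i < n + j0) (`|a i.+1 - a i| * c i)%:E)%E).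
    rewrite -{1}[j0]add0n big_addn addnK le_eqVlt; apply/orP; left; apply/eqP.
    by apply: eq_bigr => i _; rewrite /b /telescope/= addSn c1 ?mulr1// leq_addl.
  apply: (@le_trans _ _ (\sum_(0 <= i < n + j0) (`|a i.+1 - a i| * c i)%:E)%E).
    rewrite [leRHS](big_cat_nat (n := j0)) ?leq_addl//=.
    by rewrite leeDr// sume_ge0.
  exact: nneseries_lim_ge.
have /cvg_ex[l cl] := normed_cvg cs.
have [b0 bE] : exists b0, forall n, b0 + series (telescope b) n = b n.
  by exists (b 0%N) => n; rewrite [RHS]eq_sum_telescope.
apply/cvg_ex; exists (b0 + l); rewrite -(funext bE).
exact: (@cvgD R R^o nat \oo _ (cst b0) (series (telescope b)) b0 l (cvg_cst _) cl).
Qed.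

Section extraction.
Variables (R : realType) (N : nat).
Notation V := 'rV[R]_N.
Notation leb := (lebesgue_rV R N).
Local Notation K r := [set x : V | `|x| <= r].
Variables (M : R) (u0 : V -> R) (u_ : nat -> R -> V -> R).
Hypothesis u0i : Rintegrable leb u0.
Hypothesis u_meas2 : forall n, measurable_fun setT (fun p : V * R => u_ n p.2 p.1).
Hypothesis u_bnd : forall n t x, `|u_ n t x| <= M.
Hypothesis u_trans : forall n t (y : V),
  (L1dist leb (fun x : V => u_ n t (x + y))%R (u_ n t) <=
   L1dist leb (fun x : V => u0 (x + y))%R u0)%E.
Hypothesis u_weak : forall eps eta, 0 < eps -> 0 < eta ->
  exists2 tau, 0 < tau & exists n0, forall n x t s, (n0 <= n)%N -> `|t - s| < tau ->
  `|moll eps (u_ n t) x - moll eps (u_ n s) x| <= eta.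

Lemma u_meas n t : measurable_fun setT (u_ n t).
Proof. exact: (measurable_fun_pair1 (f := fun p : V * R => u_ n p.2 p.1)). Qed.

(** All indices in [S] have mollified values close to the same ultrafilter limit, hence close to
    each other. *)
Lemma ultra_locdist (U : set_system nat) (T r e : R) : UltraFilter U -> \oo `<=` U ->
  0 < e -> exists2 S : set nat, U S & forall n p t, S n -> S p -> 0 <= t <= T ->
  (locdist r (u_ n t) (u_ p t) <= e%:E)%E.
Proof.
move=> UU Uoo e0.
have [eps [a [eps0 a0 H]]] := locdist_eventually u0i u_meas u_bnd u_trans r e0.
have a20 : 0 < a / 2 by rewrite divr_gt0.
have [A HA] := moll_ultra u0i u_meas u_bnd u_trans u_weak T r UU Uoo eps0 a20.
exists [set n | forall x t, `|x| <= r -> 0 <= t <= T ->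
    `|moll eps (u_ n t) x - A x t| <= a / 2] => //.
move=> n p t Sn Sp tT; apply: H => x xr.
have H1 := Sn x t xr tT; have H2 := Sp x t xr tT.
apply: le_trans (ler_distD (A x t) _ _) _.
by rewrite (distrC (A x t)); lra.
Qed.

(** [sigma j] is picked beyond j in the intersection of the sets S_0, ..., S_j, which belongs to the
    ultrafilter. The rates are summable with sum 1. *)
Lemma exists_subsequence (T : R) : exists sigma : nat -> nat,
  (forall j, (j <= sigma j)%N) /\
  forall i j k t, (i <= j)%N -> (i <= k)%N -> 0 <= t <= T ->
  (locdist i%:R (u_ (sigma j) t) (u_ (sigma k) t) <= (1 / (2 ^ i.+1)%:R)%:E)%E.
Proof.
have [U [UU Uoo]] := @ultraFilterLemma nat \oo _.
have PU : ProperFilter U by case: UU.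
have /choice[S HS] (i : nat) : exists S : set nat, U S /\
    forall n p t, S n -> S p -> 0 <= t <= T ->
    (locdist i%:R (u_ n t) (u_ p t) <= (1 / (2 ^ i.+1)%:R)%:E)%E.
  have e0 : 0 < 1 / (2 ^ i.+1)%:R :> R by rewrite divr_gt0// ltr0n expn_gt0.
  by have [S US HS] := @ultra_locdist U T i%:R _ UU Uoo e0; exists S.
have UI j : U [set n | forall i, (i <= j)%N -> S i n].
  elim: j => [|j IHj].
    by apply: filterS (HS 0%N).1 => n Sn i; rewrite leqn0 => /eqP ->.
  apply: filterS (filterI IHj (HS j.+1).1) => n [Hn Sn] i.
  by rewrite leq_eqVlt => /predU1P[->//|]; rewrite ltnS; exact: Hn.
have /choice[sigma Hs] (j : nat) : exists n : nat,
    (j <= n)%N /\ forall i, (i <= j)%N -> S i n.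
  have /filter_ex[n [nj nS]] : U ([set n | (j <= n)%N] `&`
      [set n | forall i, (i <= j)%N -> S i n]).
    by apply: filterI => //; apply: Uoo; exists j.
  by exists n.
exists sigma; split => [j|i j k t ij ik tT]; first exact: (Hs j).1.
by apply: (HS i).2 => //; [exact: (Hs j).2|exact: (Hs k).2].
Qed.

(** At each fixed t the sum of the steps, step j being restricted to the ball of radius j, has
    integral at most 1 in x, hence is finite for almost every x. The good set [G] has full slices at
    every t of [0, T] and not only at almost every one, which continuity in time will need. *)
Lemma exists_limit (T : R) : exists sigma : nat -> nat, exists u : V * R -> R,
  exists G : set (V * R),
  [/\ forall j, (j <= sigma j)%N, measurable_fun setT u /\ measurable G,
      forall p, `|u p| <= M,
      forall p, G p -> u_ (sigma j) p.2 p.1 @[j --> \oo] --> u p &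
      forall t, 0 <= t <= T -> \forall x \ae leb, G (x, t)].
Proof.
have [sigma [sigmaj Hs]] := exists_subsequence T.
pose b j (p : V * R) : R := `|u_ (sigma j.+1) p.2 p.1 - u_ (sigma j) p.2 p.1| *
  \1_(K j%:R) p.1.
have mb j : measurable_fun setT (b j).
  apply: measurable_funM; first by apply: measurableT_comp => //; exact: measurable_funB.
  apply: (measurable_comp_fun (f := \1_(K j%:R) : V -> R) (g := fst)) => //.
  by apply: measurable_indic; exact: measurable_rV_cball.
have b0 j p : 0 <= b j p by rewrite mulr_ge0.
pose S p := (\sum_(0 <= j <oo) (b j p)%:E)%E.
have mS : measurable_fun setT S.
  apply: (ge0_emeasurable_sum (P := xpredT)) => [k x _ _|k _]; first by rewrite lee_fin.
  exact/measurable_EFinP.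
pose G := [set p | (S p < +oo)%E].
have mG : measurable G.
  rewrite -[G]setTI; apply: measurable_lte => //.
have cvG p : G p -> cvgn (fun j => u_ (sigma j) p.2 p.1).
  move=> Gp; have [j0 Hj0] : exists j0 : nat, `|p.1| <= j0%:R.
    by exists (Num.truncn `|p.1|).+1; apply: ltW; exact: truncnS_gt.
  apply: (@cvg_summable_steps _ _ (fun j => \1_(K j%:R) p.1) j0) => //.
  move=> j jj; rewrite indicE mem_set//=; apply: le_trans Hj0 _.
  by rewrite ler_nat.
(* Multiplying by the indicator of [G] makes the limit exist everywhere, so that [u] is measurable
   and bounded by [M] at every point. *)
pose w j p := u_ (sigma j) p.2 p.1 * \1_G p.
pose u p := limn (fun j => w j p).
have wu p : w j p @[j --> \oo] --> u p.
  have [Gp|nG] := pselect (G p).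
    have -> : (fun j => w j p) = (fun j => u_ (sigma j) p.2 p.1).
      by apply/funext => j; rewrite /w indicE mem_set// mulr1.
    rewrite /u (_ : (fun j => w j p) = (fun j => u_ (sigma j) p.2 p.1)).
      exact: cvG.
    by apply/funext => j; rewrite /w indicE mem_set// mulr1.
  have wE : (fun j => w j p) = cst 0.
    by apply/funext => j; rewrite /w indicE memNset// mulr0.
  by rewrite /u wE lim_cst//; exact: cvg_cst.
exists sigma, u, G; split => //.
- split=> //; apply: (measurable_fun_cvg (h := w)) => [j|p _]; last exact: wu.
  by apply: measurable_funM => //; exact: measurable_indic.
- move=> p; apply: (@closed_cvg _ _ \oo _ (fun j => `|w j p|) [set z | z <= M]).
  + exact: closed_le.
  + apply: nearW => j /=; rewrite /w normrM; apply: le_trans (u_bnd (sigma j) p.2 p.1).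
    by rewrite ler_piMr// indicE; case: (_ \in _); rewrite ?normr1 ?normr0.
  + exact: (cvg_norm (wu p)).
- move=> p Gp; have := wu p; rewrite (_ : w^~ p = (fun j => u_ (sigma j) p.2 p.1))//.
  by apply/funext => j; rewrite /w indicE mem_set// mulr1.
- move=> t tT.
  have mSt : measurable_fun setT (fun x => S (x, t)).
    exact: (measurable_fun_pair1 (f := S)).
  have S0 p : (0 <= S p)%E by apply: nneseries_ge0 => n _ _; rewrite lee_fin.
  have Si : leb.-integrable setT (fun x => S (x, t)).
    apply/integrableP; split => //.
    under eq_integral do rewrite gee0_abs//.
    rewrite /S integral_nneseries//; last 2 first.
    + by move=> j; apply/measurable_EFinP; exact: (measurable_fun_pair1 (f := b j)).
    + by move=> j x _; rewrite lee_fin.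
    apply: (@le_lt_trans _ _ 1%E); last by rewrite ltry.
    apply: le_trans (epsilon_trick0 xpredT (@ler01 R)).
    apply: lee_nneseries => [j _ _|j _]; first by apply: integral_ge0 => x _; rewrite lee_fin.
    apply: le_trans (Hs j j.+1 j t _ _ _) => //.
    rewrite /locdist [leRHS]integral_mkcond le_eqVlt; apply/orP; left; apply/eqP.
    apply: eq_integral => x _; rewrite /b /= patchE indicE.
    by case: ifP => _; rewrite ?mulr1 ?mulr0.
  have := integrable_ae measurableT Si; apply: filterS => x /(_ Logic.I) Sfin.
  by rewrite /G/= -ge0_fin_numE.
Qed.

End extraction.

(** * Levy measures: the weight min(1, |z|^2), truncation and uniform form bounds *)

Section eucl.
Variables (R : realType) (N : nat).
Notation V := 'rV[R]_N.

Lemma eucl_norm_ge0 (z : V) : 0 <= eucl_norm z. Proof. exact: sqrtr_ge0. Qed.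

Lemma eucl_norm_sqr (z : V) : eucl_norm z ^+ 2 = \sum_i z ord0 i ^+ 2.
Proof. by rewrite sqr_sqrtr// sumr_ge0// => i _; exact: sqr_ge0. Qed.

Lemma eucl_normN (z : V) : eucl_norm (- z) = eucl_norm z.
Proof. by congr Num.sqrt; apply: eq_bigr => i _; rewrite mxE sqrrN. Qed.

Lemma coord_le_eucl (z : V) i : `|z ord0 i| <= eucl_norm z.
Proof.
rewrite -sqrtr_sqr ler_wsqrtr// (bigD1 i)//= lerDl sumr_ge0// => j _.
exact: sqr_ge0.
Qed.

Lemma norm_le_eucl (z : V) : `|z| <= eucl_norm z.
Proof. by apply: rV_norm_le => [|i]; [exact: eucl_norm_ge0|exact: coord_le_eucl]. Qed.

Lemma measurable_eucl_norm : measurable_fun setT (@eucl_norm R N).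
Proof.
apply: (measurable_comp_fun (f := @Num.sqrt R) (g := fun z : V => \sum_i z ord0 i ^+ 2)).
  by apply: continuous_measurable_fun; exact: sqrt_continuous.
apply: measurable_sum => i; apply: measurable_funX; exact: measurable_rV_coord.
Qed.

Definition kappa (z : V) : R := Num.min 1 (eucl_norm z ^+ 2).

Lemma kappa_ge0 z : 0 <= kappa z.
Proof. by rewrite /kappa le_min ler01 sqr_ge0. Qed.

Lemma measurable_kappa : measurable_fun setT kappa.
Proof.
apply: measurable_minr; first exact: measurable_cst.
by apply: measurable_funX; exact: measurable_eucl_norm.
Qed.

Definition far (r : R) : set V := [set z | r < eucl_norm z].

Lemma measurable_far r : measurable (far r).
Proof.
have := measurable_eucl_norm measurableT (measurable_itv `]r, +oo[).
by rewrite setTI; congr measurable; apply/seteqP; split => z; rewrite /far/= in_itv/= andbT.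
Qed.

Lemma farN r (z : V) : far r (- z) = far r z.
Proof. by rewrite /far/= eucl_normN. Qed.

(** The increment is at most 2C and at most C |z|, whence [kappa]; it vanishes when both endpoints
    are outside [S], whence the two indicators. *)
Lemma diff_sqr_le (g : V -> R) (C : R) (S : set V) (x z : V) :
  (forall x, `|g x| <= C) ->
  (forall x z, `|g (x + z) - g x| <= C * eucl_norm z) ->
  (forall x, ~ S x -> g x = 0) ->
  (g (x + z) - g x) ^+ 2 <= 4 * C ^+ 2 * (kappa z * (\1_S x + \1_S (x + z))).
Proof.
move=> gC gl gS; have C0 : 0 <= C by exact: le_trans (normr_ge0 _) (gC 0).
have C20 : 0 <= C ^+ 2 by exact: sqr_ge0.
have k0 := kappa_ge0 z.
have ind (y : V) : (\1_S y : R) = 1 \/ (\1_S y : R) = 0 /\ g y = 0.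
  have [Sy|nS] := pselect (S y); first by left; rewrite indicE mem_set.
  by right; split; [rewrite indicE memNset|exact: gS].
have main : (g (x + z) - g x) ^+ 2 <= 4 * C ^+ 2 * kappa z.
  have H1 : (g (x + z) - g x) ^+ 2 <= 4 * C ^+ 2.
    rewrite (_ : 4 * C ^+ 2 = (2 * C) ^+ 2); last by ring.
    rewrite -real_normK ?num_real// ler_sqr ?nnegrE ?mulr_ge0//.
    by apply: le_trans (ler_normB _ _) _; have := gC (x + z); have := gC x; lra.
  have H2 : (g (x + z) - g x) ^+ 2 <= C ^+ 2 * eucl_norm z ^+ 2.
    rewrite -exprMn -real_normK ?num_real// ler_sqr ?nnegrE// mulr_ge0//.
    exact: eucl_norm_ge0.
  have e0 : 0 <= C ^+ 2 * eucl_norm z ^+ 2 by rewrite mulr_ge0// sqr_ge0.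
  by rewrite /kappa /Num.min; case: ifP => _; rewrite ?mulr1//; lra.
have Ck : 0 <= 4 * C ^+ 2 * kappa z by rewrite !mulr_ge0.
have [->|[-> gx]] := ind x; have [->|[-> gxz]] := ind (x + z).
- rewrite mulrA mulrDr mulr1; lra.
- by rewrite addr0 mulr1.
- by rewrite add0r mulr1.
- by rewrite gx gxz subrr expr0n/= addr0 mulr0 mulr0.
Qed.

End eucl.

Lemma integral_mrestr d (X : measurableType d) (R : realType)
    (m : {measure set X -> \bar R}) (D : set X) (mD : measurable D) (f : X -> \bar R) :
  measurable_fun setT f -> (\int[mrestr m mD]_x f x = \int[m]_(x in D) f x)%E.
Proof.
move=> mf.
transitivity (\int[mrestr m mD]_(x in D) f x)%E.
  rewrite [RHS]integral_mkcond; apply: ae_eq_integral => //.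
    by apply/(measurable_restrictT _ mD); exact: measurable_funS mf.
  exists (~` D); split; first exact: measurableC.
    by have := measure0 m; rewrite /mrestr -(setICl D).
  move=> x /= nx Dx; apply: nx => _; by rewrite patchE mem_set.
apply: eq_measure_integral => A mA AD.
by change (m (A `&` D) = m A); rewrite (setIidl AD).
Qed.

Section far_finite.
Variables (R : realType) (N : nat).
Notation V := 'rV[R]_N.
Variable nu : {measure set V -> \bar R}.
Hypothesis nu_levy : (\int[nu]_z (kappa z)%:E < +oo)%E.

(** Markov's inequality: [kappa] is at least min(1, r^2) on this set. *)
Lemma far_finite r : 0 < r -> (nu (far r) < +oo)%E.
Proof.
move=> r0; have mf := @measurable_far R N r.
pose c := Num.min 1 (r ^+ 2).
have c0 : 0 < c by rewrite lt_min ltr01 exprn_gt0.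
have : (c%:E * nu (far r) < +oo)%E.
  apply: le_lt_trans nu_levy.
  have mI : measurable_fun setT (fun z : V => (\1_(far r) z : R)%:E).
    by apply/measurable_EFinP; exact: measurable_indic.
  rewrite -[X in nu X]setIT -integral_indic// -ge0_integralZl// ?lee_fin ?(ltW c0)//.
  apply: ge0_le_integral => //.
  - by move=> z _; rewrite mule_ge0 ?lee_fin ?(ltW c0).
  - exact: measurable_funeM.
  - by apply/measurable_EFinP; exact: measurable_kappa.
  move=> z _; rewrite -EFinM lee_fin indicE.
  have [fz|nf] := pselect (far r z); last by rewrite memNset// mulr0 kappa_ge0.
  rewrite mem_set// mulr1 /kappa /c le_min !ge_min lexx/=.
  apply/orP; right; rewrite ler_sqr ?nnegrE ?eucl_norm_ge0//; first exact: ltW.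
  exact: ltW.
by case: (nu (far r)) => [s||] //=; rewrite ?ltry// mulry gtr0_sg// mul1e.
Qed.

End far_finite.

Section levy.
Variables (R : realType) (N : nat).
Notation V := 'rV[R]_N.
Notation leb := (lebesgue_rV R N).
Variable nu : {sigma_finite_measure set V -> \bar R}.
Hypothesis nu_even : forall A : set V, measurable A ->
  nu ((fun z : V => - z) @^-1` A) = nu A.
Hypothesis nu_levy : (\int[nu]_z (kappa z)%:E < +oo)%E.

Definition kmass : R := \int[nu]_z kappa z.

Lemma Rintegrable_kappa : Rintegrable nu (@kappa R N).
Proof.
by apply: ge0_Rintegrable => //; [exact: measurable_kappa|exact: kappa_ge0].
Qed.

Lemma kmass_ge0 : 0 <= kmass.
Proof. by apply: Rintegral_ge0 => z _; exact: kappa_ge0. Qed.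

(** The majorant of [diff_sqr_le] without its constant, as a function on pairs of a point and a
    jump. *)
Definition levy_dom (S : set V) (p : V * V) : R :=
  kappa p.2 * (\1_S p.1 + \1_S (p.1 + p.2)).

Lemma levy_dom_ge0 S p : 0 <= levy_dom S p.
Proof. by rewrite /levy_dom mulr_ge0 ?kappa_ge0// addr_ge0. Qed.

Lemma measurable_levy_dom S : measurable S -> measurable_fun setT (levy_dom S).
Proof.
move=> mS; apply: measurable_funM.
  by apply: (measurable_comp_fun (@measurable_kappa R N)).
apply: measurable_funD.
  by apply: (measurable_comp_fst (v := \1_S)); exact: measurable_indic.
by apply: (measurable_comp_add (v := \1_S)); exact: measurable_indic.
Qed.

Lemma levy_dom_integral S : measurable S ->
  (\int[leb \x nu]_p (levy_dom S p)%:E = 2%:E * leb S * kmass%:E)%E.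
Proof.
move=> mS; have mI : measurable_fun setT (\1_S : V -> R) by exact: measurable_indic.
have mIE : measurable_fun setT (fun x : V => (\1_S x : R)%:E) by exact/measurable_EFinP.
rewrite fubini_tonelli2; last 2 first.
- by apply/measurable_EFinP; exact: measurable_levy_dom.
- by move=> p; rewrite lee_fin levy_dom_ge0.
rewrite /fubini_G/=.
transitivity (\int[nu]_z ((2%:E * leb S) * (kappa z)%:E))%E.
  apply: eq_integral => z _; rewrite /levy_dom/=.
  under eq_integral do rewrite EFinM EFinD.
  have mIz : measurable_fun setT (fun x : V => (\1_S (x + z)%R : R)%:E).
    by apply/measurable_EFinP; exact: measurable_comp_shift.
  have mIs := emeasurable_funD mIE mIz.
  have s0 (x : V) : setT x -> (0 <= (\1_S x : R)%:E + (\1_S (x + z)%R : R)%:E)%E.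
    by move=> _; rewrite adde_ge0 ?lee_fin.
  rewrite ge0_integralZl// ?lee_fin ?kappa_ge0//.
  rewrite ge0_integralD// integral_indic_shift// integral_indic// setIT muleC.
  by congr (_ * _)%E; rewrite mule_natl mule2n.
rewrite ge0_integralZl//.
- by rewrite EFin_Rintegral//; exact: Rintegrable_kappa.
- by apply/measurable_EFinP; exact: measurable_kappa.
- by move=> z _; rewrite lee_fin kappa_ge0.
- by rewrite mule_ge0// lee_fin.
Qed.

Lemma Rintegrable_levy_dom S : measurable S -> (leb S < +oo)%E ->
  Rintegrable (leb \x nu)%E (levy_dom S).
Proof.
move=> mS Soo; apply: ge0_Rintegrable.
- exact: measurable_levy_dom.
- exact: levy_dom_ge0.
rewrite levy_dom_integral// lte_mul_pinfty ?ltry//; first by rewrite mule_ge0// lee_fin.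
by rewrite fin_numM// ge0_fin_numE.
Qed.

Definition levy_restr (r : R) (r0 : 0 < r) : {finite_measure set V -> \bar R} :=
  mfrestr (@measurable_far R N r) (far_finite nu_levy r0).

Lemma levy_restr_even r (r0 : 0 < r) (A : set V) : measurable A ->
  levy_restr r0 ((fun z : V => - z) @^-1` A) = levy_restr r0 A.
Proof.
move=> mA; have mAf : measurable (A `&` far r).
  exact: (measurableI _ _ mA (@measurable_far R N r)).
change (nu ((fun z : V => - z) @^-1` A `&` far r) = nu (A `&` far r)).
rewrite -(nu_even mAf); congr (nu _).
by apply/seteqP; split => z /= [Az fz]; split => //=; move: fz; rewrite farN.
Qed.

Lemma levy_restr_integral r (r0 : 0 < r) (f : V * V -> \bar R) : measurable_fun setT f ->
  (\int[leb \x levy_restr r0]_p f p = \int[leb \x nu]_(p in setT `*` far r) f p)%E.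
Proof.
move=> mf; have mD : measurable ([set: V] `*` (far r : set V)).
  exact: (measurableX measurableT (@measurable_far R N r)).
rewrite -(integral_mrestr (leb \x nu)%E mD mf).
apply: eq_measure_integral => A mA _.
rewrite /= /product_measure1 /mrestr /=; apply: eq_integral => x _.
rewrite /= /levy_restr /= /mfrestr /mrestr; congr (nu _).
by rewrite xsectionI; congr (_ `&` _); apply/seteqP; split => z; rewrite /xsection/= inE/=; [split|case].
Qed.

Lemma levy_restr_Rintegral r (r0 : 0 < r) (f : V * V -> R) : measurable_fun setT f ->
  \int[(leb \x levy_restr r0)%E]_p f p = \int[(leb \x nu)%E]_p (f p * \1_(far r) p.2).
Proof.
move=> mf; rewrite /Rintegral levy_restr_integral; last exact/measurable_EFinP.
congr fine; rewrite [LHS]integral_mkcond; apply: eq_integral => p _.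
rewrite patchE indicE; case: ifPn => [/set_mem[_ /= fp]|/negP np].
  by rewrite mem_set// mulr1.
by rewrite memNset ?mulr0// => fp; apply: np; rewrite inE.
Qed.

(** The bound is independent of the truncation radius, because the integrand is dominated by a
    multiple of [levy_dom], integrated against the full measure. *)
Lemma jump_form_levy_le r (r0 : 0 < r) (g : V -> R) (C : R) (S : set V) :
  measurable_fun setT g ->
  (forall x, `|g x| <= C) ->
  (forall x z, `|g (x + z) - g x| <= C * eucl_norm z) ->
  measurable S -> (leb S < +oo)%E -> (forall x, ~ S x -> g x = 0) ->
  jump_form (levy_restr r0) g g <= 4 * C ^+ 2 * (2 * fine (leb S) * kmass).
Proof.
move=> mg gC gl mS Soo gS.
have Sfin : leb S \is a fin_num by rewrite ge0_fin_numE.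
have di := Rintegrable_levy_dom mS Soo.
have -> : 2 * fine (leb S) * kmass = \int[(leb \x nu)%E]_p levy_dom S p.
  by rewrite /Rintegral levy_dom_integral// -(fineK Sfin) -!EFinM.
rewrite /jump_form levy_restr_Rintegral; last first.
  by apply: measurable_funM; exact: measurable_jump_diff.
have bnd (p : V * V) : `|(g (p.1 + p.2) - g p.1) * (g (p.1 + p.2) - g p.1) * \1_(far r) p.2| <=
    4 * C ^+ 2 * levy_dom S p.
  rewrite -expr2 normrM ger0_norm ?sqr_ge0//.
  apply: le_trans (diff_sqr_le p.1 p.2 gC gl gS).
  by rewrite ler_piMr ?sqr_ge0// indicE; case: (_ \in _); rewrite ?normr1 ?normr0.
rewrite -RintegralZl//; apply: le_Rintegral => //.
- apply: (Rintegrable_le _ bnd); last exact: RintegrableZ.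
  apply: measurable_funM; first by apply: measurable_funM; exact: measurable_jump_diff.
  apply: (measurable_comp_fun (f := \1_(far r) : V -> R) (g := snd)) => //.
  exact: (measurable_indic (@measurable_far R N r)).
- exact: RintegrableZ.
- by move=> p _; apply: le_trans (ler_norm _) (bnd p).
Qed.

End levy.

(** * The convex primitive of a monotone function *)

Section primitive.
Variable R : realType.
Notation mu := (@lebesgue_measure R).

(** A signed indicator: integrating against it gives the oriented integral from 0 to [x] for either
    sign of [x]. *)
Definition step_kernel (x t : R) : R := \1_(`[0, x[%classic) t - \1_(`[x, 0[%classic) t.

Lemma step_kernel_sub a b t :
  step_kernel b t - step_kernel a t = \1_(`[a, b[%classic) t - \1_(`[b, a[%classic) t.
Proof.
rewrite /step_kernel !indicE !mem_setE !in_itv/=.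
by case: (leP 0 t); case: (leP a t); case: (leP b t) => /= *; lra.
Qed.

Lemma integral_indic_itvco (a b : R) : a <= b ->
  \int[mu]_t \1_(`[a, b[%classic) t = b - a.
Proof.
move=> ab; rewrite /Rintegral integral_indic// setIT /= lebesgue_measure_itv/= lte_fin.
by case: ltP => [//|ba]; rewrite /=; lra.
Qed.

Lemma Rintegrable_itvco (a b : R) : Rintegrable mu (\1_(`[a, b[%classic) : R -> R).
Proof.
apply/integrableP; split; first by apply/measurable_EFinP; exact: measurable_indic.
under eq_integral do rewrite /= ger0_norm//.
rewrite integral_indic// setIT /= lebesgue_measure_itv/=.
by case: ifP => _; rewrite ?ltry// -EFinB ltry.
Qed.

Variable phi : R -> R.
Hypothesis phi_nd : {homo phi : r s / r <= s}.

Lemma Rintegrable_phi_itvco (a b : R) :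
  Rintegrable mu (fun t => phi t * \1_(`[a, b[%classic) t).
Proof.
have mphi : measurable_fun setT phi by exact: nondecreasing_measurable.
apply: (@Rintegrable_le _ _ R mu _ (fun t : R => (`|phi a| + `|phi b|) * \1_(`[a, b[%classic) t)).
- by apply: measurable_funM => //; exact: measurable_indic.
- move=> t; rewrite normrM indicE mem_setE in_itv/=.
  case: (leP a t) => at0 /=; last by rewrite normr0 !mulr0.
  case: (ltP t b) => tb /=; last by rewrite normr0 !mulr0.
  rewrite normr1 !mulr1; have H1 := phi_nd at0; have H2 := phi_nd (ltW tb).
  have := ler_norm (phi b); have := ler_norm (- phi a); rewrite normrN.
  by have := normr_ge0 (phi a); have := normr_ge0 (phi b); rewrite ler_norml => *;
    apply/andP; split; lra.
- by apply: RintegrableZ; exact: Rintegrable_itvco.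
Qed.

Definition primitive (x : R) : R := \int[mu]_t (phi t * step_kernel x t).

Lemma Rintegrable_primitive x : Rintegrable mu (fun t => phi t * step_kernel x t).
Proof.
rewrite (_ : (fun t => _) = fun t => phi t * \1_(`[0, x[%classic) t - phi t * \1_(`[x, 0[%classic) t).
  by apply: RintegrableB; exact: Rintegrable_phi_itvco.
by apply/funext => t; rewrite -mulrBr.
Qed.

Lemma primitive0 : primitive 0 = 0.
Proof.
rewrite /primitive; under eq_Rintegral do rewrite /step_kernel subrr mulr0.
by rewrite /Rintegral integral0.
Qed.

(** Between a and b, phi is at most phi(b) if a <= b and at least phi(b) if b <= a; the sign of the
    kernel makes one inequality of the two cases. *)
Lemma primitive_sub a b : primitive b - primitive a <= phi b * (b - a).
Proof.
rewrite /primitive -RintegralB//; [|exact: Rintegrable_primitive..].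
have ki : Rintegrable mu (fun t => \1_(`[a, b[%classic) t - \1_(`[b, a[%classic) t).
  by apply: RintegrableB; exact: Rintegrable_itvco.
apply: (@le_trans _ _ (\int[mu]_t (phi b * (\1_(`[a, b[%classic) t - \1_(`[b, a[%classic) t)))).
  apply: le_Rintegral => //.
  - by apply: RintegrableB; exact: Rintegrable_primitive.
  - exact: RintegrableZ.
  move=> t _; rewrite -mulrBr step_kernel_sub !indicE !mem_setE !in_itv/=.
  case: (leP a t) => at0; case: (leP b t) => bt;
    rewrite /= ?subrr ?mulr0 ?subr0 ?sub0r ?mulr1 ?mulrN1 ?lerN2//; apply: phi_nd => //; exact: ltW.
rewrite RintegralZl// RintegralB//; [|exact: Rintegrable_itvco..].
have [ab|/ltW ba] := leP a b.
  rewrite integral_indic_itvco// (_ : `[b, a[%classic = set0); last first.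
    by apply/seteqP; split => t //=; rewrite in_itv/= => /andP[? ?]; lra.
  by under [in X in _ - X]eq_Rintegral do rewrite indic0; rewrite /Rintegral integral0 subr0.
rewrite [in X in _ - X]integral_indic_itvco// (_ : `[a, b[%classic = set0); last first.
  by apply/seteqP; split => t //=; rewrite in_itv/= => /andP[? ?]; lra.
under [in X in X - _]eq_Rintegral do rewrite indic0.
by rewrite {1}/Rintegral integral0 sub0r opprB.
Qed.

(** Two applications of [primitive_sub] show that the primitive is locally Lipschitz, hence
    continuous. *)
Lemma measurable_primitive : measurable_fun setT primitive.
Proof.
apply: continuous_measurable_fun => a.
pose B := `|phi (a - 1)| + `|phi (a + 1)|.
have B0 : 0 < B + 1 by rewrite ltr_wpDl// addr_ge0.
have bnd b : `|b - a| <= 1 -> `|phi b| <= B + 1.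
  rewrite ler_norml => /andP[H1 H2].
  have h1 : phi (a - 1) <= phi b by apply: phi_nd; lra.
  have h2 : phi b <= phi (a + 1) by apply: phi_nd; lra.
  have := ler_norm (phi (a + 1)); have := ler_norm (- phi (a - 1)); rewrite normrN.
  have := normr_ge0 (phi (a - 1)); have := normr_ge0 (phi (a + 1)).
  by rewrite ler_norml /B => *; apply/andP; split; lra.
have lip b : `|b - a| <= 1 -> `|primitive a - primitive b| <= (B + 1) * `|a - b|.
  move=> ba; have := primitive_sub a b; have := primitive_sub b a.
  have bb := bnd b ba; have aa := bnd a; rewrite subrr normr0 in aa.
  have {}aa := aa ler01.
  have h (s c : R) : `|s| <= B + 1 -> s * c <= (B + 1) * `|c|.
    by move=> sB; apply: le_trans (ler_norm _) _; rewrite normrM ler_wpM2r.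
  have := h (phi a) (a - b) aa; have := h (phi b) (b - a) bb.
  by rewrite (distrC b a) ler_norml => *; apply/andP; split; lra.
apply/cvgrPdist_le => e e0.
have ball_near (r : R) : 0 < r -> \forall b \near a, `|a - b| <= r.
  by move=> r0; exact: (@cvgr_dist_le R R^o R (nbhs a) _ id a (@cvg_id R (nbhs a)) r r0).
have eB : 0 < e / (B + 1) by rewrite divr_gt0.
apply: (@filterS R (nbhs a) _ _ _ _ (filterI (ball_near _ ltr01) (ball_near _ eB))) => b [b1 be].
rewrite distrC in b1; apply: le_trans (lip b b1) _.
by rewrite mulrC -ler_pdivlMr.
Qed.

End primitive.

(** * Monotone Lipschitz approximation of a continuous monotone function *)

Section lipschitz_approximation.
Variable R : realType.
Variables (phi : R -> R) (M : R).
Hypothesis phi_cont : continuous phi.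
Hypothesis phi_nd : {homo phi : r s / r <= s}.
Hypothesis M0 : 0 <= M.

Definition clamp (s : R) : R := Num.max (- M) (Num.min M s).

Lemma clamp_id s : `|s| <= M -> clamp s = s.
Proof.
rewrite ler_norml => /andP[sM Ms].
by rewrite /clamp (min_idPr Ms) (max_idPr sM).
Qed.

Lemma clamp_bounded s : `|clamp s| <= M.
Proof.
rewrite ler_norml /clamp le_max lexx/= ge_max ge_min lexx/= andbT; move: M0; lra.
Qed.

Lemma clamp_nd : {homo clamp : r s / r <= s}.
Proof.
move=> r s rs; rewrite /clamp ge_max le_max lexx/= le_max; apply/orP; right.
by rewrite le_min !ge_min lexx/= rs orbT.
Qed.

Lemma clamp_dist s t : `|clamp s - clamp t| <= `|s - t|.
Proof.
wlog ts : s t / t <= s => [H|].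
  by have [/H//|/ltW /H] := leP t s; rewrite distrC (distrC t).
rewrite !ger0_norm ?subr_ge0 ?clamp_nd//.
have h1 : Num.min M s - Num.min M t <= s - t.
  by rewrite /Num.min; case: (ltP M s) => ?; case: (ltP M t) => ?; lra.
have h2 : Num.min M t <= Num.min M s.
  by rewrite /Num.min; case: (ltP M s) => ?; case: (ltP M t) => ?; lra.
rewrite /clamp; move: h1 h2; set a := Num.min M s; set b := Num.min M t => h1 h2.
by rewrite /Num.max; case: (ltP (- M) a) => ?; case: (ltP (- M) b) => ?; lra.
Qed.

(** Below the distance [d] given by uniform continuity the increment is at most [e]; from [d] on,
    the trivial bound 2B is at most (2B / d) |s - t|. *)
Lemma phi_modulus (e : R) : 0 < e -> exists2 L, 0 <= L &
  forall s t, `|s| <= M -> `|t| <= M -> `|phi s - phi t| <= e + L * `|s - t|.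
Proof.
move=> e0; have e20 : 0 < e / 2 by rewrite divr_gt0.
pose F := fun d : R => forall s t, `|s| <= M -> `|s - t| < d -> `|phi s - phi t| <= e.
have [d d0 Fd] : exists2 d : R, 0 < d & F d.
  have /compact_near_coveringP cov := @segment_compact R (- M) M.
  have := cov R (0 : R)^'+ (fun d s => forall t, `|s - t| < d -> `|phi s - phi t| <= e) _.
  move=> H; have {H} : \forall d \near (0 : R)^'+, `[- M, M]%classic `<=`
      (fun s => forall t, `|s - t| < d -> `|phi s - phi t| <= e).
    apply: H => s _.
    have /cvgrPdist_le := @phi_cont s => /(_ _ e20) /nbhs_ballP[r /= r0 Hr].
    have r20 : 0 < r / 2 by rewrite divr_gt0.
    exists (ball s (r / 2), [set d | d < r / 2]).
      by split => /=; [exact: nbhsx_ballx|exact: nbhs_right_lt].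
    move=> [s' d] /= [ss' dr] t st.
    rewrite -ball_normE /= in ss'.
    have H1 := Hr s' _; have H2 := Hr t _.
    apply: le_trans (ler_distD (phi s) _ _) _; rewrite [e]splitr lerD//.
      by rewrite distrC; apply: H1; rewrite -ball_normE /=; lra.
    apply: H2; rewrite -ball_normE /=.
    by apply: le_lt_trans (ler_distD s' _ _) _; lra.
  move=> H; have [d [d0 Hd]] := @filter_ex _ ((0 : R)^'+) _ _ (filterI (nbhs_right_gt 0) H).
  exists d => // s t sM st; apply: Hd => //=.
  by rewrite in_itv/= -ler_norml.
pose B := phi_sup phi M.
have phiB s : `|s| <= M -> `|phi s| <= B by exact: phi_bounded.
have B0 : 0 <= B by apply: le_trans (phiB 0 _); rewrite ?normr0.
exists (2 * B / d); first by rewrite !mulr_ge0// invr_ge0 ltW.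
move=> s t sM tM; have [st|st] := ltP `|s - t| d.
  apply: le_trans (Fd _ _ sM st) _; rewrite lerDl !mulr_ge0// invr_ge0 ltW//.
apply: (@le_trans _ _ (2 * B)).
  by apply: le_trans (ler_normB _ _) _; have := phiB s sM; have := phiB t tM; lra.
rewrite -mulrA; apply: (@le_trans _ _ (2 * B * (d^-1 * `|s - t|))); last first.
  by rewrite -mulrA lerDr ltW.
by rewrite ler_peMr ?mulr_ge0// mulrC ler_pdivlMr// mul1r.
Qed.

(** Lipschitz regularisation by infimal convolution with L |.|; the clamp makes [phi] bounded, so
    the infimum is finite. *)
Definition inf_conv (L s : R) : R := inf [set phi (clamp t) + L * `|s - t| | t in setT].

Lemma inf_conv_has_inf L s : 0 <= L ->
  has_inf [set phi (clamp t) + L * `|s - t| | t in setT].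
Proof.
move=> L0; split; first by exists (phi (clamp 0) + L * `|s - 0|); exists 0.
exists (- phi_sup phi M) => _ [t _ <-].
have := phi_bounded phi_nd (clamp_bounded t); rewrite ler_norml => /andP[H _].
by have := mulr_ge0 L0 (normr_ge0 (s - t)); lra.
Qed.

Lemma inf_conv_le L s t : 0 <= L -> inf_conv L s <= phi (clamp t) + L * `|s - t|.
Proof.
move=> L0; apply: ge_inf; last by exists t.
exact: (inf_conv_has_inf s L0).2.
Qed.

Lemma le_inf_conv L s b : 0 <= L -> (forall t, b <= phi (clamp t) + L * `|s - t|) ->
  b <= inf_conv L s.
Proof.
move=> L0 H; apply: lb_le_inf; first exact: (inf_conv_has_inf s L0).1.
by move=> _ [t _ <-].
Qed.

Lemma inf_conv_nd L : 0 <= L -> {homo inf_conv L : r s / r <= s}.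
Proof.
move=> L0 r s rs; apply: le_inf_conv => // t.
apply: le_trans (inf_conv_le r (t - (s - r)) L0) _; apply: lerD.
  by apply/phi_nd/clamp_nd; lra.
by rewrite (_ : r - (t - (s - r)) = s - t)//; ring.
Qed.

Lemma inf_conv_lip L s t : 0 <= L -> `|inf_conv L s - inf_conv L t| <= L * `|s - t|.
Proof.
move=> L0; have H a b : inf_conv L a <= inf_conv L b + L * `|a - b|.
  rewrite -lerBlDr; apply: le_inf_conv => // c.
  rewrite lerBlDr; apply: le_trans (inf_conv_le a c L0) _.
  by rewrite -addrA lerD2l -mulrDr ler_wpM2l//; have := ler_distD b a c; lra.
have := H s t; have := H t s; rewrite (distrC t s) ler_norml => *.
by apply/andP; split; lra.
Qed.

Lemma lipschitz_approximation (e : R) : phi 0 = 0 -> 0 < e -> exists psi : R -> R, exists L : R,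
  [/\ {homo psi : r s / r <= s}, psi 0 = 0,
      forall s t, `|psi s - psi t| <= L * `|s - t| &
      forall s, `|s| <= M -> `|psi s - phi s| <= e].
Proof.
move=> phi0 e0; have e20 : 0 < e / 2 by rewrite divr_gt0.
have [L L0 HL] := phi_modulus e20.
have approx s : `|s| <= M -> phi s - e / 2 <= inf_conv L s <= phi s.
  move=> sM; apply/andP; split; last first.
    by have := inf_conv_le s s L0; rewrite clamp_id// subrr normr0 mulr0 addr0.
  apply: le_inf_conv => // t.
  have := HL s (clamp t) sM (clamp_bounded t).
  have := ler_wpM2l L0 (clamp_dist s t); rewrite (clamp_id sM).
  have := ler_norm (phi s - phi (clamp t)); lra.
(* Subtracting the value at 0, which lies in [-e/2, 0], restores [psi 0 = 0] within the allowed
   error. *)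
exists (fun s => inf_conv L s - inf_conv L 0), L; split.
- by move=> r s rs; rewrite lerD2r inf_conv_nd.
- by rewrite subrr.
- by move=> s t; rewrite opprB addrA subrK inf_conv_lip.
- move=> s sM; have /andP[H1 H2] := approx s sM.
  have z0 : `|0 : R| <= M by rewrite normr0.
  have /andP[H3 H4] := approx 0 z0.
  by rewrite ler_norml; apply/andP; split; rewrite phi0 in H3 H4; lra.
Qed.

End lipschitz_approximation.

(** * Time grids and piecewise constant interpolation *)

Section time_grid.
Variable R : realType.

(** Index of the time cell containing [t] when [delta > 0]; negative times get index 0. *)
Definition grid (delta t : R) : nat := Num.truncn (t / delta).

Lemma truncn_sub (a b : R) : (Num.truncn b <= Num.truncn a)%N ->
  (Num.truncn a - Num.truncn b)%:R <= `|a - b| + 1.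
Proof.
move=> ba; rewrite natrB//.
have H := ler_norm (a - b); have := truncnS_gt b; rewrite -natr1 => Hb.
have [a0|a0] := leP 0 a; first by have := truncn_le a; rewrite a0 => Ha; lra.
have -> : Num.truncn a = 0%N by apply/truncn0Pn; rewrite -ltNge; lra.
have := ler0n R (Num.truncn b); have := normr_ge0 (a - b); lra.
Qed.

Lemma grid_sub (delta t s : R) : 0 < delta -> (grid delta s <= grid delta t)%N ->
  (grid delta t - grid delta s)%:R * delta <= `|t - s| + delta.
Proof.
move=> d0 st; have := truncn_sub st.
rewrite -mulrBl normrM (ger0_norm (ltW _ : 0 <= delta^-1)) ?invr_gt0// => H.
apply: le_trans (ler_wpM2r (ltW d0) H) _.
by rewrite mulrDl mul1r -mulrA mulVf ?gt_eqF// mulr1.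
Qed.

Lemma measurable_grid (delta : R) k : 0 < delta -> measurable [set t | grid delta t = k].
Proof.
move=> d0; have mf : measurable_fun setT (fun t : R => (grid delta t)%:R : R).
  apply: nondecreasing_measurable => // s t st; rewrite ler_nat; apply: le_truncn.
  by rewrite ler_pM2r// invr_gt0.
have := mf measurableT [set k%:R] (measurable_set1 _).
rewrite setTI; congr measurable; apply/seteqP; split => t /=; last by move=> ->.
by move/eqP; rewrite eqr_nat => /eqP.
Qed.

Lemma measurable_fun_grid d (X : measurableType d) (delta : R) (f : nat -> X -> R) :
  0 < delta -> (forall k, measurable_fun setT (f k)) ->
  measurable_fun setT (fun p : X * R => f (grid delta p.2) p.1).
Proof.
move=> d0 mf _ Y mY; rewrite setTI.
rewrite (_ : _ @^-1` _ = \bigcup_k ((f k @^-1` Y) `*` [set t | grid delta t = k])).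
  apply: bigcupT_measurable => k; apply: measurableX; last exact: measurable_grid.
  by rewrite -[X in measurable X]setTI; exact: mf.
apply/seteqP; split => [[x t] /= Yf|[x t] [k _ [/= Yf gk]]].
  by exists (grid delta t).
by rewrite /= gk.
Qed.

End time_grid.

(** * Sigma-finite products and limits of products bounded in L2 *)

Section product_sigma_finite.
Context d1 d2 (X : measurableType d1) (Y : measurableType d2) (R : realType).
Variables (m1 : {sigma_finite_measure set X -> \bar R})
  (m2 : {sigma_finite_measure set Y -> \bar R}).

Let prod_sigma_finite : sigma_finite setT (m1 \x m2)%E.
Proof.
have /sigma_finiteP[F [TF ndF Foo]] := sigma_finiteT m1.
have /sigma_finiteP[G [TG ndG Goo]] := sigma_finiteT m2.
exists (fun k => F k `*` G k).
  rewrite -setXTT TF TG predeqE => -[x y]; split.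
    move=> [/= [i _ Fix] [k _ Gky]]; exists (maxn i k) => //; split.
    - by move: x Fix; exact/subsetPset/ndF/leq_maxl.
    - by move: y Gky; exact/subsetPset/ndG/leq_maxr.
  by move=> [k _ []/= ? ?]; split; exists k.
move=> k; have [? ?] := Foo k; have [? ?] := Goo k.
split; first exact: measurableX.
by rewrite product_measure1E// lte_mul_pinfty// ge0_fin_numE.
Qed.

(* The canonical instances of [product_measure1] only cover finite factors. *)
Definition prod_measure : set (X * Y) -> \bar R := (m1 \x m2)%E.

HB.instance Definition _ := Measure.on prod_measure.

HB.instance Definition _ := Measure_isSigmaFinite.Build _ _ _
  prod_measure prod_sigma_finite.

End product_sigma_finite.

Section weak_limit.
Context d (X : measurableType d) (R : realType).
Variable P : {measure set X -> \bar R}.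

Lemma young_mul (a b eta : R) : 0 < eta -> `|a * b| <= eta * a ^+ 2 + (4 * eta)^-1 * b ^+ 2.
Proof.
move=> eta0; rewrite normrM -(real_normK (num_real a)) -(real_normK (num_real b)).
rewrite -subr_ge0 (_ : _ - _ = (2 * eta * `|a| - `|b|) ^+ 2 / (4 * eta)).
  by rewrite divr_ge0 ?sqr_ge0// mulr_ge0// ltW.
by field; rewrite gt_eqF.
Qed.

(* The pointwise Young inequality dominates the part of [F_n G_n - F G] that is
   not absorbed by [eta (F_n^2 + F^2)], so that dominated convergence applies to
   it although [F_n] is only bounded in L2. *)
Lemma weak_limit (F_ G_ : nat -> X -> R) (F G H : X -> R) (C : R) :
  (forall n, measurable_fun setT (F_ n)) -> measurable_fun setT F ->
  (forall n, measurable_fun setT (G_ n)) -> measurable_fun setT G ->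
  {ae P, forall x, F_ n x @[n --> \oo] --> F x} ->
  {ae P, forall x, G_ n x @[n --> \oo] --> G x} ->
  (forall n, (\int[P]_x (F_ n x ^+ 2)%:E <= C%:E)%E) ->
  (forall n x, G_ n x ^+ 2 <= H x) -> (forall x, G x ^+ 2 <= H x) ->
  Rintegrable P H ->
  [/\ (\int[P]_x (F x ^+ 2)%:E <= C%:E)%E,
      Rintegrable P (fun x => F x * G x),
      forall n, Rintegrable P (fun x => F_ n x * G_ n x) &
      \int[P]_x (F_ n x * G_ n x) @[n --> \oo] --> \int[P]_x (F x * G x)].
Proof.
move=> mF_ mF mG_ mG cF cG FC GH_ GH Hi.
have mH := integrable_measurable Hi.
have F2C : (\int[P]_x (F x ^+ 2)%:E <= C%:E)%E.
  apply: (@fatou_ae_le _ _ R P setT (fun n x => F_ n x ^+ 2)) => //.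
  - by move=> n; exact: measurable_funX.
  - exact: measurable_funX.
  - by move=> n x _; exact: sqr_ge0.
  - by move=> x _; exact: sqr_ge0.
  - apply: filterS cF => x cFx _; rewrite expr2.
    by under eq_fun do rewrite expr2; exact: cvgM.
  - exact: nearW.
have F2i : Rintegrable P (fun x => F x ^+ 2).
  apply: ge0_Rintegrable => [|x|]; [exact: measurable_funX|exact: sqr_ge0|].
  by apply: le_lt_trans F2C _; rewrite ltry.
have F2_i n : Rintegrable P (fun x => F_ n x ^+ 2).
  apply: ge0_Rintegrable => [|x|]; [exact: measurable_funX|exact: sqr_ge0|].
  by apply: le_lt_trans (FC n) _; rewrite ltry.
have prod_int (f g : X -> R) : measurable_fun setT f -> measurable_fun setT g ->
    Rintegrable P (fun x => f x ^+ 2) -> (forall x, g x ^+ 2 <= H x) ->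
    Rintegrable P (fun x => f x * g x).
  move=> mf mg f2 gH; apply: (Rintegrable_le (g := fun x => f x ^+ 2 + 4^-1 * H x)).
  - exact: measurable_funM.
  - move=> x; apply: le_trans (young_mul (f x) (g x) ltr01) _.
    by rewrite mul1r mulr1 lerD2l ler_wpM2l// invr_ge0.
  - by apply: RintegrableD => //; exact: RintegrableZ.
have FGi := prod_int F G mF mG F2i GH.
have FG_i n := prod_int (F_ n) (G_ n) (mF_ n) (mG_ n) (F2_i n) (GH_ n).
split => //.
have C0 : 0 <= C.
  by rewrite -lee_fin; apply: le_trans F2C; apply: integral_ge0 => x _; rewrite lee_fin sqr_ge0.
have F2R : \int[P]_x (F x ^+ 2) <= C by rewrite -lee_fin -EFin_Rintegral.
have F2_R n : \int[P]_x (F_ n x ^+ 2) <= C by rewrite -lee_fin -EFin_Rintegral.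
apply/cvgrPdist_le => e e0.
(* The quadratic terms contribute at most eta * (C + C) <= e / 2; the excess [h] takes the other
   half. *)
pose eta := e / (4 * (C + 1)).
have eta0 : 0 < eta by rewrite divr_gt0// mulr_gt0//; lra.
pose h n x : R := Num.max 0 (`|F_ n x * G_ n x - F x * G x| - eta * (F_ n x ^+ 2 + F x ^+ 2)).
have mh n : measurable_fun setT (h n).
  apply: measurable_maxr; first exact: measurable_cst.
  apply: measurable_funB.
    by apply: measurableT_comp => //; apply: measurable_funB; exact: measurable_funM.
  apply: measurable_funM; first exact: measurable_cst.
  by apply: measurable_funD; exact: measurable_funX.
have h0 n x : 0 <= h n x by rewrite /h le_max lexx.
(* Young's inequality with this same [eta] cancels the squares of F_n and F, leaving only those of
   G_n and G, which [H] dominates. *)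
have hdom n x : `|h n x| <= (2 * eta)^-1 * H x.
  have H0 : 0 <= H x by apply: le_trans (GH x); exact: sqr_ge0.
  have i0 : 0 <= (2 * eta)^-1 by rewrite invr_ge0 mulr_ge0 ?(ltW eta0).
  rewrite ger0_norm// /h ge_max mulr_ge0//=.
  have H1 := young_mul (F_ n x) (G_ n x) eta0; have H2 := young_mul (F x) (G x) eta0.
  have e4 : 0 <= (4 * eta)^-1 by rewrite invr_ge0 mulr_ge0 ?(ltW eta0).
  have H3 := ler_wpM2l e4 (GH_ n x); have H4 := ler_wpM2l e4 (GH x).
  have H5 := ler_normB (F_ n x * G_ n x) (F x * G x).
  have -> : (2 * eta)^-1 = (4 * eta)^-1 + (4 * eta)^-1 by field; rewrite gt_eqF.
  by rewrite mulrDl; lra.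
have ch : (\int[P]_x (h n x)%:E)%E @[n --> \oo] --> 0%E.
  have [||||| _ _] := @dominated_convergence _ _ _ P setT measurableT
    (fun n x => (h n x)%:E) (cst 0%E) (fun x => ((2 * eta)^-1 * H x)%:E).
  - by move=> n; exact/measurable_EFinP.
  - exact: measurable_cst.
  - apply: filterS2 cF cG => x cFx cGx _.
    apply: cvg_EFin; first exact: nearW.
    have cFG : (F_ n x * G_ n x) @[n --> \oo] --> F x * G x by exact: cvgM.
    have c0 : `|F_ n x * G_ n x - F x * G x| @[n --> \oo] --> (0 : R).
      rewrite -(normr0 R) -(subrr (F x * G x)).
      by apply: cvg_norm; apply: cvgB => //; exact: cvg_cst.
    apply: (squeeze_cvgr _ (cvg_cst 0) c0); apply: nearW => n.
    rewrite /h le_max lexx/= ge_max normr_ge0/= gerBl mulr_ge0 ?(ltW eta0)//.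
    by rewrite addr_ge0 ?sqr_ge0.
  - exact: RintegrableZ.
  - by apply: nearW => x n _; rewrite /= lee_fin; exact: hdom.
  by rewrite integral0.
have hi n : Rintegrable P (h n).
  by apply: (Rintegrable_le (mh n) (hdom n)); exact: RintegrableZ.
have e20 : 0 < e / 2 by rewrite divr_gt0.
have ih0 n : (0 <= \int[P]_x (h n x)%:E)%E by apply: integral_ge0 => x _; rewrite lee_fin.
have [n0 _ Hn] := (ge0_cvge0P ih0).1 ch _ e20.
exists n0 => // n /= nn.
have {}Hn : \int[P]_x h n x <= e / 2 by rewrite -lee_fin -EFin_Rintegral//; exact: Hn.
rewrite distrC -RintegralB//; apply: le_trans (le_normr_Rintegral _ _) _ => //.
  exact: RintegrableB.
apply: (@le_trans _ _ (\int[P]_x (h n x + eta * (F_ n x ^+ 2 + F x ^+ 2)))).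
  apply: le_Rintegral => //.
  - by apply: Rintegrable_norm; exact: RintegrableB.
  - by apply: RintegrableD => //; apply: RintegrableZ; exact: RintegrableD.
  - by move=> x _; rewrite -lerBlDr /h le_max lexx orbT.
have sI : Rintegrable P (fun x => F_ n x ^+ 2 + F x ^+ 2) by exact: RintegrableD.
rewrite RintegralD//; last exact: RintegrableZ.
rewrite RintegralZl// RintegralD//.
have H1 := ler_wpM2l (ltW eta0) (lerD (F2_R n) F2R).
have H2 : eta * (C + C) <= e / 2.
  rewrite /eta mulrAC ler_pdivrMr; last by rewrite mulr_gt0//; lra.
  by have := mulr_ge0 (ltW e0) C0; rewrite (_ : e / 2 * _ = e * 2 * (C + 1)); [lra|field].
lra.
Qed.

End weak_limit.

(** * Lebesgue measure on the time interval and products with it *)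

Section time_measure.
Variable R : realType.
Notation mu := (@lebesgue_measure R).

Lemma lebesgue_itvoo_lty (T : R) : (mu `]0%R, T[%classic < +oo)%E.
Proof. by rewrite lebesgue_measure_itv/=; case: ifP => _; rewrite ?ltry// -EFinB ltry. Qed.

Definition time_measure (T : R) : {finite_measure set (measurableTypeR R) -> \bar R} :=
  @mfrestr _ (measurableTypeR R) R `]0%R, T[%classic mu
    (measurable_itv `]0%R, T[) (lebesgue_itvoo_lty T).

Lemma time_measure_integral (T : R) (f : R -> \bar R) : measurable_fun setT f ->
  (\int[time_measure T]_t f t = \int[mu]_(t in `]0%R, T[) f t)%E.
Proof. exact: (integral_mrestr mu (measurable_itv `]0%R, T[)). Qed.

Lemma measurable_fun_grid1 (delta : R) (a : nat -> R) : 0 < delta ->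
  measurable_fun setT (fun t : R => a (grid delta t)).
Proof.
move=> d0; have := @measurable_fun_grid R _ R delta (fun k (_ : R) => a k) d0 _.
move=> /(_ (fun k => measurable_cst _)) H.
exact: (measurable_fun_pair2 (f := fun p : R * R => a (grid delta p.2)) 0 H).
Qed.

Lemma grid_indic (delta : R) (K : nat) (a : nat -> R) (t : R) : 0 < delta ->
  ((fun t : R => a (grid delta t)) \_ `[0%R, K%:R * delta[) t =
  \sum_(k < K) a k * \1_(`[k%:R * delta, k.+1%:R * delta[%classic) t.
Proof.
move=> d0; have E (k : nat) : 0 <= t -> (t \in (`[k%:R * delta, k.+1%:R * delta[)) = (grid delta t == k).
  move=> t0; rewrite in_itv/= /grid truncn_eq ?divr_ge0 ?(ltW d0)//.
  by rewrite ler_pdivlMr// ltr_pdivrMr.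
rewrite patchE mem_setE in_itv/=; case: (leP 0 t) => t0 /=; last first.
  rewrite big1// => k _; rewrite indicE mem_setE in_itv/= (_ : (_ <= t) = false) ?mulr0//.
  by apply/negbTE; rewrite -ltNge; apply: lt_le_trans t0 _; rewrite mulr_ge0// ltW.
have td : (t < K%:R * delta) = (grid delta t < K)%N.
  by rewrite /grid truncn_lt_nat ?divr_ge0 ?(ltW d0)// ltr_pdivrMr.
rewrite td; case: ifPn => gK.
  rewrite (bigD1 (Ordinal gK))//= indicE mem_setE E// eqxx mulr1 big1 ?addr0// => k.
  rewrite -val_eqE/= => kg; rewrite indicE mem_setE E// eq_sym (negbTE kg) mulr0//.
rewrite big1// => k _; rewrite indicE mem_setE E//.
case: eqP => [gk|_]; last by rewrite mulr0.
by move: gK; rewrite gk ltn_ord.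
Qed.

(** As T is a whole number of cells, the integral of the interpolation is exactly a Riemann sum. *)
Lemma step_time_integral (T delta : R) (K : nat) (a : nat -> R) : 0 < delta ->
  T = K%:R * delta ->
  Rintegrable (time_measure T) (fun t => a (grid delta t)) /\
  \int[time_measure T]_t a (grid delta t) = \sum_(k < K) delta * a k.
Proof.
move=> d0 TE; have ma := measurable_fun_grid1 a d0.
have main (b : nat -> R) : (\int[time_measure T]_t (b (grid delta t))%:E)%E =
    (\sum_(k < K) delta * b k)%:E.
  have mb := measurable_fun_grid1 b d0.
  rewrite time_measure_integral; last exact/measurable_EFinP.
  (* Adding the null set {0} lets the interval be cut into the half-open cells of the grid. *)
  rewrite integral_itv_obnd_cbnd; last first.
    apply: (@measurable_funS _ _ _ _ setT) => //; exact/measurable_EFinP.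
  rewrite integral_mkcond.
  transitivity (\int[mu]_t (\sum_(k < K) b k * \1_(`[k%:R * delta, k.+1%:R * delta[%classic) t)%:E)%E.
    apply: eq_integral => t _; rewrite -(grid_indic K b t d0) TE.
    by rewrite !patchE; case: ifP.
  have Ii (k : nat) : Rintegrable mu (fun t => b k * \1_(`[k%:R * delta, k.+1%:R * delta[%classic) t).
    exact: (RintegrableZ (b k) (@Rintegrable_itvco R (k%:R * delta) (k.+1%:R * delta))).
  have Is : Rintegrable mu (fun t : R => \sum_(k < K) b k * \1_(`[k%:R * delta, k.+1%:R * delta[%classic) t).
    exact: (@Rintegrable_sum _ _ _ mu K (fun (k : nat) (t : R) => b k * \1_(`[k%:R * delta, k.+1%:R * delta[%classic) t)).
  rewrite EFin_Rintegral//.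
  rewrite (@Rintegral_sum _ _ _ mu K (fun (k : nat) (t : R) => b k * \1_(`[k%:R * delta, k.+1%:R * delta[%classic) t))//; congr EFin; apply: eq_bigr => k _.
  rewrite RintegralZl//; last exact: Rintegrable_itvco.
  rewrite /Rintegral integral_indic// setIT /= lebesgue_measure_itv/= lte_fin.
  rewrite ltr_pM2r// ltr_nat ltnS leqnn /= -natr1; ring.
split; last by rewrite /Rintegral main.
apply: Rintegrable_ltyP => //.
by rewrite (main (fun k => `|a k|)) ltry.
Qed.

End time_measure.

Section triple_product.
Variables (R : realType) (N : nat).
Notation V := 'rV[R]_N.
Notation leb := (lebesgue_rV R N).
Variable nu : {sigma_finite_measure set V -> \bar R}.
Variable T : R.


Lemma triple_tonelli (f : measurableTypeR R * (V * V) -> R) : measurable_fun setT f -> (forall p, 0 <= f p) ->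
  (\int[time_measure T \x prod_measure leb nu]_p (f p)%:E =
   \int[time_measure T]_t \int[prod_measure leb nu]_q (f (t, q))%:E)%E.
Proof.
move=> mf f0; apply: (@fubini_tonelli1 _ _ _ _ R (time_measure T) (prod_measure leb nu) (fun p => (f p)%:E)).
  exact/measurable_EFinP.
by move=> p; rewrite lee_fin.
Qed.

(** Tonelli with x innermost: for fixed t and z a condition at x + z is a translate of a condition
    at x, so exceptional sets that are Lebesgue-null in x suffice. *)
Lemma triple_null (A : set (measurableTypeR R * (V * V))) : measurable A ->
  (forall t, 0 < t < T -> forall z, leb [set x | A (t, (x, z))] = 0%E) -> (time_measure T \x prod_measure leb nu)%E A = 0%E.
Proof.
move=> mA HA.
have mI : measurable_fun setT (\1_A : measurableTypeR R * (V * V) -> R) by exact: measurable_indic.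
rewrite -(setIT A) -integral_indic// triple_tonelli//.
rewrite time_measure_integral; last first.
  apply: (measurable_integral2 (prod_measure leb nu) (f := fun p : measurableTypeR R * (V * V) => (\1_A p)%:E)).
  exact/measurable_EFinP.
apply: integral0_eq => t /=; rewrite in_itv/= => tT.
rewrite (fubini_tonelli2 (fun q : V * V => (\1_A (t, q))%:E))//; last first.
  apply/measurable_EFinP; exact: (measurable_fun_pair2 (f := \1_A : measurableTypeR R * (V * V) -> R)).
apply: integral0_eq => z _; rewrite /fubini_G -(HA t tT z).
have mz : measurable [set x | A (t, (x, z))].
  rewrite (_ : [set _ | _] = ysection (xsection A t) z).
    apply: measurable_ysection; exact: (@measurable_xsection _ _ (measurableTypeR R) (V * V)%type A t mA).
  apply/seteqP; split => x /= H; last by have := set_mem (set_mem H).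
  by apply/mem_set/mem_set.
by rewrite -[in RHS](setIT [set x | _]) -integral_indic//.
Qed.

End triple_product.

Section time_product.
Context d (X : measurableType d) (R : realType).
Variables (m : {sigma_finite_measure set X -> \bar R}) (T : R).

Lemma time_prod_null (A : set (measurableTypeR R * X)) : measurable A ->
  (forall t, 0 < t < T -> m [set x | A (t, x)] = 0%E) -> (time_measure T \x m)%E A = 0%E.
Proof.
move=> mA HA.
have mI : measurable_fun setT (\1_A : measurableTypeR R * X -> R) by exact: measurable_indic.
have mE : measurable_fun setT (EFin \o (\1_A : measurableTypeR R * X -> R)) by exact/measurable_EFinP.
rewrite -(setIT A) -integral_indic//.
have pE p : (0 <= (EFin \o (\1_A : measurableTypeR R * X -> R)) p)%E by rewrite lee_fin.
rewrite (@fubini_tonelli1 _ _ _ _ R (time_measure T) m _ mE pE).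
rewrite time_measure_integral; last exact: (measurable_integral2 m mE).
apply: integral0_eq => t /=; rewrite in_itv/= => tT.
have mt : measurable [set x | A (t, x)].
  rewrite (_ : [set _ | _] = xsection A t).
    by apply: measurable_xsection.
  by apply/seteqP; split => x /= H; [exact/mem_set|exact: set_mem H].
by rewrite -(HA t tT) -[in RHS](setIT [set x | _]) -integral_indic.
Qed.

Lemma Rintegrable_time_snd (f : X -> R) : Rintegrable m f ->
  Rintegrable (time_measure T \x m)%E (fun p => f p.2).
Proof.
move=> fi; apply: (Rintegrable_prod (f := fun p : measurableTypeR R * X => f p.2)).
  by apply: (measurable_comp_fun (f := f)) => //; exact: integrable_measurable fi.
have foo := Rintegrable_lty fi.
have -> : (\int[time_measure T]_t \int[m]_x `|f (t, x).2|%:E =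
    \int[time_measure T]_t cst (\int[m]_x `|f x|%:E) t)%E by [].
rewrite integral_cst//= lte_mul_pinfty//; first exact: integral_ge0.
  by rewrite ge0_fin_numE//; exact: integral_ge0.
exact: fin_num_fun_lty.
Qed.

End time_product.

(** * The approximating family and its uniform estimates *)

Section approximants.
Variables (R : realType) (N : nat).
Notation V := 'rV[R]_N.
Notation leb := (lebesgue_rV R N).
Variable nu : {sigma_finite_measure set V -> \bar R}.
Hypothesis nu_even : forall A : set V, measurable A ->
  nu ((fun z : V => - z) @^-1` A) = nu A.
Hypothesis nu_levy : (\int[nu]_z (kappa z)%:E < +oo)%E.
Variables (T M B : R) (u0 : V -> R).
Hypothesis T0 : 0 < T.
Hypothesis u0i : Rintegrable leb u0.
Hypothesis u0M : forall x, `|u0 x| <= M.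
Variables (phi_ : nat -> R -> R) (Lip_ : nat -> R) (K_ : nat -> nat).
Hypothesis phi_nd : forall n, {homo phi_ n : r s / r <= s}.
Hypothesis phi0 : forall n, phi_ n 0 = 0.
Hypothesis phi_lip : forall n s t, `|phi_ n s - phi_ n t| <= Lip_ n * `|s - t|.
Hypothesis phi_B : forall n, phi_sup (phi_ n) M <= B.
Hypothesis K_gt0 : forall n, (0 < K_ n)%N.

Lemma natSinv_gt0 n : 0 < n.+1%:R^-1 :> R. Proof. by rewrite invr_gt0. Qed.

Definition trunc_levy n : {finite_measure set V -> \bar R} :=
  levy_restr nu_levy (natSinv_gt0 n).

Definition time_step n : R := T / (K_ n)%:R.

Hypothesis step_small : forall n, time_step n <= n.+1%:R^-1.
Hypothesis cfl : forall n, 4 * (time_step n * Lip_ n * mass (trunc_levy n)) <= 1.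

Lemma time_step_gt0 n : 0 < time_step n.
Proof. by rewrite /time_step divr_gt0// ltr0n. Qed.

Lemma trunc_levy_even n (A : set V) : measurable A ->
  trunc_levy n ((fun z : V => - z) @^-1` A) = trunc_levy n A.
Proof. exact: levy_restr_even. Qed.

Definition U n : nat -> V -> R := iterate (trunc_levy n) (phi_ n) (time_step n) u0.

Definition u_ n (t : R) : V -> R := U n (grid (time_step n) t).

Let d0 n := ltW (time_step_gt0 n).

Lemma U_measurable n k : measurable_fun setT (U n k).
Proof. exact: (iterate_measurable (phi_nd n) (phi_lip n) (d0 n) (cfl n) u0i u0M). Qed.

Lemma U_bounded n k x : `|U n k x| <= M.
Proof. exact: (iterate_bounded (phi_nd n) (phi_lip n) (d0 n) (cfl n) u0i u0M). Qed.

Lemma u_measurable2 n : measurable_fun setT (fun p : V * R => u_ n p.2 p.1).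
Proof.
by apply: (measurable_fun_grid (time_step_gt0 n)) => k; exact: U_measurable.
Qed.

Lemma u_bounded n t x : `|u_ n t x| <= M. Proof. exact: U_bounded. Qed.

Lemma u_translation n t (y : V) :
  (L1dist leb (fun x : V => u_ n t (x + y))%R (u_ n t) <=
   L1dist leb (fun x : V => u0 (x + y))%R u0)%E.
Proof. exact: (iterate_translation (phi_nd n) (phi_lip n) (d0 n) (cfl n) u0i u0M). Qed.

Lemma u_L1 n t : (\int[leb]_x `|u_ n t x|%:E <= \int[leb]_x `|u0 x|%:E)%E.
Proof. exact: (iterate_L1 (phi_nd n) (phi_lip n) (d0 n) (cfl n) u0i u0M). Qed.

Local Notation v n k := (phi_ n \o U n k).

Definition energy_bound : R := 4 * (B * \int[leb]_x `|u0 x|).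

Lemma energy_bound_ge0 : 0 <= energy_bound.
Proof.
have M0 : 0 <= M by exact: bounded_B_ge0 u0M.
have B0 : 0 <= B.
  apply: le_trans (phi_B 0); apply: le_trans (phi_bounded (phi_nd 0) (_ : `|0| <= M)).
    exact: normr_ge0.
  by rewrite normr0.
by rewrite /energy_bound !mulr_ge0// Rintegral_ge0.
Qed.

Lemma u_energy n K : \sum_(k < K) time_step n * jump_form (trunc_levy n) (v n k) (v n k) <=
  energy_bound.
Proof.
apply: le_trans (iterate_energy (trunc_levy_even n) (phi_nd n) (phi0 n) (phi_lip n)
  (d0 n) (cfl n) u0i u0M K (measurable_primitive (phi_nd n)) (primitive0 (phi_ n))
  (primitive_sub (phi_nd n))) _.
by rewrite /energy_bound ler_pM2l// ler_wpM2r// Rintegral_ge0.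
Qed.

Lemma u_energy_shift n i K :
  \sum_(k < K) time_step n * jump_form (trunc_levy n) (v n (i + k)) (v n (i + k)) <=
  energy_bound.
Proof.
apply: le_trans (u_energy n (i + K)); rewrite big_split_ord/= lerDr sumr_ge0// => k _.
by rewrite mulr_ge0// jump_form_ge0.
Qed.

(** The tent is bounded, Lipschitz and supported in a ball, with constants depending on neither its
    centre nor the truncation, so [jump_form_levy_le] gives one bound for all. *)
Lemma tent_form_bound eps : 0 < eps -> exists2 G, 0 <= G & forall n (x : V),
  jump_form (trunc_levy n) (fun y : V => tent eps (y - x)) (fun y => tent eps (y - x)) <= G.
Proof.
move=> eps0; pose C := Num.max 1 eps^-1.
have C1 : 1 <= C by rewrite le_max lexx.
have Ce : eps^-1 <= C by rewrite le_max lexx orbT.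
exists (4 * C ^+ 2 * (2 * cvol N eps * kmass nu)).
  have C20 := sqr_ge0 C; have k0 := kmass_ge0 nu; have c0 := cvol_ge0 N eps.
  apply: mulr_ge0; [exact: mulr_ge0|apply: mulr_ge0 => //; exact: mulr_ge0].
move=> n x.
have shiftS : (fun y : V => y + (- x)) @^-1` [set y : V | `|y| <= eps] =
    [set y : V | `|y - x| <= eps] by [].
have volS : leb [set y : V | `|y - x| <= eps] = leb [set y : V | `|y| <= eps].
  by rewrite -shiftS lebesgue_rV_shift//; exact: measurable_rV_cball.
rewrite /cvol -volS; apply: jump_form_levy_le.
- apply: (measurable_comp_shift (- x) (f := tent eps)).
  exact: measurable_tent.
- by move=> y; rewrite tent_norm; apply: le_trans (tent_le1 eps0 _) C1.
- move=> y z; apply: le_trans (tent_lip eps0 _ _) _.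
  rewrite (_ : y + z - x - (y - x) = z); last by rewrite opprB addrA subrK addrC addKr.
  apply: ler_pM => //; first by rewrite invr_ge0 ltW.
  exact: norm_le_eucl.
- rewrite -shiftS -[X in measurable X]setTI; apply: measurable_shift => //.
  exact: measurable_rV_cball.
- by rewrite volS lebesgue_rV_bounded.
- by move=> y /= /negP; rewrite -ltNge => ye; rewrite tent_eq0// ltW.
Qed.

(** The change of a mollified value is the discrete weak form tested with a translated tent. Young's
    inequality with parameter [h] bounds it by h / 2 times the energy of phi(u) plus G / (2h) times
    the elapsed time, and each part is at most eta / 2. *)
Lemma u_weak eps eta : 0 < eps -> 0 < eta ->
  exists2 tau, 0 < tau & exists n0, forall n x t s, (n0 <= n)%N -> `|t - s| < tau ->
  `|moll eps (u_ n t) x - moll eps (u_ n s) x| <= eta.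
Proof.
move=> eps0 eta0; have [G G0 HG] := tent_form_bound eps0.
have E0 := energy_bound_ge0.
pose h := eta / (energy_bound + 1).
have h0 : 0 < h by rewrite divr_gt0//; lra.
(* The number of steps times the step size is at most |t - s| + delta <= 2 tau, and G / (2h) times 2
   tau must not exceed eta / 2. From [n0] on the step size is itself at most tau. *)
pose tau := eta * h / (G + 1) / 2.
have tau0 : 0 < tau by rewrite !(divr_gt0, mulr_gt0)//; lra.
have [n0 n0tau] : exists n0 : nat, n0.+1%:R^-1 <= tau.
  exists (Num.truncn tau^-1); rewrite -[leRHS]invrK lef_pV2 ?posrE ?invr_gt0//.
  exact/ltW/truncnS_gt.
exists tau => //; exists n0 => n x t s nn ts.
wlog st : t s ts / (grid (time_step n) s <= grid (time_step n) t)%N => [H|].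
  have [st|/ltnW st] := leqP (grid (time_step n) s) (grid (time_step n) t); first exact: H.
  by rewrite distrC; apply: H => //; rewrite distrC.
have dn : time_step n <= tau.
  apply: le_trans (step_small n) _; apply: le_trans n0tau.
  by rewrite lef_pV2 ?posrE// ler_nat ltnS.
pose g (y : V) := tent eps (y - x).
have gi : Rintegrable leb g := Rintegrable_tent_shift eps0 x.
have gB y : `|g y| <= 1 by rewrite /g tent_norm tent_le1.
set i := grid _ s in st *; set j := grid _ t in st *.
have -> : moll eps (u_ n t) x - moll eps (u_ n s) x =
    - \sum_(k < j - i) time_step n * (2^-1 * jump_form (trunc_levy n) (v n (i + k)) g).
  rewrite -(iterate_weak_diff (trunc_levy_even n) (phi_nd n) (phi_lip n) (d0 n) (cfl n) u0i u0M
    i (j - i) gi) subnKC//.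
rewrite normrN; apply: le_trans (ler_norm_sum _ _ _) _.
apply: (@le_trans _ _ (\sum_(k < j - i) (h / 2 *
    (time_step n * jump_form (trunc_levy n) (v n (i + k)) (v n (i + k))) +
    h^-1 / 2 * G * time_step n))).
  apply: ler_sum => k _; have i20 : 0 <= 2^-1 :> R by rewrite invr_ge0.
  rewrite normrM (ger0_norm (d0 n)) normrM (ger0_norm i20).
  have := jump_form_young (trunc_levy_even n) (phi_nd n) (phi0 n) (phi_lip n) (d0 n) (cfl n)
    u0i u0M (i + k) gi gB h0.
  have hG : h^-1 * jump_form (trunc_levy n) g g <= h^-1 * G.
    by rewrite ler_wpM2l ?invr_ge0 ?(ltW h0)//; exact: HG.
  move=> H; have {}H := le_trans H (lerD (lexx _) hG).
  have t20 : 0 <= time_step n * 2^-1 by rewrite mulr_ge0// invr_ge0.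
  rewrite mulrA; apply: le_trans (ler_wpM2l t20 H) _.
  by rewrite le_eqVlt; apply/orP; left; apply/eqP; ring.
rewrite big_split/= -mulr_sumr sumr_const card_ord -mulr_natr.
have H1 := ler_wpM2l (ltW (_ : 0 < h / 2)) (u_energy_shift n i (j - i)).
have H1' : h / 2 * energy_bound <= eta / 2.
  rewrite /h mulrAC ler_wpM2r ?invr_ge0// mulrAC ler_pdivrMr ?ler_wpM2l ?ltW//; lra.
have H2 := grid_sub (time_step_gt0 n) st.
have H3 : h^-1 / 2 * G * time_step n * (j - i)%:R <= eta / 2.
  rewrite -mulrA (mulrC (time_step n)).
  have tt : (j - i)%:R * time_step n <= 2 * tau by apply: le_trans H2 _; lra.
  have hG0 : 0 <= h^-1 / 2 * G by rewrite !mulr_ge0 ?invr_ge0 ?(ltW h0).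
  apply: le_trans (ler_wpM2l hG0 tt) _.
  have -> : h^-1 / 2 * G * (2 * tau) = eta / 2 * (G / (G + 1)).
    have hN0 : h != 0 by rewrite gt_eqF.
    have GN0 : G + 1 != 0 by rewrite gt_eqF//; lra.
    by rewrite /tau; move: h hN0 {h0 tau tau0 n0tau ts dn hG0 tt H1 H1'} => k kN0; field; rewrite GN0.
  by rewrite ler_piMr ?divr_ge0 ?(ltW eta0)// ler_pdivrMr ?mul1r; lra.
have {}H1 := H1 (_ : 0 < h / 2); rewrite divr_gt0// in H1.
have := H1 isT; lra.
Qed.

Lemma u_limit : exists sigma : nat -> nat, exists u : V * R -> R,
  exists G : set (V * R),
  [/\ forall j, (j <= sigma j)%N, measurable_fun setT u /\ measurable G,
      forall p, `|u p| <= M,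
      forall p, G p -> u_ (sigma j) p.2 p.1 @[j --> \oo] --> u p &
      forall t, 0 <= t <= T -> \forall x \ae leb, G (x, t)].
Proof. exact: (exists_limit u0i u_measurable2 u_bounded u_translation u_weak). Qed.

Lemma u_locdist_time (r e : R) : 0 < e ->
  exists2 tau, 0 < tau & exists n0, forall n t s, (n0 <= n)%N -> `|t - s| < tau ->
  (locdist r (u_ n t) (u_ n s) <= e%:E)%E.
Proof.
apply: (locdist_time u0i _ u_bounded u_translation u_weak r) => n t.
exact: U_measurable.
Qed.

End approximants.

(** * Space-time measurability and bounds on test functions *)

Section space_time.
Variables (R : realType) (N : nat).
Notation V := 'rV[R]_N.

(** Identifies R^(N+1) with R^N x R, so that measurability of open sets is carried over to the
    product sigma-algebra. *)
Definition rV_split (v : 'rV[R]_N.+1) : V * R :=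
  (\row_j v ord0 (lift ord0 j), v ord0 ord0).

Lemma rV_split_cons (p : V * R) : rV_split (rV_cons (p.2, p.1)) = p.
Proof.
case: p => x t; rewrite /rV_split !mxE unlift_none; congr (_, _).
by apply/rowP => j; rewrite !mxE liftK.
Qed.

Lemma continuous_rV_split : continuous rV_split.
Proof.
move=> v A /= /nbhs_ballP[e /= e0 eA]; apply/nbhs_ballP; exists e => //= w.
rewrite -!ball_normE/= => vw; apply: eA; rewrite -ball_normE/=; apply: le_lt_trans vw.
rewrite /rV_split /Num.norm/= ge_max; apply/andP; split.
  apply: rV_norm_le => [|j]; [exact: (normr_ge0 (v - w))|rewrite !mxE].
  by have := ler_norm_coord (v - w) (lift ord0 j); rewrite !mxE.
by have := ler_norm_coord (v - w) ord0; rewrite !mxE.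
Qed.

Lemma measurable_swap_cons : measurable_fun setT (fun p : V * R => rV_cons (p.2, p.1)).
Proof.
apply: (measurableT_comp (@measurable_rV_cons R N)).
by apply: measurable_fun_pair; [exact: measurable_snd|exact: measurable_fst].
Qed.

Lemma continuous_measurable_space_time (f : V * R -> R) : continuous f -> measurable_fun setT f.
Proof.
move=> cf; rewrite (_ : f = (f \o rV_split) \o (fun p : V * R => rV_cons (p.2, p.1))).
  apply: measurableT_comp measurable_swap_cons; apply: continuous_measurable_rV => v.
  by apply: continuous_comp; [exact: continuous_rV_split|exact: cf].
by apply/funext => p /=; rewrite rV_split_cons.
Qed.

Lemma closed_measurable_space_time (K : set (V * R)) : closed K -> measurable K.
Proof.
move=> cK; rewrite (_ : K = (fun p : V * R => rV_cons (p.2, p.1)) @^-1` (rV_split @^-1` K)).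
  rewrite -[X in measurable X]setTI; apply: measurable_swap_cons => //.
  rewrite -(setCK (_ @^-1` K)); apply: measurableC; apply: open_measurable_rV.
  rewrite openC; apply: closed_comp => // v _; exact: continuous_rV_split.
by apply/funext => p /=; rewrite rV_split_cons.
Qed.

Lemma box_bounded (f : V * R -> R) (r T : R) : continuous f ->
  exists2 C, 0 <= C & forall x t, `|x| <= r -> 0 <= t <= T -> `|f (x, t)| <= C.
Proof.
move=> cf; pose K := [set x : V | forall i, x ord0 i \in `[- r, r]].
have cK : compact (K `*` `[0, T]).
  apply: compact_setX; last exact: segment_compact.
  by apply: (@rV_compact R N (fun=> `[- r, r]%classic)) => i; exact: segment_compact.
have : compact (f @` (K `*` `[0, T])).
  by apply: continuous_compact cK; exact: continuous_subspaceT.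
move=> /(@compact_bounded R R^o) [C [Cr HC]].
exists (Num.max 0 (C + 1)); first by rewrite le_max lexx.
move=> x t xr tT; apply: le_trans (_ : C + 1 <= _); last by rewrite le_max lexx orbT.
apply: HC; first by rewrite ltrDl.
exists (x, t) => //; split => //= i; rewrite in_itv/= -ler_norml.
exact: le_trans (ler_norm_coord _ _) xr.
Qed.

End space_time.

Section line.
Variables (R : realType) (V : normedModType R).

Lemma is_derive_line (f : V -> R) (p e : V) : (forall x, derivable f x e) ->
  forall s : R, is_derive s 1 (fun s => f (s *: e + p)) ('D_e f (s *: e + p)).
Proof.
move=> df s.
have E : (fun h : R => h^-1 *: ((fun s : R => f (s *: e + p)) (h *: 1 + s) - f (s *: e + p))) =
    (fun h : R => h^-1 *: (f (h *: e + (s *: e + p)) - f (s *: e + p))).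
  apply/funext => h; congr (_ *: (f _ - _)).
  by rewrite scaler1 scalerDl addrA.
split; first by have := df (s *: e + p); rewrite /derivable/= E.
by rewrite /derive/= E.
Qed.

Lemma line_lipschitz (f : V -> R) (p e : V) (C : R) : continuous f ->
  (forall x, derivable f x e) ->
  (forall s, `|'D_e f (s *: e + p)| <= C) ->
  forall a, `|f (a *: e + p) - f p| <= C * `|a|.
Proof.
move=> cf df DC a.
have cg (s : R) : {for s, continuous (fun s : R => f (s *: e + p))}.
  apply: continuous_comp; last exact: cf.
  by apply: cvgD; [exact: cvgZr_tmp|exact: cvg_cst].
have [->|aN0] := eqVneq a 0; first by rewrite scale0r add0r subrr normr0 mulr0.
pose g s := f (s *: e + p).
suff H x y : x < y -> `|g y - g x| <= C * `|y - x|.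
  have -> : f p = g 0 by rewrite /g scale0r add0r.
  rewrite -/(g a) -[a in leRHS]subr0.
  have [a0|a0|/eqP] := ltgtP a 0; [|exact: H|by rewrite (negbTE aN0)].
  by rewrite distrC (distrC a); exact: H.
move=> xy.
have [c _ ->] := @MVT R g (fun s => 'D_e f (s *: e + p)) x y xy
  (fun s _ => is_derive_line p df s) (continuous_subspaceT cg).
by rewrite normrM ler_wpM2r.
Qed.

End line.

Section test_functions.
Variables (R : realType) (N : nat).
Notation V := 'rV[R]_N.
Variables (T : R) (psi : V * R -> R).
Hypothesis T0 : 0 < T.
Hypothesis psiT : test_function T psi.

Let smooth_psi : smooth psi. Proof. by case: psiT. Qed.

Lemma test_continuous : continuous psi.
Proof. by have [] := smooth_psi 0%N. Qed.

Lemma test_derivable (e p : V * R) : derivable psi p e.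
Proof. by have [_ /(_ e)[/(_ p)]] := smooth_psi 1%N. Qed.

Lemma test_derive_continuous (e : V * R) : continuous ('D_e psi).
Proof. by have [_ /(_ e)[_ []]] := smooth_psi 1%N. Qed.

Notation time_dir := ((0 : V), (1 : R)).

Lemma test_time_line (x : V) (t : R) :
  is_derive t 1 (fun t => psi (x, t)) ('D_time_dir psi (x, t)).
Proof.
have lineE (s : R) : s *: time_dir + (x, 0) = (x, s).
  by congr pair; rewrite /= ?scaler0 ?add0r// -[s *: 1]/(s * 1) mulr1 addr0.
have := is_derive_line (x, 0) (@test_derivable time_dir) t.
by rewrite lineE; under eq_fun do rewrite lineE.
Qed.

Lemma test_time_derivative p : time_derivative psi p = 'D_time_dir psi p.
Proof.
case: p => x t; rewrite /time_derivative derive1E.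
by have /@derive_val := test_time_line x t.
Qed.

(** If psi(x, T) were nonzero, continuity would make psi nonzero at slightly earlier times, and (x,
    T) would belong to the closed support, which lies in t < T. *)
Lemma test_end (x : V) : psi (x, T) = 0.
Proof.
apply/eqP/negPn/negP => psi0.
case: psiT => _ _ /(_ (x, T)); rewrite /= ltxx andbF; apply: contraPP => _.
suff : closure [set p | 0 <= p.2 < T /\ psi p != 0] (x, T) by move=> H /(_ H).
move=> A nA; have nz : nbhs (x, T) [set p | psi p != 0].
  apply: (test_continuous (x := (x, T)) (_ : nbhs (psi (x, T)) [set r : R | r != 0])).
  by apply: open_nbhs_nbhs; split => //; exact: open_neq.
have /nbhs_ballP[e /= e0 eA] : nbhs (x, T) (A `&` [set p | psi p != 0]) by exact: filterI.
pose h := Num.min T e / 2.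
have h0 : 0 < h by rewrite divr_gt0// lt_min T0.
have mT : Num.min T e <= T by rewrite ge_min lexx.
have me : Num.min T e <= e by rewrite ge_min lexx orbT.
have hT : h < T by move: T0; rewrite /h; lra.
have he : h < e by rewrite /h; lra.
have [Ah zh] : (A `&` [set p | psi p != 0]) (x, T - h).
  apply: eA; split; first exact: ballxx.
  by rewrite -ball_normE/=/ball_/= opprB addrC subrK gtr0_norm.
by exists (x, T - h); split => //; split => //=; lra.
Qed.

Lemma test_outside : exists r, forall x t, 0 <= t <= T -> r < `|x| -> psi (x, t) = 0.
Proof.
case: psiT => _ /compact_bounded[r [rr Hr]] _; exists (r + 1) => x t tT rx.
have [tT'|tT'] := ltP t T; last first.
  by rewrite (_ : t = T) ?test_end//; apply: le_anti; rewrite tT' andbT; case/andP: tT.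
apply/eqP/negPn/negP => psi0.
have : closure [set p | 0 <= p.2 < T /\ psi p != 0] (x, t).
  by apply: subset_closure; split => //=; rewrite tT' andbT; case/andP: tT.
move=> /(Hr (r + 1) _) => H; have {H} : `|(x, t)| <= r + 1 by apply: H; rewrite ltrDl.
by rewrite /Num.norm/= ge_max => /andP[]; rewrite -/(Num.norm _) leNgt rx.
Qed.

(** All bounds concern times in [0, T], because compactness of the support says nothing about the
    values of [psi] at other times. *)
Lemma test_facts : exists r C, [/\ 0 <= C,
  forall x t, 0 <= t <= T -> r < `|x| -> psi (x, t) = 0,
  forall x t, 0 <= t <= T -> `|psi (x, t)| <= C,
  forall x z t, 0 <= t <= T -> `|psi (x + z, t) - psi (x, t)| <= C * eucl_norm z &
  forall x t, 0 < t < T ->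
    `|time_derivative psi (x, t)| <= C /\ (r < `|x| -> time_derivative psi (x, t) = 0)].
Proof.
have [r psir] := test_outside.
have boxed (f : V * R -> R) : continuous f ->
    (forall x t, 0 < t < T -> r < `|x| -> f (x, t) = 0) ->
    exists2 C, 0 <= C & forall x t, 0 < t < T -> `|f (x, t)| <= C.
  move=> cf f0; have [C C0 HC] := box_bounded r T cf; exists C => // x t tT.
  have [xr|rx] := leP `|x| r; last by rewrite f0// normr0.
  by apply: HC => //; case/andP: tT => *; rewrite !ltW.
have [C1 C10 HC1] := box_bounded r T test_continuous.
have psiC1 x t : 0 <= t <= T -> `|psi (x, t)| <= C1.
  move=> tT; have [xr|rx] := leP `|x| r; last by rewrite psir// normr0.
  exact: HC1.
have Dt0 x t : 0 < t < T -> r < `|x| -> 'D_time_dir psi (x, t) = 0.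
  move=> tT rx; have /@derive_val <- := test_time_line x t.
  rewrite (@near_eq_derive _ _ _ _ (cst 0)) ?derive_cst// ?oner_eq0//.
  near=> s; apply: psir => //.
  have : s \in `]0, T[ by near: s; apply: near_in_itvoo; rewrite in_itv.
  by rewrite in_itv/= => /andP[? ?]; rewrite !ltW.
have [C2 C20 HC2] := boxed _ (@test_derive_continuous time_dir) Dt0.
pose dir (i : 'I_N) : V * R := ('e_i, 0).
have lineE (i : 'I_N) (x : V) (t s : R) : s *: dir i + (x, t) = (s *: 'e_i + x, t).
  by congr pair; rewrite /= scaler0 add0r.
have HD i : exists2 C, 0 <= C & forall x t, 0 <= t <= T -> `|'D_(dir i) psi (x, t)| <= C.
  (* Beyond r + 1 a move of length at most 1 stays where psi vanishes, so the partial derivative is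
     0 there. *)
  have [C C0 HC] := box_bounded (r + 1) T (@test_derive_continuous (dir i)).
  exists C => // x t tT; have [xr|rx] := leP `|x| (r + 1); first exact: HC.
  have := is_derive_line (x, t) (@test_derivable (dir i)) 0.
  rewrite scale0r add0r => /@derive_val <-.
  rewrite (@near_eq_derive _ _ _ _ (cst 0)) ?derive_cst ?normr0// ?oner_eq0//.
  near=> s; rewrite lineE; apply: psir => //.
  have s1 : `|s| <= 1 by near: s; exact: (@nbhs0_le R R^o 1 ltr01).
  have : `|x| <= `|s *: 'e_i + x| + `|s *: ('e_i : V)|.
    by rewrite -[x in leLHS](addKr (s *: 'e_i)) addrC; apply: le_trans (ler_normB _ _) _.
  have : `|s *: ('e_i : V)| <= 1.
    apply: rV_norm_le => // j; rewrite !mxE normrM mulr_ile1//.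
    by case: (_ && _); rewrite ?normr1 ?normr0 ?ler01.
  lra.
pose C_ i := projT1 (cid2 (HD i)).
have C_0 i : 0 <= C_ i by rewrite /C_; case: cid2.
have C_D i x t : 0 <= t <= T -> `|'D_(dir i) psi (x, t)| <= C_ i.
  by rewrite /C_; case: cid2 => ? ? H; exact: H.
pose C3 := \sum_i C_ i.
have C30 : 0 <= C3 by rewrite sumr_ge0.
exists r, (C1 + C2 + C3); split.
- by rewrite !addr_ge0.
- exact: psir.
- by move=> x t tT; have := psiC1 x t tT; lra.
- move=> x z t tT.
  apply: le_trans (_ : C3 * eucl_norm z <= _); last by rewrite ler_wpM2r ?eucl_norm_ge0//; lra.
  rewrite {1}(row_sum_delta z) mulr_suml.
  (* The move by z is made one coordinate at a time, by induction on the list of directions. *)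
  have H (s : seq 'I_N) y : `|psi (y + \sum_(i <- s) z ord0 i *: 'e_i, t) - psi (y, t)| <=
      \sum_(i <- s) C_ i * eucl_norm z.
    elim: s y => [|i s IHs] y; first by rewrite !big_nil addr0 subrr normr0.
    rewrite !big_cons addrA.
    apply: le_trans (ler_distD (psi (y + z ord0 i *: 'e_i, t)) _ _) _.
    rewrite [leLHS]addrC; apply: lerD; last exact: IHs.
    rewrite (addrC y) -lineE.
    have := line_lipschitz test_continuous (@test_derivable (dir i)) (p := (y, t)) (C := C_ i).
    move=> /(_ (fun s => _) (z ord0 i)) H.
    apply: le_trans (H _) _ => [q|]; first by rewrite lineE C_D.
    by rewrite ler_wpM2l// coord_le_eucl.
  exact: H.
- move=> x t tT; rewrite test_time_derivative; split; last exact: Dt0.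
  by have := HC2 x t tT; lra.
Unshelve. all: by end_near. Qed.

Lemma measurable_test : measurable_fun setT psi.
Proof. exact: continuous_measurable_space_time test_continuous. Qed.

Lemma measurable_time_derivative : measurable_fun setT (time_derivative psi).
Proof.
rewrite (_ : time_derivative psi = 'D_time_dir psi).
  exact: continuous_measurable_space_time (@test_derive_continuous time_dir).
by apply/funext => p; exact: test_time_derivative.
Qed.

End test_functions.

(** * Passage to the limit in the discrete weak formulation *)

Section limit_passage.
Variables (R : realType) (N : nat).
Notation V := 'rV[R]_N.
Notation leb := (lebesgue_rV R N).
Variable nu : {sigma_finite_measure set V -> \bar R}.
Hypothesis nu_even : forall A : set V, measurable A ->
  nu ((fun z : V => - z) @^-1` A) = nu A.
Hypothesis nu_levy : (\int[nu]_z (kappa z)%:E < +oo)%E.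
Variables (T M E : R) (u0 : V -> R).
Hypothesis T0 : 0 < T.
Variables (r_ : nat -> R) (K_ : nat -> nat) (phi_ : nat -> R -> R) (B_ : nat -> R).
Variable U : nat -> nat -> V -> R.
Hypothesis r_gt0 : forall j, 0 < r_ j.
Hypothesis r_cvg : r_ j @[j --> \oo] --> 0.
Hypothesis K_gt0 : forall j, (0 < K_ j)%N.

Definition mesh j : R := T / (K_ j)%:R.

Hypothesis mesh_cvg : mesh j @[j --> \oo] --> 0.

Notation trunc j := (levy_restr nu_levy (r_gt0 j)).
Notation v j k := (phi_ j \o U j k).

Hypothesis U_meas : forall j k, measurable_fun setT (U j k).
Hypothesis U_bnd : forall j k x, `|U j k x| <= M.
Hypothesis v_int : forall j k, Rintegrable leb (v j k).
Hypothesis v_bnd : forall j k x, `|v j k x| <= B_ j.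
Hypothesis energy : forall j,
  \sum_(k < K_ j) mesh j * jump_form (trunc j) (v j k) (v j k) <= E.
Hypothesis weak_sum : forall j (psi : nat -> V -> R), (forall k, Rintegrable leb (psi k)) ->
  \sum_(k < K_ j) \int[leb]_x (U j k x * (psi k.+1 x - psi k x)) -
  \sum_(k < K_ j) mesh j * (2^-1 * jump_form (trunc j) (v j k) (psi k.+1)) +
  \int[leb]_x (u0 x * psi 0%N x) = \int[leb]_x (U j (K_ j) x * psi (K_ j) x).
Variables (phi : R -> R) (u : V * R -> R) (G : set (V * R)).
Hypothesis phi_cont : continuous phi.
Hypothesis phi_meas : measurable_fun setT phi.
Hypothesis phi_cvg : forall e, 0 < e -> \forall j \near \oo,
  forall s, `|s| <= M -> `|phi_ j s - phi s| <= e.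
Hypothesis u_meas : measurable_fun setT u.
Hypothesis u_bnd : forall p, `|u p| <= M.
Hypothesis G_meas : measurable G.
Hypothesis u_cvg : forall p, G p ->
  U j (grid (mesh j) p.2) p.1 @[j --> \oo] --> u p.
Hypothesis G_full : forall t, 0 < t < T -> \forall x \ae leb, G (x, t).

Lemma mesh_gt0 j : 0 < mesh j.
Proof. by rewrite /mesh divr_gt0// ltr0n. Qed.

Lemma mesh_K j : T = (K_ j)%:R * mesh j.
Proof. by rewrite /mesh mulrC divfK// pnatr_eq0 -lt0n. Qed.

Notation time := (time_measure T).
Notation lnu := (prod_measure leb nu).
Notation triple := (time \x lnu)%E.
Notation TVV := (measurableTypeR R * (V * V))%type.
Notation TV := (measurableTypeR R * V)%type.

(** The truncation is encoded as an indicator, so that all approximations live on one measure space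
    with the full measure [nu]. *)
Definition jumps_ j (p : TVV) : R := \1_(far (r_ j)) p.2.2 *
  (v j (grid (mesh j) p.1) (p.2.1 + p.2.2) - v j (grid (mesh j) p.1) p.2.1).

Definition jumps (p : TVV) : R := \1_(far 0) p.2.2 *
  (phi (u (p.2.1 + p.2.2, p.1)) - phi (u (p.2.1, p.1))).

Lemma measurable_grid_swap d (X : measurableType d) j (f : nat -> X -> R) :
  (forall k, measurable_fun setT (f k)) ->
  measurable_fun setT (fun p : measurableTypeR R * X => f (grid (mesh j) p.1) p.2).
Proof.
move=> mf; have := measurable_fun_grid (mesh_gt0 j) mf => H.
apply: (measurable_comp_fun (f := fun p : X * R => f (grid (mesh j) p.2) p.1)
  (g := fun p : measurableTypeR R * X => (p.2, p.1))) => //.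
by apply: measurable_fun_pair; [exact: measurable_snd|exact: measurable_fst].
Qed.

Lemma measurable_jumps_ j : measurable_fun setT (jumps_ j).
Proof.
have H := measurable_grid_swap j (fun k => measurable_jump_diff (integrable_measurable (v_int j k))).
apply: measurable_funM; last exact: H.
apply: (measurable_comp_fun (f := \1_(far (r_ j)) : V -> R) (g := fun p : TVV => p.2.2)).
  by apply: measurable_indic; exact: measurable_far.
by apply: measurableT_comp => //; exact: measurable_snd.
Qed.

Lemma measurable_TVV_shift : measurable_fun setT (fun p : TVV => (p.2.1 + p.2.2, p.1)).
Proof.
apply: measurable_fun_pair; last exact: measurable_fst.
apply: measurable_fun_rV => i; under eq_fun do rewrite mxE.
apply: measurable_funD; apply: (measurable_comp_fun (f := fun x : V => x ord0 i));
  try exact: measurable_rV_coord.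
- by apply: measurableT_comp => //; exact: measurable_snd.
- by apply: measurableT_comp => //; exact: measurable_snd.
Qed.

Lemma measurable_TVV_base : measurable_fun setT (fun p : TVV => (p.2.1, p.1)).
Proof.
apply: measurable_fun_pair; last exact: measurable_fst.
by apply: measurableT_comp => //; exact: measurable_snd.
Qed.

Lemma measurable_space_time_diff (f : V * R -> R) : measurable_fun setT f ->
  measurable_fun setT (fun p : TVV => f (p.2.1 + p.2.2, p.1) - f (p.2.1, p.1)).
Proof.
move=> mf; apply: measurable_funB; apply: (measurable_comp_fun (f := f)) => //.
  exact: measurable_TVV_shift.
exact: measurable_TVV_base.
Qed.

Lemma measurable_jumps : measurable_fun setT jumps.
Proof.
apply: measurable_funM; last first.
  apply: (measurable_space_time_diff (f := phi \o u)); exact: measurableT_comp.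
apply: (measurable_comp_fun (f := \1_(far 0) : V -> R) (g := fun p : TVV => p.2.2)).
  by apply: measurable_indic; exact: measurable_far.
by apply: measurableT_comp => //; exact: measurable_snd.
Qed.

Lemma phi_U_cvg p : G p -> phi_ j (U j (grid (mesh j) p.2) p.1) @[j --> \oo] --> phi (u p).
Proof.
move=> Gp; apply/cvgrPdist_le => e e0; have e2 : 0 < e / 2 by rewrite divr_gt0.
have c1 : phi (U j (grid (mesh j) p.2) p.1) @[j --> \oo] --> phi (u p).
  by apply: continuous_cvg; [exact: phi_cont|exact: u_cvg].
have /cvgrPdist_le/(_ _ e2) c2 := c1.
near=> j; rewrite -(subrKA (phi (U j (grid (mesh j) p.2) p.1))) (splitr e).
apply: le_trans (ler_normD _ _) _; apply: lerD; first by near: j.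
rewrite distrC; have := U_bnd j (grid (mesh j) p.2) p.1; move: (U j _ _).
by near: j; exact: phi_cvg.
Unshelve. all: by end_near. Qed.

Lemma far_cvg (z : V) : \1_(far (r_ j)) z @[j --> \oo] --> (\1_(far 0) z : R).
Proof.
rewrite [X in _ --> X]indicE; have [z0|z0] := ltP 0 (eucl_norm z).
  rewrite mem_set//; apply: cvg_near_cst; near=> j.
  rewrite indicE mem_set//; near: j.
  by have /cvgr_lt := r_cvg; apply.
rewrite memNset; last by apply/negP; rewrite -leNgt.
apply: cvg_near_cst; near=> j; rewrite indicE memNset//.
by apply/negP; rewrite -leNgt; exact: le_trans z0 (ltW (r_gt0 j)).
Unshelve. all: by end_near. Qed.

(** Both x and x + z must be good at time t; for fixed t and z the exceptional x lie in a null set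
    or in a translate of it. *)
Lemma jumps_cvg : {ae triple, forall p, jumps_ j p @[j --> \oo] --> jumps p}.
Proof.
pose A : set TVV := [set p | (`]0, T[%classic p.1 /\ G (p.2.1 + p.2.2, p.1)) /\ G (p.2.1, p.1)].
have mA : measurable A.
  apply: measurableI; [apply: measurableI|].
  - rewrite -[X in measurable X]setTI.
    exact: (@measurable_fst _ _ (measurableTypeR R) (V * V)%type measurableT _ (measurable_itv `]0, T[)).
  - by rewrite -[X in measurable X]setTI; exact: (measurable_TVV_shift measurableT G_meas).
  - by rewrite -[X in measurable X]setTI; exact: (measurable_TVV_base measurableT G_meas).
exists (~` A); split.
- exact: measurableC.
- apply: triple_null; first exact: measurableC.
  move=> t tT z; have [C [mC C0 GC]] := G_full tT.
  apply/eqP; rewrite eq_le measure_ge0 andbT.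
  apply: (@le_trans _ _ (leb (C `|` (fun x : V => x + z) @^-1` C))).
    apply: le_measure; rewrite ?inE.
    + rewrite -[X in measurable X]setTI.
      apply: (measurable_comp_fun (f := id) (g := fun x : V => (t, (x, z)) : TVV)) => //; last exact: measurableC.
      by apply: measurable_fun_pair => //; apply: measurable_fun_pair.
    + by apply: measurableU => //; rewrite -[X in measurable X]setTI; exact: measurable_shift.
    + move=> x /= nA; apply: contrapT => nC; apply: nA.
      have [nC1 nC2] : ~ C x /\ ~ C (x + z) by split => Cx; apply: nC; [left|right].
      have inG y : ~ C y -> G (y, t) by move=> nCy; apply: contrapT => nG; exact/nCy/GC.
      by split; [split; [rewrite /= in_itv|exact: inG]|exact: inG].
  have mCz : measurable ((fun x : V => x + z) @^-1` C).
    by rewrite -[X in measurable X]setTI; exact: measurable_shift.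
  have Cz0 : leb ((fun x : V => x + z) @^-1` C) = 0%E by rewrite lebesgue_rV_shift.
  by rewrite measureU0// le_eqVlt; apply/orP; left; apply/eqP; exact: C0.
- move=> p /= nH; apply: contra_not nH => -[[_ G1] G2].
  by apply: cvgM; [exact: far_cvg|apply: cvgB; exact: phi_U_cvg].
Qed.

(** On each time cell the inner integral is the form of the truncated measure, so the triple
    integral is the sum bounded by the discrete energy estimate. *)
Lemma jumps_energy_ j : (\int[triple]_p (jumps_ j p ^+ 2)%:E <= E%:E)%E.
Proof.
have mJ := measurable_jumps_ j.
rewrite (@triple_tonelli R N nu T (fun p => jumps_ j p ^+ 2)); last 2 first.
- exact: measurable_funX.
- by move=> p; exact: sqr_ge0.
pose a k := jump_form (trunc j) (v j k) (v j k).
have inner t : (\int[lnu]_q (jumps_ j (t, q) ^+ 2)%:E = (a (grid (mesh j) t))%:E)%E.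
  set k := grid _ t; have mv := integrable_measurable (v_int j k).
  have [Ji _ _] := jump_form_ibp (levy_restr_even nu_even nu_levy (r_gt0 j)) mv (v_bnd j k) (v_int j k).
  rewrite /a /jump_form -EFin_Rintegral// levy_restr_integral; last first.
    by apply/measurable_EFinP; exact: integrable_measurable Ji.
  rewrite [RHS]integral_mkcond; apply: eq_integral => q _; rewrite patchE in_setX in_setT/=.
  rewrite /jumps_/= indicE -/k; case: ifPn => _; first by rewrite mul1r expr2.
  by rewrite mul0r expr0n.
under eq_integral do rewrite inner.
have [ai aE] := step_time_integral a (mesh_gt0 j) (mesh_K j).
by rewrite EFin_Rintegral// aE lee_fin; exact: energy.
Qed.


Variable psi : V * R -> R.
Hypothesis psiT : test_function T psi.

(** Evaluating test functions at clipped times makes the bounds of [test_facts] available at every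
    real time. *)
Definition clip (t : R) : R := Num.max 0 (Num.min t T).

Lemma clip_itv t : 0 <= clip t <= T.
Proof.
by rewrite /clip le_max lexx/= ge_max ge_min lexx orbT andbT ltW.
Qed.

Lemma clip_id t : 0 <= t <= T -> clip t = t.
Proof. by move=> /andP[t0 tT]; rewrite /clip (min_idPl tT) (max_idPr t0). Qed.

Lemma clip_lip s h : 0 <= h -> clip s <= clip (s + h) <= clip s + h.
Proof.
have T1 := T0; move=> h0; rewrite /clip.
by case: (leP s T) => h1; case: (leP (s + h) T) => h2; case: (leP 0 T) => h3;
  case: (leP 0 s) => h4; case: (leP 0 (s + h)) => h5; apply/andP; split; lra.
Qed.

Lemma measurable_clip : measurable_fun setT clip.
Proof.
apply: measurable_maxr; first exact: measurable_cst.
by apply: measurable_minr; [exact: measurable_id|exact: measurable_cst].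
Qed.

Definition test_level j k (x : V) : R := psi (x, clip (k%:R * mesh j)).

(** Level k + 1 on cell k: summation by parts pairs the form of step k with the test function at
    level k + 1. *)
Definition test_jumps_ j (p : TVV) : R :=
  test_level j (grid (mesh j) p.1).+1 (p.2.1 + p.2.2) -
  test_level j (grid (mesh j) p.1).+1 p.2.1.

Definition test_jumps (p : TVV) : R :=
  psi (p.2.1 + p.2.2, clip p.1) - psi (p.2.1, clip p.1).

Definition test_slope_ j (p : TV) : R :=
  (test_level j (grid (mesh j) p.1).+1 p.2 - test_level j (grid (mesh j) p.1) p.2) / mesh j.

Definition test_slope (p : TV) : R :=
  \1_(`]0, T[%classic : set R) p.1 * time_derivative psi (p.2, p.1).

Lemma measurable_test_level j k : measurable_fun setT (test_level j k).
Proof.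
have mpsi := measurable_test psiT.
have H := measurable_fun_pair1 (f := psi) (clip (k%:R * mesh j)) mpsi.
exact: H.
Qed.

Lemma measurable_test_jumps_ j : measurable_fun setT (test_jumps_ j).
Proof.
have H := measurable_grid_swap j (fun k => measurable_jump_diff (measurable_test_level j k.+1)).
exact: H.
Qed.

Lemma measurable_test_jumps : measurable_fun setT test_jumps.
Proof.
have m : measurable_fun setT (fun p : V * R => psi (p.1, clip p.2)).
  apply: (measurable_comp_fun (f := psi) (g := fun p : V * R => (p.1, clip p.2))).
    exact: measurable_test psiT.
  apply: measurable_fun_pair; first exact: measurable_fst.
  by apply: (measurable_comp_fun (f := clip)) => //; exact: measurable_clip.
exact: (measurable_space_time_diff m).
Qed.

Lemma measurable_test_slope_ j : measurable_fun setT (test_slope_ j).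
Proof.
apply: (measurable_grid_swap j (f := fun k x => (test_level j k.+1 x - test_level j k x) / mesh j)) => k.
apply: measurable_funM; last exact: measurable_cst.
by apply: measurable_funB; exact: measurable_test_level.
Qed.

Lemma measurable_test_slope : measurable_fun setT test_slope.
Proof.
apply: measurable_funM.
  apply: (measurable_comp_fun (f := \1_(`]0, T[%classic : set (measurableTypeR R)) : measurableTypeR R -> R)
    (g := fun p : TV => p.1)); last exact: measurable_fst.
  by apply: measurable_indic; exact: measurable_itv.
apply: (measurable_comp_fun (f := time_derivative psi) (g := fun p : TV => (p.2, p.1))).
  exact: measurable_time_derivative psiT.
by apply: measurable_fun_pair; [exact: measurable_snd|exact: measurable_fst].
Qed.

Lemma grid_le j t : 0 <= t -> (grid (mesh j) t)%:R * mesh j <= t.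
Proof.
move=> t0; rewrite -ler_pdivlMr ?mesh_gt0// /grid.
by rewrite truncn_le ?divr_ge0// ltW// mesh_gt0.
Qed.

Lemma grid_gt j t : t < (grid (mesh j) t).+1%:R * mesh j.
Proof. by rewrite -ltr_pdivrMr ?mesh_gt0// /grid truncnS_gt. Qed.

Lemma gridS_le j t : 0 <= t < T -> (grid (mesh j) t).+1%:R * mesh j <= T.
Proof.
move=> /andP[t0 tT]; have m0 := mesh_gt0 j; have td0 : 0 <= t / mesh j by rewrite divr_ge0// ltW.
rewrite [leRHS](mesh_K j) ler_pM2r// ler_nat /grid truncn_lt_nat// ltr_pdivrMr//.
by rewrite -mesh_K.
Qed.

Lemma grid_cvg t : 0 <= t < T -> (grid (mesh j) t).+1%:R * mesh j @[j --> \oo] --> t.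
Proof.
move=> /andP[t0 tT]; apply/cvgrPdist_le => e e0.
have /cvgrPdist_le/(_ _ e0) H := mesh_cvg; near=> j.
have : `|0 - mesh j| <= e by near: j.
rewrite sub0r normrN gtr0_norm ?mesh_gt0// => me.
have h1 := grid_le j t0; have h2 := grid_gt j t.
rewrite -natr1 mulrDl mul1r in h2 *; rewrite ltr0_norm; lra.
Unshelve. all: by end_near. Qed.

Lemma test_jumps_cvg : {ae triple, forall p, test_jumps_ j p @[j --> \oo] --> test_jumps p}.
Proof.
pose A : set TVV := [set p | `]0, T[%classic p.1].
have mA : measurable A.
  rewrite -[X in measurable X]setTI.
  exact: (@measurable_fst _ _ (measurableTypeR R) (V * V)%type measurableT _ (measurable_itv `]0, T[)).
exists (~` A); split; first exact: measurableC.
  apply: triple_null; first exact: measurableC.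
  move=> t tT z; rewrite (_ : [set _ | _] = set0) ?measure0//.
  by rewrite -subset0 => x /=; apply; rewrite /A/= in_itv.
move=> [t [x z]] /= nH; apply: contra_not nH; rewrite /A/= in_itv/= => tT.
have tT' : 0 <= t <= T by case/andP: tT => *; rewrite !ltW.
have lim (y : V) : test_level j (grid (mesh j) t).+1 y @[j --> \oo] --> psi (y, clip t).
  apply: (@continuous_cvg nat R R \oo _ (fun j => clip ((grid (mesh j) t).+1%:R * mesh j))
    (fun s : R => psi (y, s)) (clip t)).
    have [+ _] := test_time_line psiT y (clip t).
    by move=> /derivable1_diffP/differentiable_continuous.
  rewrite clip_id//; have c := @grid_cvg t; apply: cvg_trans (c _); last by case/andP: tT => ? ->; rewrite ltW.
  apply: near_eq_cvg; near=> j; rewrite clip_id//.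
  rewrite gridS_le ?andbT; last by case/andP: tT => ? ->; rewrite ltW.
  by rewrite mulr_ge0// ltW// mesh_gt0.
by apply: cvgB; exact: lim.
Unshelve. all: by end_near. Qed.

Lemma test_mvt (x : V) (a b : R) : 0 <= a -> a < b -> b <= T ->
  exists2 c, a < c < b & psi (x, b) - psi (x, a) = time_derivative psi (x, c) * (b - a).
Proof.
move=> a0 ab bT.
have D (t : R) : is_derive t 1 (fun t => psi (x, t)) (time_derivative psi (x, t)).
  by rewrite (test_time_derivative psiT); exact: test_time_line psiT x t.
have cD : {within `[a, b], continuous (fun t => psi (x, t))}.
  by apply: derivable_within_continuous => t _; have [] := D t.
have [c cab ->] := MVT ab (fun t _ => D t) cD.
by exists c => //; move: cab; rewrite in_itv.
Qed.

(** By the mean value theorem the difference quotient is the time derivative at a point less than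
    one mesh width away from t. *)
Lemma test_slope_cvg : {ae (time \x leb)%E, forall p, test_slope_ j p @[j --> \oo] --> test_slope p}.
Proof.
pose A : set TV := [set p | `]0, T[%classic p.1].
have mA : measurable A.
  rewrite -[X in measurable X]setTI.
  exact: (@measurable_fst _ _ (measurableTypeR R) V measurableT _ (measurable_itv `]0, T[)).
exists (~` A); split; first exact: measurableC.
  apply: time_prod_null; first exact: measurableC.
  move=> t tT; rewrite (_ : [set _ | _] = set0) ?measure0//.
  by rewrite -subset0 => x /=; apply; rewrite /A/= in_itv.
move=> [t x] /= nH; apply: contra_not nH; rewrite /A/= in_itv/= => tT.
rewrite /test_slope/= indicE mem_set/= ?in_itv// mul1r.
have [t0 tT'] := andP tT.
apply/cvgrPdist_le => e e0.
have : nbhs t [set s | `|time_derivative psi (x, t) - time_derivative psi (x, s)| <= e].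
  have /cvgrPdist_le := @test_derive_continuous R N T psi psiT ((0 : V), (1 : R)) (x, t).
  move=> /(_ _ e0) /nbhs_ballP[d /= d0 dH]; apply/nbhs_ballP; exists d => // s ts.
  rewrite /= !(test_time_derivative psiT); apply: dH; split => //=; exact: ballxx.
move=> /nbhs_ballP[d /= d0 dH].
have /cvgrPdist_lt/(_ _ d0) H := mesh_cvg; near=> j.
have : `|0 - mesh j| < d by near: j.
have m0 := mesh_gt0 j.
rewrite sub0r normrN gtr0_norm// => md.
have h1 := grid_le j (ltW t0); have h2 := grid_gt j t.
have tT0 : 0 <= t < T by rewrite ltW.
have h3 := gridS_le j tT0.
rewrite /test_slope_ /test_level/=; move: (grid (mesh j) t) h1 h2 h3 => k h1 h2 h3.
have k0 : 0 <= k%:R * mesh j by rewrite mulr_ge0// ltW.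
have h4 : k.+1%:R * mesh j = k%:R * mesh j + mesh j by rewrite -natr1 mulrDl mul1r.
rewrite !clip_id; [|by apply/andP; split; lra|by apply/andP; split; lra].
have kk : k%:R * mesh j < k.+1%:R * mesh j by rewrite h4 ltrDl.
have [c /andP[c1 c2] ->] := test_mvt x k0 kk h3.
rewrite h4 addrAC subrr add0r mulfK ?gt_eqF//.
apply: (dH c); rewrite -ball_normE/=/ball_/= ltr_norml; apply/andP; split; lra.
Unshelve. all: by end_near. Qed.

Lemma jumps_test_jumps j t : (forall j k, Rintegrable leb (test_level j k)) ->
  \int[lnu]_q (jumps_ j (t, q) * test_jumps_ j (t, q)) =
  jump_form (trunc j) (v j (grid (mesh j) t)) (test_level j (grid (mesh j) t).+1).
Proof.
move=> level_i; set k := grid _ t; have mv := integrable_measurable (v_int j k).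
have [Ji _ _] := jump_form_ibp (levy_restr_even nu_even nu_levy (r_gt0 j)) mv (v_bnd j k) (level_i j k.+1).
rewrite /jump_form levy_restr_Rintegral; last exact: integrable_measurable Ji.
apply: eq_Rintegral => q _; rewrite /jumps_ /test_jumps_ /= -/k.
by rewrite [RHS]mulrC mulrA.
Qed.

(** [weak_limit] applies twice: to the jumps, dominated by means of the Levy condition, and to [u]
    times the slope of [psi]. The discrete identity [step] holds for every j, so its limit is the
    equation. *)
Lemma test_limit :
  [/\ Rintegrable triple (fun p => jumps p * test_jumps p),
      Rintegrable (time \x leb)%E (fun p => u (p.2, p.1) * test_slope p) &
      \int[(time \x leb)%E]_p (u (p.2, p.1) * test_slope p) -
      2^-1 * \int[triple]_p (jumps p * test_jumps p) +
      \int[leb]_x (u0 x * psi (x, 0)) = 0].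
Proof.
have [r [C [C0 psir psiC psiL psit]]] := test_facts T0 psiT.
pose S := [set x : V | `|x| <= r].
have mS : measurable S by exact: measurable_rV_cball.
have Sfin : (leb S < +oo)%E by exact: lebesgue_rV_bounded.
have nS x : ~ S x -> r < `|x| by move=> /negP; rewrite -ltNge.
have M0 : 0 <= M by exact: le_trans (normr_ge0 _) (u_bnd 0).
have diffH t (q : V * V) : 0 <= t <= T ->
    (psi (q.1 + q.2, t) - psi (q.1, t)) ^+ 2 <= 4 * C ^+ 2 * levy_dom S q.
  move=> tT; apply: (@diff_sqr_le R N (fun x => psi (x, t)) C S q.1 q.2).
  - by move=> x; exact: psiC.
  - by move=> x z; exact: psiL.
  - by move=> x /nS; exact: psir.
have Hi : Rintegrable triple (fun p => 4 * C ^+ 2 * levy_dom S p.2).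
  by apply: RintegrableZ; apply: Rintegrable_time_snd; exact: Rintegrable_levy_dom.
have [_ Bi B_i Bcvg] := @weak_limit _ _ R triple jumps_ test_jumps_ jumps test_jumps
  (fun p => 4 * C ^+ 2 * levy_dom S p.2) E measurable_jumps_ measurable_jumps
  measurable_test_jumps_ measurable_test_jumps jumps_cvg test_jumps_cvg jumps_energy_
  (fun j p => diffH _ p.2 (clip_itv _)) (fun p => diffH _ p.2 (clip_itv _)) Hi.
have ind_i : Rintegrable leb (\1_S : V -> R).
  by apply: ge0_Rintegrable => //; rewrite integral_indic// setIT.
have H2i : Rintegrable (time \x leb)%E (fun p => C ^+ 2 * \1_S p.2).
  by apply: RintegrableZ; exact: (Rintegrable_time_snd T ind_i).
have M2i : Rintegrable (time \x leb)%E (fun p => M ^+ 2 * \1_S p.2).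
  by apply: RintegrableZ; exact: (Rintegrable_time_snd T ind_i).
(* Cutting to the ball [S] gives the bounded functions a uniform L2 bound; the slopes vanish off
   [S], so the products are unchanged. *)
pose F2_ j (p : TV) := \1_S p.2 * U j (grid (mesh j) p.1) p.2.
pose F2 (p : TV) := \1_S p.2 * u (p.2, p.1).
have mind : measurable_fun setT (fun p : TV => \1_S p.2 : R).
  by apply: (measurable_comp_fun (f := \1_S : V -> R)) => //; exact: measurable_indic.
have mF2_ j : measurable_fun setT (F2_ j).
  by apply: measurable_funM => //; exact: (measurable_grid_swap j (U_meas j)).
have mswap : measurable_fun setT (fun p : TV => (p.2, p.1)).
  by apply: measurable_fun_pair; [exact: measurable_snd|exact: measurable_fst].
have mF2 : measurable_fun setT F2.
  by apply: measurable_funM => //; exact: (measurable_comp_fun u_meas mswap).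
have F2cvg : {ae (time \x leb)%E, forall p, F2_ j p @[j --> \oo] --> F2 p}.
  pose A : set TV := [set p | G (p.2, p.1)].
  have mA : measurable A by rewrite -[X in measurable X]setTI; exact: (mswap measurableT _ G_meas).
  exists (~` A); split; first exact: measurableC.
    apply: time_prod_null; first exact: measurableC.
    move=> t tT; have [D [mD D0 GD]] := G_full tT.
    apply/eqP; rewrite eq_le measure_ge0 andbT.
    rewrite -[X in (_ <= X)%E]D0; apply: le_measure; rewrite ?inE.
    - rewrite -[X in measurable X]setTI.
      apply: (measurable_comp_fun (f := id) (g := fun x : V => (t, x) : TV)) => //; last exact: measurableC.
      exact: measurable_fun_pair.
    - exact: mD.
    - by move=> x; exact: GD.
  move=> p /= nH; apply: contra_not nH => Gp.
  by apply: cvgM; [exact: cvg_cst|exact: (u_cvg Gp)].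
have F2bnd j : (\int[time \x leb]_p (F2_ j p ^+ 2)%:E <=
    (\int[(time \x leb)%E]_p (M ^+ 2 * \1_S p.2))%:E)%E.
  rewrite -EFin_Rintegral//.
  have mF : measurable_fun setT (fun p => (F2_ j p ^+ 2)%:E).
    by apply/measurable_EFinP; exact: measurable_funX.
  have mMS : measurable_fun setT (fun p : TV => (M ^+ 2 * \1_S p.2)%:E).
    by apply/measurable_EFinP; exact: integrable_measurable M2i.
  apply: ge0_le_integral => //.
  - by move=> p _; rewrite lee_fin sqr_ge0.
  move=> p _; rewrite lee_fin /F2_ indicE; case: (_ \in _); last by rewrite mul0r expr0n mulr0.
  by rewrite mul1r mulr1 -real_normK ?num_real// ler_sqr ?nnegrE.
have level0 j k x : ~ S x -> test_level j k x = 0.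
  by move=> /nS rx; apply: psir => //; exact: clip_itv.
have slope_le j p : test_slope_ j p ^+ 2 <= C ^+ 2 * \1_S p.2.
  rewrite indicE; have [Sp|nSp] := pselect (S p.2); last first.
    by rewrite /test_slope_ !level0// subrr mul0r expr0n memNset// mulr0.
  rewrite mem_set// mulr1 -real_normK ?num_real// ler_sqr ?nnegrE//.
  have m0 := mesh_gt0 j.
  rewrite /test_slope_ normrM normfV (gtr0_norm m0) ler_pdivrMr//.
  rewrite /test_level; set k := grid _ _.
  (* Clipping can only shorten the time increment; if it collapses to a point, the slope is 0. *)
  have ab : clip (k%:R * mesh j) <= clip (k.+1%:R * mesh j) <= clip (k%:R * mesh j) + mesh j.
    have -> : k.+1%:R * mesh j = k%:R * mesh j + mesh j by rewrite -natr1 mulrDl mul1r.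
    exact: clip_lip (ltW m0).
  have := clip_itv (k%:R * mesh j); have := clip_itv (k.+1%:R * mesh j); move: ab.
  set a := clip (k%:R * _); set b := clip (k.+1%:R * _) => /andP[ab ba] /andP[b0 bT] /andP[a0 aT].
  move: ab; rewrite le_eqVlt => /predU1P[->|ab]; first by rewrite subrr normr0 mulr_ge0// ltW.
  have [c /andP[ac cb] ->] := test_mvt p.2 a0 ab bT.
  have cT : 0 < c < T by apply/andP; split; lra.
  rewrite normrM ler_pM//; first by have [] := psit p.2 c cT.
  by rewrite ger0_norm; lra.
have slope_lim_le p : test_slope p ^+ 2 <= C ^+ 2 * \1_S p.2.
  rewrite /test_slope [\1__ p.1]indicE; case: (boolP (p.1 \in _)) => /= [|_]; last first.
    by rewrite mul0r expr0n mulr_ge0 ?sqr_ge0.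
  rewrite inE/= in_itv/= => tT; have [pC p0] := psit p.2 p.1 tT.
  rewrite mul1r indicE; have [Sp|nSp] := pselect (S p.2); last first.
    by rewrite p0 ?expr0n ?mulr_ge0 ?sqr_ge0//; exact: nS.
  by rewrite mem_set// mulr1 -real_normK ?num_real// ler_sqr ?nnegrE.
have [_ Ai A_i Acvg] := @weak_limit _ _ R (time \x leb)%E F2_ test_slope_ F2 test_slope
  (fun p => C ^+ 2 * \1_S p.2) _ mF2_ mF2
  measurable_test_slope_ measurable_test_slope F2cvg test_slope_cvg F2bnd slope_le slope_lim_le H2i.
have F2E p : F2 p * test_slope p = u (p.2, p.1) * test_slope p.
  rewrite /F2 indicE; have [Sp|nSp] := pselect (S p.2); first by rewrite mem_set// mul1r.
  have /eqP : test_slope p ^+ 2 <= 0.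
    by apply: le_trans (slope_lim_le p) _; rewrite indicE memNset// mulr0.
  rewrite le_eqVlt ltNge sqr_ge0 orbF => /eqP; rewrite sqrf_eq0 => /eqP ->.
  by rewrite !mulr0.
have -> : (fun p => u (p.2, p.1) * test_slope p) = (fun p => F2 p * test_slope p).
  by apply/funext => p; rewrite F2E.
split=> //.
have level_i j k : Rintegrable leb (test_level j k).
  apply: (Rintegrable_le (g := fun x => C * \1_S x)); first exact: measurable_test_level.
  - move=> x; rewrite indicE; have [Sx|nSx] := pselect (S x); last first.
      by rewrite level0// normr0 mulr_ge0.
    by rewrite mem_set// mulr1; apply: psiC; exact: clip_itv.
  - exact: RintegrableZ.
have step j : \int[(time \x leb)%E]_p (F2_ j p * test_slope_ j p) -
    2^-1 * \int[triple]_p (jumps_ j p * test_jumps_ j p) +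
    \int[leb]_x (u0 x * psi (x, 0)) = 0.
  have := @weak_sum j _ (level_i j).
  (* The boundary term of the summation by parts sits at time T, where psi vanishes. *)
  have -> : \int[leb]_x (U j (K_ j) x * test_level j (K_ j) x) = 0.
    rewrite /Rintegral integral0_eq// => x _; rewrite /test_level -mesh_K clip_id ?lexx ?ltW//.
    by rewrite (test_end T0 psiT) mulr0.
  have -> : (fun x => u0 x * test_level j 0 x) = (fun x => u0 x * psi (x, 0)).
    by apply/funext => x; rewrite /test_level mul0r clip_id// lexx ltW.
  move=> H; apply: etrans H; congr (_ - _ + _).
  - rewrite Rfubini//.
    pose a k := \int[leb]_x (U j k x * ((test_level j k.+1 x - test_level j k x) / mesh j)).
    have [_ aE] := step_time_integral a (mesh_gt0 j) (mesh_K j).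
    transitivity (\int[time]_t a (grid (mesh j) t)).
      apply: eq_Rintegral => t _; apply: eq_Rintegral => x _.
      rewrite /F2_/= indicE; have [Sx|nSx] := pselect (S x); first by rewrite mem_set// mul1r.
      by rewrite /test_slope_/= !level0// subrr mul0r !mulr0.
    rewrite aE; apply: eq_bigr => k _; rewrite /a.
    rewrite -RintegralZl//; first last.
      have mU := U_meas j k.
      apply: (Rintegrable_mul_bounded mU (U_bnd j k)).
      have := RintegrableZ (mesh j)^-1 (RintegrableB (level_i j k.+1) (level_i j k)).
      by under eq_fun do rewrite mulrC.
    apply: eq_Rintegral => x _.
    by field; rewrite gt_eqF ?mesh_gt0.
  - rewrite Rfubini//.
    pose b k := jump_form (trunc j) (v j k) (test_level j k.+1).
    have [_ bE] := step_time_integral b (mesh_gt0 j) (mesh_K j).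
    transitivity (2^-1 * \int[time]_t b (grid (mesh j) t)).
      apply: (congr1 (fun s : R => 2^-1 * s)).
      apply: eq_Rintegral.
      move=> t _.
      have H1 := jumps_test_jumps j t level_i.
      exact: H1.
    by rewrite bE mulr_sumr; apply: eq_bigr => k _; rewrite mulrCA.
have lim : \int[(time \x leb)%E]_p (F2_ j p * test_slope_ j p) -
    2^-1 * \int[triple]_p (jumps_ j p * test_jumps_ j p) +
    \int[leb]_x (u0 x * psi (x, 0)) @[j --> \oo] -->
    \int[(time \x leb)%E]_p (F2 p * test_slope p) -
    2^-1 * \int[triple]_p (jumps p * test_jumps p) +
    \int[leb]_x (u0 x * psi (x, 0)).
  apply: cvgD; last exact: cvg_cst.
  by apply: cvgB => //; apply: cvgM => //; exact: cvg_cst.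
move: lim; under eq_fun do rewrite step.
have c0 : (fun _ : nat => 0 : R) @ \oo --> (0 : R) by exact: cvg_cst.
by move=> /(cvg_unique (@Rhausdorff R) c0)/= <-.
Qed.

End limit_passage.

(** * Existence for an everywhere bounded datum and normalised phi *)

Section core.
Variables (R : realType) (N : nat).
Notation V := 'rV[R]_N.
Notation leb := (lebesgue_rV R N).
Variable nu : {sigma_finite_measure set V -> \bar R}.
Hypothesis nu_even : forall A : set V, measurable A ->
  nu ((fun z : V => - z) @^-1` A) = nu A.
Hypothesis nu_levy : (\int[nu]_z (kappa z)%:E < +oo)%E.
Variables (T M : R) (phi : R -> R) (u0 : V -> R).
Hypothesis T0 : 0 < T.
Hypothesis phi_cont : continuous phi.
Hypothesis phi_nd : {homo phi : r s / r <= s}.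
Hypothesis phi0 : phi 0 = 0.
Hypothesis u0i : Rintegrable leb u0.
Hypothesis u0M : forall x, `|u0 x| <= M.

(** The Lipschitz constants may grow with n; the time steps are chosen after them. *)
Lemma nonexpansive_approximants : exists phi_ : nat -> R -> R, exists Lip_ : nat -> R,
  [/\ forall n, {homo phi_ n : r s / r <= s}, forall n, phi_ n 0 = 0,
      forall n s t, `|phi_ n s - phi_ n t| <= Lip_ n * `|s - t| &
      forall n s, `|s| <= M -> `|phi_ n s - phi s| <= n.+1%:R^-1].
Proof.
have M0 : 0 <= M by exact: le_trans (normr_ge0 _) (u0M 0).
have H n := lipschitz_approximation phi_cont phi_nd M0 phi0 (natSinv_gt0 R n).
have [phi_ H1] := choice H; have [Lip_ H2] := choice H1.
by exists phi_, Lip_; split=> n; have [] := H2 n.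
Qed.

Lemma exists_time_steps (L : nat -> R) : exists K_ : nat -> nat,
  [/\ forall n, (0 < K_ n)%N, forall n, time_step T K_ n <= n.+1%:R^-1 &
      forall n, 4 * (time_step T K_ n * L n * mass (trunc_levy nu_levy n)) <= 1].
Proof.
(* The first summand forces the time step below 1/(n+1), the second forces the CFL condition. *)
pose a n := T * n.+1%:R + 4 * (T * `|L n| * mass (trunc_levy nu_levy n)).
have m0 n : 0 <= mass (trunc_levy nu_levy n) by rewrite fine_ge0.
have a2 n : 0 <= 4 * (T * `|L n| * mass (trunc_levy nu_levy n)).
  by rewrite !mulr_ge0// ltW.
have a1 n : 0 <= T * n.+1%:R by rewrite mulr_ge0// ltW.
exists (fun n => (Num.truncn (a n)).+1); split=> n //.
  rewrite /time_step ler_pdivrMr// mulrC ler_pdivlMr//.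
  by apply: le_trans (ltW (truncnS_gt _)); rewrite /a lerDl.
have K0 : 0 < (Num.truncn (a n)).+1%:R :> R by [].
have aK : a n <= (Num.truncn (a n)).+1%:R by exact/ltW/truncnS_gt.
rewrite /time_step (_ : 4 * _ = 4 * (T * L n * mass (trunc_levy nu_levy n)) / (Num.truncn (a n)).+1%:R); last first.
  by field; rewrite addrC natr1 gt_eqF.
rewrite ler_pdivrMr// mul1r; apply: le_trans aK.
apply: le_trans (_ : 4 * (T * `|L n| * mass (trunc_levy nu_levy n)) <= _); last by rewrite /a lerDr.
rewrite ler_pM2l// ler_wpM2r// ler_wpM2l ?ler_norm// ltW//.
Qed.

Lemma core_solution : exists u : V * R -> R, exists E : R,
  [/\ measurable_fun setT u /\ (forall p, `|u p| <= M),
      forall t, 0 <= t <= T ->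
        (\int[leb]_x `|u (x, t)|%:E <= \int[leb]_x `|u0 x|%:E)%E,
      forall r e, 0 < e -> exists2 tau, 0 < tau & forall s t,
        0 <= s <= T -> 0 <= t <= T -> `|t - s| < tau ->
        (locdist r (fun x => u (x, t)) (fun x => u (x, s)) <= e%:E)%E,
      (\int[time_measure T \x prod_measure leb nu]_p (jumps phi u p ^+ 2)%:E <= E%:E)%E &
      forall psi, test_function T psi ->
      [/\ Rintegrable (time_measure T \x prod_measure leb nu)%E
            (fun p => jumps phi u p * test_jumps T psi p),
          Rintegrable (time_measure T \x leb)%E (fun p => u (p.2, p.1) * test_slope T psi p) &
          \int[(time_measure T \x leb)%E]_p (u (p.2, p.1) * test_slope T psi p) -
          2^-1 * \int[(time_measure T \x prod_measure leb nu)%E]_p (jumps phi u p * test_jumps T psi p) +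
          \int[leb]_x (u0 x * psi (x, 0)) = 0]].
Proof.
have M0 : 0 <= M by exact: le_trans (normr_ge0 _) (u0M 0).
have [phi_ [Lip_ [pnd p0 plip papprox]]] := nonexpansive_approximants.
have [K_ [K0 Ksmall cfl]] := exists_time_steps Lip_.
(* On [-M, M] every approximant is within 1 of [phi]. *)
pose B := phi_sup phi M + 1.
have n1 (n : nat) : n.+1%:R^-1 <= 1 :> R by rewrite invf_le1// ler1n.
have pB n : phi_sup (phi_ n) M <= B.
  have hM := papprox n M; have hN := papprox n (- M); rewrite normrN ger0_norm// lexx in hM hN.
  move: (hM isT) (hN isT) (n1 n); rewrite !ler_norml => /andP[_ h4] /andP[h2 _] h1.
  have h6 : phi M <= phi_sup phi M by rewrite le_max lexx.
  have h7 : - phi (- M) <= phi_sup phi M by rewrite le_max lexx orbT.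
  rewrite {1}/phi_sup ge_max /B; move: (n.+1%:R^-1) (phi_sup phi M) h1 h2 h4 h6 h7 => i s.
  move: (phi_ n M) (phi_ n (- M)) (phi M) (phi (- M)) => a b c d *.
  by apply/andP; split; lra.
have [sigma [u [G [sig [mu mG] uM uG Gfull]]]] :=
  u_limit nu_even T0 u0i u0M pnd p0 plip pB K0 Ksmall cfl.
have mphi : measurable_fun setT phi.
  by apply: nondecreasing_measurable => // s t; exact: phi_nd.
have mu_ j t : measurable_fun setT (u_ nu_levy T u0 phi_ K_ (sigma j) t).
  exact: (U_measurable T0 u0i u0M pnd plip K0 cfl).
have mut t : measurable_fun setT (fun x => u (x, t)).
  exact: (measurable_fun_pair1 (f := u) t mu).
have sinv (e : R) : 0 < e -> \forall j \near \oo, (sigma j).+1%:R^-1 <= e.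
  move=> e0; have := near_infty_natSinv_lt (PosNum e0); apply: filterS => j /ltW.
  by apply: le_trans; rewrite lef_pV2 ?posrE// ler_nat ltnS.
pose r' j : R := (sigma j).+1%:R^-1.
have r0' j : 0 < r' j by exact: natSinv_gt0.
pose K' j := K_ (sigma j).
pose phi' j := phi_ (sigma j).
pose U' j := U nu_levy T u0 phi_ K_ (sigma j).
have rcvg : r' j @[j --> \oo] --> 0.
  apply/cvgr0Pnorm_le => e e0; apply: filterS (sinv _ e0) => j.
  by rewrite ger0_norm// ltW.
have meshcvg : mesh T K' j @[j --> \oo] --> 0.
  apply/cvgr0Pnorm_le => e e0; apply: filterS (sinv _ e0) => j.
  rewrite ger0_norm; first exact/le_trans/Ksmall.
  by rewrite /mesh divr_ge0// ltW.
have dn n : 0 <= time_step T K_ n by rewrite /time_step divr_ge0// ltW.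
have Umeas j k : measurable_fun setT (U' j k).
  exact: (U_measurable T0 u0i u0M pnd plip K0 cfl).
have Ubnd j k x : `|U' j k x| <= M by exact: (U_bounded T0 u0i u0M pnd plip K0 cfl).
have teven n := trunc_levy_even nu_even nu_levy n.
have v_int j k : Rintegrable leb (phi' j \o U' j k).
  exact: (iterate_phi_integrable (pnd _) (p0 _) (plip _) (dn _) (cfl _) u0i u0M).
have v_bnd j k x : `|(phi' j \o U' j k) x| <= B.
  by apply: le_trans (pB (sigma j)); exact: (phi_bounded (pnd _) (Ubnd j k x)).
have en j : \sum_(k < K' j) mesh T K' j * jump_form (levy_restr nu_levy (r0' j))
    (phi' j \o U' j k) (phi' j \o U' j k) <= energy_bound B u0.
  exact: (u_energy nu_even T0 u0i u0M pnd p0 plip pB K0 cfl).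
have wk j := iterate_weak_sum (teven (sigma j)) (pnd (sigma j)) (plip (sigma j)) (dn (sigma j))
  (cfl (sigma j)) u0i u0M (K_ (sigma j)).
have phicvg e : 0 < e -> \forall j \near \oo, forall s, `|s| <= M -> `|phi' j s - phi s| <= e.
  by move=> e0; apply: filterS (sinv _ e0) => j je s sM; apply: le_trans (papprox _ _ sM) je.
have ltW2 t : 0 < t < T -> 0 <= t <= T by move=> /andP[? ?]; rewrite !ltW.
exists u, (energy_bound B u0); split=> //.
(* The estimates are uniform in j, and Fatou's lemma passes them to the limit; here this works at
   every t, the slices of [G] being full. *)
- move=> t tT; apply: (@fatou_ae_le _ _ _ leb setT
      (fun j x => `|u_ nu_levy T u0 phi_ K_ (sigma j) t x|)) => //.
  + by move=> j; exact: measurableT_comp.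
  + exact: measurableT_comp.
  + by apply: filterS (Gfull t tT) => x Gx _; apply: cvg_norm; exact: (uG (x, t)).
  + by near=> j; exact: (u_L1 T0 u0i u0M pnd plip K0 cfl).
- move=> r e e0.
  have [tau tau0 [n0 Hn]] := u_locdist_time nu_even T0 u0i u0M pnd p0 plip pB K0 Ksmall cfl r e0.
  exists tau => // s t sT tT ts; apply: (@fatou_ae_le _ _ _ leb [set x : V | `|x| <= r]
      (fun j x => `|u_ nu_levy T u0 phi_ K_ (sigma j) t x - u_ nu_levy T u0 phi_ K_ (sigma j) s x|)) => //.
  + exact: measurable_rV_cball.
  + move=> j; apply: measurable_funTS; apply: measurableT_comp => //.
    exact: measurable_funB.
  + apply: measurable_funTS; apply: measurableT_comp => //.
    exact: measurable_funB.
  + apply: filterS2 (Gfull t tT) (Gfull s sT) => x Gt Gs _.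
    by apply: cvg_norm; apply: cvgB; [exact: (uG (x, t))|exact: (uG (x, s))].
  + near=> j; apply: Hn => //; apply: leq_trans (sig j).
    by near: j; exact: nbhs_infty_ge.
- apply: (@fatou_ae_le _ _ R (time_measure T \x prod_measure leb nu)%E setT
      (fun j p => jumps_ T r' K' phi' U' j p ^+ 2)) => //.
  + by move=> j; apply: measurable_funX; exact: (measurable_jumps_ T0 r' (fun j => K0 (sigma j)) v_int j).
  + by apply: measurable_funX; exact: (measurable_jumps mphi mu).
  + by move=> j p _; exact: sqr_ge0.
  + by move=> p _; exact: sqr_ge0.
  + have := jumps_cvg nu r0' rcvg Ubnd phi_cont phicvg mG uG (fun t tT => Gfull t (ltW2 t tT)).
    apply: filterS => p cp _; rewrite expr2; under eq_fun do rewrite expr2.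
    exact: cvgM.
  + by near=> j; exact: (jumps_energy_ nu_even T0 (fun j => K0 (sigma j)) v_int v_bnd en j).
- move=> psi psiT.
  exact: (@test_limit R N nu nu_even nu_levy T M (energy_bound B u0) u0 T0 r' K' phi' (fun=> B) U' r0'
    rcvg (fun j => K0 (sigma j)) meshcvg Umeas Ubnd v_int v_bnd en wk phi u G phi_cont mphi phicvg mu uM mG uG
    (fun t tT => Gfull t (ltW2 t tT)) psi psiT).
Unshelve. all: by end_near. Qed.

End core.

(** * Essential bounds, Levy measures and energy forms as in the statement *)

Section Lfun_infty.
Context d (X : measurableType d) (R : realType) (m : {measure set X -> \bar R}).

Lemma Lfun_infty_bound (f : X -> R) : f \in Lfun m +oo%E ->
  exists2 M, 0 <= M & {ae m, forall x, `|f x| <= M}.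
Proof.
rewrite inE => /andP[_]; rewrite inE/= /finite_norm unlock.
case: ifPn => [_|m0 _]; last first.
  (* If the whole space is null, any bound holds almost everywhere. *)
  exists 0 => //; exists setT; split => //.
  by apply/eqP; rewrite -measure_le0 leNgt.
set s := ess_sup _ _ => soo; exists (Num.max 0 (fine s)); first by rewrite le_max lexx.
have := ess_sup_ge m (abse \o (EFin \o f)); apply: filterS => x /= fs.
rewrite le_max; apply/orP; right; rewrite -lee_fin fineK//.
rewrite fin_numElt soo andbT; apply: lt_le_trans fs; exact: ltNyr.
Qed.

Lemma bounded_Lfun_infty (f : X -> R) (M : R) : measurable_fun setT f ->
  (forall x, `|f x| <= M) -> f \in Lfun m +oo%E.
Proof.
move=> mf fM; rewrite inE; apply/andP; split; rewrite inE//= /finite_norm unlock.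
case: ifPn => [_|//]; apply: le_lt_trans (ltry M).
by apply/ess_supP; apply: aeW => x /=; rewrite lee_fin.
Qed.

End Lfun_infty.

Section sigma_finite_alias.
Context d (X : measurableType d) (R : realType) (m : {measure set X -> \bar R}).
Hypothesis m_sf : sigma_finite setT m.

(** A copy of [m] indexed by the proof of sigma-finiteness, so that this proof can be packed into a
    structure. *)
Definition sigma_finite_alias of sigma_finite setT m : set X -> \bar R := m.

Local Notation m' := (sigma_finite_alias m_sf).

HB.instance Definition _ := Measure.on m'.

HB.instance Definition _ := Measure_isSigmaFinite.Build _ _ _ m' m_sf.

End sigma_finite_alias.

Section levy_measure.
Variables (R : realType) (N : nat).
Notation V := 'rV[R]_N.
Variable mu : {measure set V -> \bar R}.

Lemma levy_integrable_kappa : levy_integrable mu -> (\int[mu]_z (kappa z)%:E < +oo)%E.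
Proof.
rewrite /levy_integrable; set A := [set z | eucl_norm z <= 1]; set B := [set z | 1 < eucl_norm z].
have mB : measurable B by exact: measurable_far.
have AB : A = ~` B.
  by apply/seteqP; split => z /=; rewrite /A/B/=; [rewrite leNgt => /negP|move/negP; rewrite -leNgt].
have mA : measurable A by rewrite AB; exact: measurableC.
move=> H; rewrite (_ : setT = A `|` B); last by rewrite AB setUC setUv.
have mk : measurable_fun setT (fun z : V => (kappa z)%:E).
  by apply/measurable_EFinP; exact: measurable_kappa.
rewrite ge0_integral_setU//; first last.
- by rewrite AB; apply/disj_setPS; rewrite setICl.
- by move=> z _; rewrite lee_fin kappa_ge0.
- exact: (@measurable_funS _ _ _ _ setT).
apply: le_lt_trans H; apply: leeD; apply: ge0_le_integral => //.
- by move=> z _; rewrite lee_fin kappa_ge0.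
- exact: (@measurable_funS _ _ _ _ setT).
- apply: (@measurable_funS _ _ _ _ setT) => //.
  by apply/measurable_EFinP; apply: measurable_funX; exact: measurable_eucl_norm.
- by move=> z _; rewrite lee_fin /kappa ge_min lexx orbT.
- by move=> z _; rewrite lee_fin kappa_ge0.
- exact: (@measurable_funS _ _ _ _ setT).
- by move=> z _; rewrite lee_fin /kappa ge_min lexx.
Qed.

Lemma notfar0 : ~` far 0 = [set 0 : V].
Proof.
apply/seteqP; split => z /=; last first.
  move=> ->; rewrite /far/= /eucl_norm big1 ?sqrtr0 ?ltxx// => i _.
  by rewrite mxE expr0n.
move=> /negP; rewrite -leNgt => z0; apply/eqP; rewrite -normr_le0.
exact: le_trans (norm_le_eucl z) z0.
Qed.

(** The space is the union of {0}, which is null, and the sets |z| > 1/(n+1), which have finite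
    measure. *)
Lemma levy_sigma_finite : mu [set 0] = 0%E -> (\int[mu]_z (kappa z)%:E < +oo)%E ->
  sigma_finite setT mu.
Proof.
move=> mu0 muk; pose F (n : nat) : set V := ~` far 0 `|` far n.+1%:R^-1.
have m0 : measurable (~` (far 0 : set V)) by apply: measurableC; exact: measurable_far.
exists F.
  apply/esym; rewrite -subTset => z _; have [z0|z0] := ltP 0 (eucl_norm z); last first.
    by exists 0%N => //; left => /=; rewrite /far/= ltNge z0.
  have [n _ Hn] := near_infty_natSinv_lt (PosNum z0).
  by exists n => //; right; exact: (Hn n (leqnn n)).
move=> n; split; first by apply: measurableU => //; exact: measurable_far.
have z0 : mu (~` far 0) = 0%E by rewrite notfar0; exact: mu0.
have ff : (mu (far n.+1%:R^-1) < +oo)%E by apply: far_finite => //; rewrite invr_gt0.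
by rewrite /F setUC measureU0//; exact: measurable_far.
Qed.

Lemma even_measure_preimage : even_measure mu -> forall A : set V, measurable A ->
  mu ((fun z : V => - z) @^-1` A) = mu A.
Proof.
move=> ev A mA; rewrite [RHS]ev//; congr (mu _).
apply/seteqP; split => z /=.
  by move=> Az; exists (- z) => //; rewrite opprK.
by move=> [y Ay <-]; rewrite opprK.
Qed.

End levy_measure.

Section energy_form.
Variables (R : realType) (N : nat).
Notation V := 'rV[R]_N.
Notation leb := (lebesgue_rV R N).
Variable nu : {sigma_finite_measure set V -> \bar R}.

Definition form_integrand (f g : V * R -> R) (p : V * R * V) : R :=
  \1_(far 0) p.2 * ((f (p.1.1 + p.2, p.1.2) - f p.1) * (g (p.1.1 + p.2, p.1.2) - g p.1)).

Lemma measurable_form_integrand (f g : V * R -> R) : measurable_fun setT f -> measurable_fun setT g ->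
  measurable_fun setT (form_integrand f g).
Proof.
move=> mf mg.
have ms : measurable_fun setT (fun p : V * R * V => (p.1.1 + p.2, p.1.2)).
  apply: measurable_fun_pair; last by apply: measurableT_comp => //; exact: measurable_fst.
  apply: measurable_fun_rV => i; under eq_fun do rewrite mxE.
  apply: measurable_funD; apply: (measurable_comp_fun (f := fun x : V => x ord0 i));
    try exact: measurable_rV_coord.
  - by apply: measurableT_comp => //; exact: measurable_fst.
  - exact: measurable_snd.
have md (h : V * R -> R) : measurable_fun setT h ->
    measurable_fun setT (fun p : V * R * V => h (p.1.1 + p.2, p.1.2) - h p.1).
  move=> mh; apply: measurable_funB; first exact: (measurable_comp_fun mh ms).
  exact: (measurable_comp_fun mh measurable_fst).
apply: measurable_funM; last by apply: measurable_funM; [exact: (md f mf)|exact: (md g mg)].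
have mi : measurable_fun setT (\1_(far 0) : V -> R).
  by apply: measurable_indic; exact: measurable_far.
exact: (measurable_comp_fun mi (measurable_snd (T1 := (V * R)%type) (T2 := V))).
Qed.

Lemma energy_formE (f g : V * R -> R) t :
  energy_form nu (fun x => f (x, t)) (fun x => g (x, t)) =
  ((2^-1)%:E * \int[leb]_x \int[nu]_z (form_integrand f g (x, t, z))%:E)%E.
Proof.
rewrite /energy_form; congr (_ * _)%E; apply: eq_integral => x _.
rewrite integral_mkcond; apply: eq_integral => z _; rewrite patchE /form_integrand indicE/=.
by case: (_ \in _); rewrite ?mul1r ?mul0r.
Qed.

Lemma measurable_energy_form (f g : V * R -> R) :
  measurable_fun setT f -> measurable_fun setT g ->
  measurable_fun setT (fun t => energy_form nu (fun x => f (x, t)) (fun x => g (x, t))).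
Proof.
move=> mf mg; under eq_fun do rewrite energy_formE.
apply: measurable_funeM.
have mI : measurable_fun setT (fun p : V * R => (\int[nu]_z (form_integrand f g (p, z))%:E)%E).
  apply: (measurable_integral2 nu (f := fun p : V * R * V => (form_integrand f g p)%:E)).
  by apply/measurable_EFinP; exact: measurable_form_integrand.
apply: (measurable_integral2 leb (f := fun p : R * V => (\int[nu]_z (form_integrand f g (p.2, p.1, z))%:E)%E)).
apply: (measurable_comp_fun (f := fun p : V * R => (\int[nu]_z (form_integrand f g (p, z))%:E)%E)
  (g := fun p : R * V => (p.2, p.1))) => //.
by apply: measurable_fun_pair; [exact: measurable_snd|exact: measurable_fst].
Qed.

Variables (phi : R -> R) (u : V * R -> R) (T : R).
Hypothesis phi_meas : measurable_fun setT phi.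
Hypothesis u_meas : measurable_fun setT u.

Lemma energy_form_diag t :
  energy_form nu (fun x => phi (u (x, t))) (fun x => phi (u (x, t))) =
  ((2^-1)%:E * \int[prod_measure leb nu]_q (jumps phi u (t, q) ^+ 2)%:E)%E.
Proof.
rewrite (energy_formE (phi \o u) (phi \o u)); congr (_ * _)%E.
have mj : measurable_fun setT (fun q : V * V => (jumps phi u (t, q) ^+ 2)%:E).
  apply/measurable_EFinP; apply: measurable_funX.
  exact: (measurable_fun_pair2 (f := jumps phi u) t (measurable_jumps phi_meas u_meas)).
have j0 (q : V * V) : (0 <= (jumps phi u (t, q) ^+ 2)%:E)%E by rewrite lee_fin sqr_ge0.
apply/esym; apply: etrans (@fubini_tonelli1 _ _ _ _ R leb nu _ mj j0) _.
apply: eq_integral => x _; apply: eq_integral => z _; congr EFin.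
rewrite /jumps /form_integrand/= indicE; case: (_ \in _); rewrite ?mul1r ?mul0r ?expr0n//.
Qed.

(** The integrand is signed, so equality with the iterated integral needs integrability of the
    slice, which Fubini provides for almost every t. *)
Lemma energy_form_cross psi t : 0 < t < T ->
  Rintegrable (prod_measure leb nu) (fun q => jumps phi u (t, q) * test_jumps T psi (t, q)) ->
  energy_form nu (fun x => phi (u (x, t))) (fun x => psi (x, t)) =
  (2^-1 * \int[prod_measure leb nu]_q (jumps phi u (t, q) * test_jumps T psi (t, q)))%:E.
Proof.
move=> /andP[t0 tT] ji; rewrite (energy_formE (phi \o u) psi) EFinM; congr (_ * _)%E.
rewrite -EFin_Rintegral//.
apply/esym; apply: etrans (esym (@integral12_prod_meas1 _ _ _ _ R leb nu _ ji)) _.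
apply: eq_integral => x _; apply: eq_integral => z _; congr EFin.
by rewrite /jumps /test_jumps /form_integrand/= clip_id ?ltW// mulrA.
Qed.

End energy_form.

(** * From the limit identities to an energy solution *)

Section conversion.
Variables (R : realType) (N : nat).
Notation V := 'rV[R]_N.
Notation leb := (lebesgue_rV R N).
Variable nu : {sigma_finite_measure set V -> \bar R}.
Variables (T M : R) (phi : R -> R) (u : V * R -> R) (u0 : V -> R).
Hypothesis T0 : 0 < T.
Hypothesis phi_meas : measurable_fun setT phi.
Hypothesis u_meas : measurable_fun setT u.
Hypothesis u_bnd : forall p, `|u p| <= M.
Hypothesis u0i : Rintegrable leb u0.
Hypothesis u_L1 : forall t, 0 <= t <= T ->
  (\int[leb]_x `|u (x, t)|%:E <= \int[leb]_x `|u0 x|%:E)%E.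

Notation time := (time_measure T).
Notation lnu := (prod_measure leb nu).
Notation TV := (measurableTypeR R * V)%type.

Let measurable_slice t : measurable_fun setT (fun x => u (x, t)).
Proof. exact: (measurable_fun_pair1 (f := u) t u_meas). Qed.

Let measurable_swap : measurable_fun setT (fun p : TV => (p.2, p.1)).
Proof. by apply: measurable_fun_pair; [exact: measurable_snd|exact: measurable_fst]. Qed.

Lemma jumps_L2_energy (E : R) :
  (\int[time \x lnu]_p (jumps phi u p ^+ 2)%:E <= E%:E)%E -> L2_energy T nu (phi \o u).
Proof.
move=> HE; split; first by apply: measurable_funTS; exact: measurableT_comp.
have mj : measurable_fun setT (fun p => jumps phi u p ^+ 2).
  by apply: measurable_funX; exact: measurable_jumps.
have mphiu : measurable_fun setT (phi \o u) by exact: measurableT_comp.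
rewrite -time_measure_integral; last exact: (measurable_energy_form nu mphiu mphiu).
rewrite (eq_integral (fun t => (2^-1)%:E * \int[lnu]_q (jumps phi u (t, q) ^+ 2)%:E)%E); last first.
  by move=> t _; exact: energy_form_diag.
rewrite ge0_integralZl//; first last.
- by move=> t _; apply: integral_ge0 => q _; rewrite lee_fin sqr_ge0.
- apply: (measurable_integral2 lnu (f := fun p => (jumps phi u p ^+ 2)%:E)).
  exact/measurable_EFinP.
rewrite -(triple_tonelli nu T mj); last by move=> p; exact: sqr_ge0.
have i20 : (0 <= (2^-1)%:E :> \bar R)%E by rewrite lee_fin.
by apply: le_lt_trans (lee_wpmul2l i20 HE) _; rewrite -EFinM ltry.
Qed.

Lemma weak_form psi : test_function T psi ->
  Rintegrable (time \x lnu)%E (fun p => jumps phi u p * test_jumps T psi p) ->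
  Rintegrable (time \x leb)%E (fun p => u (p.2, p.1) * test_slope T psi p) ->
  \int[(time \x leb)%E]_p (u (p.2, p.1) * test_slope T psi p) -
  2^-1 * \int[(time \x lnu)%E]_p (jumps phi u p * test_jumps T psi p) +
  \int[leb]_x (u0 x * psi (x, 0)) = 0 ->
  (\int[lebesgue_measure]_(t in `]0%R, T[)
     (\int[leb]_x (u (x, t) * time_derivative psi (x, t))%:E
      - energy_form nu (fun x => phi (u (x, t))) (fun x => psi (x, t)))
   + \int[leb]_x (u0 x * psi (x, 0))%:E = 0)%E.
Proof.
move=> psiT ji si eq0.
have mphiu : measurable_fun setT (phi \o u) by exact: measurableT_comp.
have mpsi := measurable_test psiT.
have mdpsi := measurable_time_derivative psiT.
have me := measurable_energy_form nu mphiu mpsi.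
have ms : measurable_fun setT (fun t : R => \int[leb]_x (u (x, t) * time_derivative psi (x, t))%:E)%E.
  apply: (measurable_integral2 leb (f := fun p : R * V => (u (p.2, p.1) * time_derivative psi (p.2, p.1))%:E)).
  apply/measurable_EFinP; apply: measurable_funM.
    exact: (measurable_comp_fun u_meas measurable_swap).
  exact: (measurable_comp_fun mdpsi measurable_swap).
pose a t := \int[leb]_x (u (x, t) * test_slope T psi (t, x)).
pose b t := \int[lnu]_q (jumps phi u (t, q) * test_jumps T psi (t, q)).
have ai : Rintegrable time a by exact: (Rintegrable_fubini si).
have bi : Rintegrable time b by exact: (Rintegrable_fubini ji).
have abi : Rintegrable time (fun t => a t - 2^-1 * b t).
  by apply: RintegrableB => //; exact: RintegrableZ.
rewrite -(time_measure_integral T); last exact: emeasurable_funB.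
(* For almost every t both slices are integrable, and there the extended-real expression of the
   statement is the real number on the right. *)
rewrite (@ae_eq_integral _ _ _ time setT (fun t => (a t - 2^-1 * b t)%:E)%E)//; first last.
- have in_time : {ae time, forall t, 0 < t < T}.
    exists (~` `]0, T[%classic); split.
    + by apply: measurableC; exact: measurable_itv.
    + have -> : time (~` `]0, T[%classic) = lebesgue_measure (~` `]0, T[ `&` `]0, T[) by [].
      by rewrite setICl measure0.
    + by move=> t /= nt; rewrite in_itv.
  have := ae_integrable1 (m1 := time) (m2 := leb) si.
  have := ae_integrable1 (m1 := time) (m2 := lnu) ji.
  apply: (@filterS3 _ _ (ae_filter_ringOfSetsType time) _ _ _ _ _ in_time) => t tT jit sit _.
  rewrite (energy_form_cross tT jit) EFinB; congr (_ - _)%E.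
  rewrite /a -EFin_Rintegral//; apply: eq_integral => x _.
  by rewrite /test_slope/= indicE mem_set ?mul1r//= in_itv.
- by apply/measurable_EFinP; exact: integrable_measurable abi.
- exact: emeasurable_funB.
rewrite EFin_Rintegral// RintegralB//; last exact: RintegrableZ.
rewrite RintegralZl// -(Rfubini si) -(Rfubini ji).
have [r [C [_ _ psiC _ _]]] := test_facts T0 psiT.
have psiC0 x : `|psi (x, 0)| <= C by apply: psiC; rewrite lexx ltW.
have := Rintegrable_mul_bounded (measurable_fun_pair1 (f := psi) 0 mpsi) psiC0 u0i.
under eq_fun do rewrite mulrC.
by move=> /EFin_Rintegral ->; rewrite -EFinD eq0.
Qed.

(** Tonelli with time outside: every slice has L1 norm at most that of the datum, and the time
    interval has finite length. *)
Lemma integrable_Q : (lebesgue_rV_time R N).-integrable setT (EFin \o (u \_ (@Q_ R N T))).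
Proof.
have mQ : measurable (@Q_ R N T).
  by apply: measurableX => //; exact: measurable_itv.
have mu' : measurable_fun setT (u \_ (@Q_ R N T)).
  by apply/(measurable_restrict _ mQ measurableT); exact: measurable_funTS.
apply/integrableP; split; first exact/measurable_EFinP.
have mn : measurable_fun setT (fun p : V * measurableTypeR R => `|(u \_ (@Q_ R N T)) p|%:E).
  by apply/measurable_EFinP; exact: measurableT_comp.
have n0 (p : V * measurableTypeR R) : (0 <= `|(u \_ (@Q_ R N T)) p|%:E)%E by rewrite lee_fin.
rewrite (@fubini_tonelli2 _ _ _ _ R leb lebesgue_measure _ mn n0).
have I0 : 0 <= \int[leb]_x `|u0 x| by rewrite Rintegral_ge0.
apply: (@le_lt_trans _ _ (\int[lebesgue_measure]_t ((\int[leb]_x `|u0 x|) * \1_(`]0, T[%classic : set R) t)%:E)%E).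
  apply: ge0_le_integral => //.
  - by move=> t _; apply: integral_ge0 => x _; exact: n0.
  - exact: (measurable_fun_fubini_tonelli_G _ mn n0).
  - by apply/measurable_EFinP; apply: measurable_funM => //; exact: measurable_cst.
  move=> t _; rewrite indicE mem_setE /fubini_G; case: (boolP (t \in `]0, T[)) => tT /=.
    have tT' : 0 <= t <= T by move: tT; rewrite in_itv/= => /andP[? ?]; rewrite !ltW.
    rewrite mulr1 -EFin_Rintegral; last exact: Rintegrable_norm.
    apply: le_trans (u_L1 tT'); rewrite le_eqVlt; apply/orP; left; apply/eqP.
    by apply: eq_integral => x _; rewrite patchE mem_set.
  rewrite mulr0 integral0_eq// => x _; rewrite patchE memNset ?normr0//.
  by move=> [_ /= tin]; rewrite tin in tT.
under eq_integral do rewrite EFinM.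
rewrite ge0_integralZl//; last exact/measurable_EFinP.
by rewrite integral_indic// setIT lte_mul_pinfty//; exact: lebesgue_itvoo_lty.
Qed.

Lemma L1loc_slice t : 0 <= t <= T -> Rintegrable leb (fun x => u (x, t)).
Proof.
move=> tT; apply: Rintegrable_ltyP => //.
exact: le_lt_trans (u_L1 tT) (Rintegrable_lty u0i).
Qed.

Lemma compact_measurable_rV (K : set V) : compact K -> measurable K.
Proof.
move=> cK; rewrite -(setCK K); apply: measurableC; apply: open_measurable_rV.
by rewrite openC; apply: compact_closed => //; exact: norm_hausdorff.
Qed.

(** [u] is its own continuous representative, since the modulus in time holds between all times of
    [0, T], endpoints included; a compact set lies in some ball. *)
Lemma solution_C_L1loc :
  (forall r e, 0 < e -> exists2 tau, 0 < tau & forall s t,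
    0 <= s <= T -> 0 <= t <= T -> `|t - s| < tau ->
    (locdist r (fun x => u (x, t)) (fun x => u (x, s)) <= e%:E)%E) -> C_L1loc T u.
Proof.
move=> Hd; exists (fun t x => u (x, t)); split.
- move=> t tT; split => // K cK; have mK := compact_measurable_rV cK.
  exact: (integrableS measurableT mK _ (L1loc_slice tT)).
- move=> K s cK sT; have mK := compact_measurable_rV cK.
  have [r [_ Hr]] := compact_bounded cK.
  have Kr x : K x -> `|x| <= r + 1 by apply: Hr; rewrite ltrDl.
  have FF : Filter (within `[0%R, T] (nbhs s)) by exact: within_filter.
  apply/(@ge0_cvge0P R _ _ FF); first by move=> t; apply: integral_ge0 => x _; rewrite lee_fin.
  move=> e e0; have [tau tau0 Ht] := Hd (r + 1) e e0.
  have Hn : nbhs s [set t | `|s - t| < tau].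
    exact: (@cvgr_dist_lt R R^o R (nbhs s) _ id s (@cvg_id R (nbhs s)) tau tau0).
  apply: (@filterS R (nbhs s) _ _ _ _ Hn) => t st tT.
  apply: le_trans (Ht s t sT _ _); first last.
  + by rewrite distrC.
  + by move: tT; rewrite /= in_itv.
  apply: ge0_subset_integral => //.
  + exact: measurable_rV_cball.
  + apply/measurable_EFinP; apply: measurable_funTS; apply: measurableT_comp => //.
    exact: measurable_funB.
- by apply: aeW => t _; apply: aeW.
Qed.

Lemma solution_L1loc_Q : L1loc_Q T u.
Proof.
split; first exact: measurable_funTS.
have mQ : measurable (@Q_ R N T).
  by apply: measurableX => //; exact: measurable_itv.
move=> K KQ cK; have mK : measurable K.
  apply: closed_measurable_space_time; exact: compact_closed.
apply: (@integrableS _ _ _ (lebesgue_rV_time R N) (@Q_ R N T) K _ mQ mK KQ).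
rewrite integrable_mkcond//; have := integrable_Q; congr (is_true (_.-integrable _ _)).
by apply/funext => p; rewrite /= !patchE; case: ifP.
Qed.

End conversion.

Theorem corollary2p16 (R : realType) (N : nat) (hN : (0 < N)%N)
    (T : R) (hT : 0 < T)
    (phi : R -> R) (phi_cont : continuous phi)
    (phi_nd : {homo phi : r s / r <= s})
    (mu : {measure set 'rV[R]_N -> \bar R})
    (mu_radon : punctured_radon mu) (mu_even : even_measure mu)
    (mu_levy : levy_integrable mu)
    (u0 : 'rV[R]_N -> R)
    (u0_L1 : u0 \in Lfun (lebesgue_rV R N) 1%E)
    (u0_Loo : u0 \in Lfun (lebesgue_rV R N) +oo%E) :
  exists u : 'rV[R]_N * R -> R,
    [/\ energy_solution T phi mu u0 u,
        u \_ (@Q_ R N T) \in Lfun (lebesgue_rV_time R N) 1%E,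
        u \_ (@Q_ R N T) \in Lfun (lebesgue_rV_time R N) +oo%E &
        C_L1loc T u].
Proof.
have mu_kappa := levy_integrable_kappa mu_levy.
have mu_sf : sigma_finite setT mu by apply: levy_sigma_finite mu_kappa; case: mu_radon.
pose nu : {sigma_finite_measure set 'rV[R]_N -> \bar R} := sigma_finite_alias mu_sf.
have nu_even : forall A : set 'rV[R]_N, measurable A -> nu ((fun z => - z) @^-1` A) = nu A.
  exact: even_measure_preimage mu_even.
have nu_levy : (\int[nu]_z (kappa z)%:E < +oo)%E by exact: mu_kappa.
have u0i : Rintegrable (lebesgue_rV R N) u0 by apply/Lfun1_integrable.
have mu0 := integrable_measurable u0i.
have [M M0 u0M] := Lfun_infty_bound u0_Loo.
(* The bound on [u0] holds only almost everywhere; the clamp gives a version bounded everywhere, and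
   it is integrable because [clamp] is 1-Lipschitz and fixes 0. *)
pose w0 := clamp M \o u0.
have mclamp : measurable_fun setT (clamp M).
  by apply: nondecreasing_measurable => // r s; exact: clamp_nd.
have mw0 : measurable_fun setT w0 by exact: measurableT_comp.
have clamp0 : clamp M 0 = 0 by rewrite clamp_id// normr0.
have w0M x : `|w0 x| <= M by exact: clamp_bounded.
have w0i : Rintegrable (lebesgue_rV R N) w0.
  apply: (Rintegrable_le mw0 (g := fun x => `|u0 x|)); last exact: Rintegrable_norm.
  by move=> x; have := clamp_dist M (u0 x) 0; rewrite clamp0 !subr0.
(* Only increments of [phi] enter the energy form, so a solution for [phi'] is one for [phi]. *)
pose phi' s := phi s - phi 0.
have phi'_cont : continuous phi' by move=> s; apply: cvgB; [exact: phi_cont|exact: cvg_cst].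
have phi'_nd : {homo phi' : r s / r <= s} by move=> r s rs; rewrite lerD2r phi_nd.
have phi'0 : phi' 0 = 0 by rewrite /phi' subrr.
have mphi : measurable_fun setT phi by apply: nondecreasing_measurable => // r s; exact: phi_nd.
have [u [E [[mu_ uM] uL1 ut uE uw]]] :=
  core_solution nu_even nu_levy hT phi'_cont phi'_nd phi'0 w0i w0M.
have jumpsE : jumps phi' u = jumps phi u.
  by apply/funext => p; rewrite /jumps /phi' opprB addrA subrK.
rewrite jumpsE in uE uw.
have Qi := integrable_Q mu_ w0i uL1.
exists u; split.
- split; [exact: (solution_L1loc_Q mu_ w0i uL1)|exact: (jumps_L2_energy (nu := nu) mphi mu_ uE)|].
  move=> psi psiT; have [ji si eq0] := uw psi psiT.
  have := weak_form hT mphi mu_ w0i psiT ji si eq0.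
  have mpsi := measurable_fun_pair1 (f := psi) 0 (measurable_test psiT).
  (* In the initial term [w0] may be replaced by [u0], as they agree almost everywhere. *)
  rewrite (@ae_eq_integral _ _ _ (lebesgue_rV R N) setT (fun x => (u0 x * psi (x, 0))%:E)%E)//.
  + by apply/measurable_EFinP; exact: measurable_funM.
  + by apply/measurable_EFinP; exact: measurable_funM.
  + by apply: filterS u0M => x u0x _; rewrite /w0/= clamp_id.
- exact/Lfun1_integrable.
- apply: (@bounded_Lfun_infty _ _ R _ _ M); last first.
    by move=> p; rewrite patchE; case: ifP => // _; rewrite normr0.
  have /integrableP[/measurable_EFinP] := Qi; exact.
- exact: (solution_C_L1loc mu_ w0i uL1).
Qed.
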